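(* Let $G \in \mathfrak{K}$ and let $X$ be a $p$-permutation $\mathbb{F}G$-module. Then, in $\mathbb{K}T(G)$, $$[X] = \frac{1}{|G|} \sum_{U, V \leq G} |U| \, \mu(U, V) \ {}_G\mathrm{ind}_U\big({}_U\mathrm{res}_V(\pi_V({}_V\mathrm{res}_G[X]))\big) .$$
   Context: $p$ is a prime, $\mathbb{F}$ is an algebraically closed field of characteristic $p$, all groups are finite and all $\mathbb{F}G$-modules are finite-dimensional. $\mathfrak{K}$ is a class of finite groups closed under taking subgroups. $\mathbb{K}$ is a field of characteristic zero that is a splitting field for all groups in $\mathfrak{K}$. The same symbol is used for a linear map and for its extension to a larger coefficient ring. A $p$-permutation $\mathbb{F}G$-module is a direct summand of a permutation $\mathbb{F}G$-module. An indecomposable $\mathbb{F}G$-module is exprojective if, up to isomorphism, it is inflated from a projective $\mathbb{F}G/K$-module for some normal subgroup $K \unlhd G$ (equivalently, it is a direct summand of the permutation module $\mathbb{F}G/K$ for some $K \unlhd G$). A general $\mathbb{F}G$-module is exprojective if all its indecomposable direct summands are. $T(G)$ is the Grothendieck ring of the category of $p$-permutation $\mathbb{F}G$-modules with respect to split short exact sequences, with multiplication given by $\otimes_{\mathbb{F}}$; $[X] \in T(G)$ is the class of $X$. $T^{\rm ex}(G)$ is the $\mathbb{Z}$-span in $T(G)$ of the classes of exprojective modules. For $H \le G$, ${}_G\mathrm{ind}_H : T(H) \to T(G)$ and ${}_H\mathrm{res}_G : T(G) \to T(H)$ are given by induction and restriction of modules. $\pi_G : T(G) \to T^{\rm ex}(G)$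 is the $\mathbb{Z}$-linear map that is the identity on $T^{\rm ex}(G)$ and annihilates the class of every indecomposable non-exprojective $p$-permutation $\mathbb{F}G$-module. $\mu(U,V)$ is the Möbius function of the poset of subgroups of $G$ (zero unless $U \le V$, so only terms with $U\le V$ contribute). *)

(* Defs.v *)
From HB Require Import structures.
From mathcomp Require Import all_boot all_order all_algebra all_fingroup all_character.
From mathcomp Require Import ring_quotient boolp.
From mathcomp Require Import freeg.

Set Implicit Arguments.
Unset Strict Implicit.
Unset Printing Implicit Defensive.

Import GRing.Theory.
Local Open Scope ring_scope.
Local Open Scope quotient_scope.

Section Span.
Variables (R : nzRingType) (M : lmodType R) (S : M -> Prop).

Definition in_span (v : M) : Prop :=
  exists2 s : seq (R * M), (forall c, c \in s -> S c.2)
    & v = \sum_(c <- s) c.1 *: c.2.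

Definition span : {pred M} := fun v => `[< in_span v >].

Lemma spanP v : reflect (in_span v) (v \in span).
Proof. exact: asboolP. Qed.

Lemma mem_span v : S v -> v \in span.
Proof.
move=> Sv; apply/spanP; exists [:: (1, v)] => [c|].
  by rewrite inE => /eqP->.
by rewrite big_seq1 scale1r.
Qed.

Lemma span_scale a v : v \in span -> a *: v \in span.
Proof.
case/spanP=> s Ss ->; apply/spanP.
exists [seq (a * c.1, c.2) | c <- s] => [_ /mapP[c sc ->]|]; first exact: (Ss c).
by rewrite big_map scaler_sumr; apply: eq_bigr => c _; rewrite scalerA.
Qed.

Lemma span_add u v : u \in span -> v \in span -> u + v \in span.
Proof.
case/spanP=> s Ss -> /spanP[t St ->]; apply/spanP; exists (s ++ t).
  by move=> c; rewrite mem_cat => /orP[/Ss|/St].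
by rewrite big_cat.
Qed.

Lemma span_zmod_closed : zmod_closed span.
Proof.
split=> [|u v su sv]; first by apply/spanP; exists [::]; rewrite ?big_nil.
by rewrite span_add // -scaleN1r span_scale.
Qed.

HB.instance Definition _ :=
  GRing.isZmodClosed.Build M span span_zmod_closed.

End Span.

(* The R-module with generators X and relations v = 0 for all v with rel v.   *)
Section PresentedModule.
Variables (R : nzRingType) (X : choiceType) (rel : {freeg X / R} -> Prop).

Definition presmod : Type := Quotient.quot (span rel).

HB.instance Definition _ := GRing.Zmodule.on presmod.

Definition pres (v : {freeg X / R}) : presmod := \pi_(Quotient.quot (span rel)) v.

Lemma presP u v : reflect (pres u = pres v) (u - v \in span rel).
Proof. by rewrite Quotient.idealrBE; apply: eqP. Qed.

Fact pres_is_zmod_morphism : zmod_morphism pres.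
Proof. by move=> u v; rewrite /pres raddfB. Qed.

HB.instance Definition _ :=
  GRing.isZmodMorphism.Build _ _ pres pres_is_zmod_morphism.

Definition pres_repr (v : presmod) : {freeg X / R} :=
  generic_quotient.repr (v : Quotient.quot (span rel)).

Lemma pres_reprK : cancel pres_repr pres.
Proof. by move=> v; rewrite /pres /pres_repr reprK. Qed.

Definition pres_scale (a : R) (v : presmod) : presmod := pres (a *: pres_repr v).

Lemma pres_scaleE a v : pres_scale a (pres v) = pres (a *: v).
Proof.
by apply/presP; rewrite -scalerBr span_scale //; apply/presP; rewrite pres_reprK.
Qed.

Fact pres_scalerA a b v : pres_scale a (pres_scale b v) = pres_scale (a * b) v.
Proof. by rewrite -[v]pres_reprK !pres_scaleE scalerA. Qed.

Fact pres_scale1r : left_id 1 pres_scale.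
Proof. by move=> v; rewrite -[v]pres_reprK pres_scaleE scale1r. Qed.

Fact pres_scalerDr : right_distributive pres_scale +%R.
Proof.
move=> a u v; rewrite -[u]pres_reprK -[v]pres_reprK.
by rewrite -raddfD !pres_scaleE scalerDr raddfD.
Qed.

Fact pres_scalerDl v : {morph pres_scale^~ v : a b / a + b}.
Proof.
by move=> a b /=; rewrite -[v]pres_reprK !pres_scaleE scalerDl raddfD.
Qed.

HB.instance Definition _ := GRing.Zmodule_isLmodule.Build R presmod
  pres_scalerA pres_scale1r pres_scalerDr pres_scalerDl.

Lemma presZ a v : pres (a *: v) = a *: pres v.
Proof. by rewrite -pres_scaleE. Qed.

Definition pgen (x : X) : presmod := pres << x >>.

Section Lift.
Variables (M : lmodType R) (f : X -> M).

(* This is the linear extension of f when f respects the relations. *)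
Definition pres_lift (v : presmod) : M := fglift f (pres_repr v).

HB.instance Definition _ :=
  GRing.isZmodMorphism.Build {freeg X / R} M (fglift f) (lift_is_additive f).

Lemma fgliftZ a v : fglift f (a *: v) = a *: fglift f v.
Proof.
rewrite /GRing.scale /= /fgscale -[v in RHS]freeg_sumE !raddf_sum /=.
rewrite -/(GRing.scale _ _) scaler_sumr.
by apply: eq_bigr => x _; rewrite !liftU scalerA.
Qed.

Hypothesis f_rel : forall v, rel v -> fglift f v = 0.

Lemma pres_liftE v : pres_lift (pres v) = fglift f v.
Proof.
apply/eqP; rewrite -subr_eq0 -raddfB; apply/eqP.
have /presP/spanP[s] : pres (pres_repr (pres v)) = pres v by rewrite pres_reprK.
move=> Ss ->; rewrite raddf_sum big_seq big1 // => c sc.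
by rewrite /= fgliftZ f_rel ?scaler0 //; apply: Ss.
Qed.

Lemma pres_lift_gen x : pres_lift (pgen x) = f x.
Proof. by rewrite pres_liftE liftU scale1r. Qed.

Fact pres_lift_is_zmod_morphism : zmod_morphism pres_lift.
Proof.
move=> u v; rewrite -[u]pres_reprK -[v]pres_reprK -raddfB !pres_liftE.
by rewrite raddfB.
Qed.

Fact pres_lift_is_scalable : scalable pres_lift.
Proof. by move=> a u; rewrite -[u]pres_reprK -presZ !pres_liftE fgliftZ. Qed.

End Lift.
End PresentedModule.

(* Scalar extension of an abelian group A to R (the tensor product of R and A *)
(* over int), presented by generators 1 (x) a and additivity relations; the   *)
(* tensor r (x) a is r *: (1 (x) a).                                         *)
Section ScalarExtension.
Variable R : nzRingType.

Definition scalext_rel (A : zmodType) (v : {freeg A / R}) : Prop :=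
  exists a b : A, v = << a + b >> - << a >> - << b >>.

Definition scalext (A : zmodType) : Type := presmod (@scalext_rel A).

HB.instance Definition _ A := GRing.Lmodule.on (scalext A).

Definition ext1 (A : zmodType) (a : A) : scalext A := pgen (@scalext_rel A) a.

Fact ext1_is_zmod_morphism A : zmod_morphism (@ext1 A).
Proof.
move=> a b; apply/eqP; rewrite -subr_eq0 opprB addrA subr_eq0 eq_sym.
rewrite -subr_eq0 opprD addrA addrAC /ext1 /pgen -!raddfB -(raddf0 (pres _)).
apply/eqP/presP; rewrite subr0; apply: mem_span; exists (a - b), b.
by rewrite subrK addrAC.
Qed.

HB.instance Definition _ A :=
  GRing.isZmodMorphism.Build A (scalext A) (@ext1 A) (@ext1_is_zmod_morphism A).

Section Functoriality.
Variables (A B : zmodType) (f : {additive A -> B}).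

Definition extmap : scalext A -> scalext B := pres_lift (fun a => ext1 (f a)).

Lemma extmap_rel v :
  @scalext_rel A v -> fglift (fun a => ext1 (f a)) v = 0.
Proof.
case=> a [b ->]; rewrite !raddfB /= !liftU !scale1r !raddfD /=.
by rewrite addrAC addrK subrr.
Qed.

Lemma extmapE a : extmap (ext1 a) = ext1 (f a).
Proof. exact: (pres_lift_gen extmap_rel). Qed.

HB.instance Definition _ := GRing.isZmodMorphism.Build (scalext A) (scalext B)
  extmap (pres_lift_is_zmod_morphism extmap_rel).

HB.instance Definition _ := GRing.isScalable.Build R (scalext A) (scalext B)
  *:%R extmap (pres_lift_is_scalable extmap_rel).

End Functoriality.
End ScalarExtension.

Arguments ext1 R {A} a.
Arguments extmap R {A B} f v.

(* FG-modules are matrix representations acting on row vectors, hence right   *)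
(* modules; a left module corresponds to the right one with v g = g^-1 v.     *)
Section Modules.
Variables (F : fieldType) (gT : finGroupType).
Implicit Types G H : {group gT}.

Section OneGroup.
Variable G : {group gT}.
Implicit Types X Y Z : representation F G.

Definition iso X Y : Prop := mx_rsim X Y.

Definition summand X Y : Prop := exists Z, iso Y (dadd_grepr X Z).

Definition indecomposable X : Prop :=
  (0 < rdegree X)%N /\
  forall Y Z, iso X (dadd_grepr Y Z) -> rdegree Y = 0%N \/ rdegree Z = 0%N.

Definition projective X : Prop :=
  exists n, summand X (muln_grepr (Representation (regular_repr F G)) n).

(* The rows of B form a basis of X that is permuted by G.                     *)
Definition permutation_module X : Prop :=
  exists2 B : 'M[F]_(rdegree X), B \in unitmx &
    forall g, g \in G -> forall i, exists j, row i B *m X g = row j B.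

Definition p_permutation X : Prop :=
  exists2 P, permutation_module P & summand X P.

Definition hom n1 n2 (r1 : mx_representation F G n1)
    (r2 : mx_representation F G n2) (f : 'M[F]_(n1, n2)) : Prop :=
  forall g, g \in G -> r1 g *m f = f *m r2 g.

Lemma iso_daddP Y X Z :
  iso Y (dadd_grepr X Z) <->
  exists i1 i2 p1 p2,
    [/\ [/\ hom X Y i1, hom Z Y i2, hom Y X p1 & hom Y Z p2],
        [/\ i1 *m p1 = 1%:M, i2 *m p2 = 1%:M, i1 *m p2 = 0 & i2 *m p1 = 0]
      & p1 *m i1 + p2 *m i2 = 1%:M].
Proof.
split=> [[B eqn freeB homB] | [i1] [i2] [p1] [p2]].
  have [B' BB'] := row_freeP freeB.
  have B'B : B' *m B = 1%:M.
    case: Y B eqn freeB homB B' BB' => /= nY rY B eqn _ _; move: B; rewrite eqn.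
    by move=> B B'; apply: mulmx1C.
  have homB' g : g \in G -> dadd_grepr X Z g *m B' = B' *m Y g.
    move=> Gg; rewrite -[LHS]mul1mx -B'B -mulmxA (mulmxA B) -homB // -!mulmxA.
    by rewrite BB' mulmx1.
  exists (usubmx B'), (dsubmx B'), (lsubmx B), (rsubmx B).
  have BE : B = row_mx (lsubmx B) (rsubmx B) by rewrite hsubmxK.
  have B'E : B' = col_mx (usubmx B') (dsubmx B') by rewrite vsubmxK.
  move: homB homB' BB' B'B; rewrite BE B'E.
  rewrite !(row_mxKl, row_mxKr, col_mxKu, col_mxKd).
  move: (usubmx B') (dsubmx B') (lsubmx B) (rsubmx B) => i1 i2 p1 p2.
  move=> homB homB'; rewrite mul_row_col => -> /=.
  rewrite mul_col_row scalar_mx_block => /eq_block_mx[-> -> -> ->].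
  split=> //; split=> g Gg.
  - move: (homB' g Gg); rewrite /= mul_block_col !mul0mx addr0 add0r mul_col_mx.
    by case/eq_col_mx.
  - move: (homB' g Gg); rewrite /= mul_block_col !mul0mx addr0 add0r mul_col_mx.
    by case/eq_col_mx.
  - move: (homB g Gg); rewrite /= mul_row_block !mulmx0 addr0 add0r mul_mx_row.
    by case/eq_row_mx.
  - move: (homB g Gg); rewrite /= mul_row_block !mulmx0 addr0 add0r mul_mx_row.
    by case/eq_row_mx.
case=> [[hi1 hi2 hp1 hp2] [e11 e22 e12 e21] e].
have BB' : row_mx p1 p2 *m col_mx i1 i2 = 1%:M by rewrite mul_row_col.
have B'B : col_mx i1 i2 *m row_mx p1 p2 = 1%:M.
  by rewrite mul_col_row e11 e22 e12 e21 -scalar_mx_block.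
exists (row_mx p1 p2).
- apply/eqP; rewrite eqn_leq -{1}(mxrank1 F (rdegree Y)) -BB'.
  rewrite (leq_trans (mxrankM_maxl _ _)) ?rank_leq_col //=.
  rewrite -{1}(mxrank1 F (rdegree X + rdegree Z)) -B'B.
  by rewrite (leq_trans (mxrankM_maxl _ _)) ?rank_leq_col.
- by apply/row_freeP; exists (col_mx i1 i2).
move=> g Gg; rewrite /= mul_row_block !mulmx0 addr0 add0r mul_mx_row.
by rewrite hp1 ?hp2.
Qed.

End OneGroup.

Section Restriction.
Variables H G : {group gT}.

(* The zero module is a dummy value when H is not a subgroup of G.            *)
Definition res_grepr (X : representation F G) : representation F H :=
  if @idP (H \subset G) is ReflectT sHG then Representation (subg_repr X sHG)
  else @grepr0 F gT H.

Lemma res_grepr_dadd Y X Z : iso Y (dadd_grepr X Z) ->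
  iso (res_grepr Y) (dadd_grepr (res_grepr X) (res_grepr Z)).
Proof.
rewrite /res_grepr; case: {-}_ / idP => [sHG|_] isoY; last first.
  by exists 0 => // [|h _]; rewrite ?mulmx0 ?mul0mx //; apply/eqP; rewrite flatmx0 mxrank0.
case: isoY => B eqn freeB homB; exists B => // h Hh.
exact: homB (subsetP sHG _ Hh).
Qed.

Lemma res_grepr_perm X :
  permutation_module X -> permutation_module (res_grepr X).
Proof.
rewrite /res_grepr; case: {-}_ / idP => [sHG|_] [B uB permB]; last first.
  by exists 1%:M; rewrite ?unitmx1 // => h _ [].
by exists B => // h Hh i; apply: permB (subsetP sHG _ Hh) i.
Qed.

Lemma res_grepr_pperm X : p_permutation X -> p_permutation (res_grepr X).
Proof.
case=> P permP [Z isoP]; exists (res_grepr P); first exact: res_grepr_perm.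
by exists (res_grepr Z); apply: res_grepr_dadd.
Qed.

End Restriction.

Section Induction.
Variables G H : {group gT}.

Local Notation m := #|rcosets H G|.

Definition transv (i : 'I_m) : gT := repr (enum_val i).

Lemma enum_val_transv i : enum_val i = (H :* transv i)%g.
Proof.
have /rcosetsP[x _ Ex] := enum_valP i.
by rewrite /transv Ex rcoset_repr.
Qed.

Lemma transv_uniq x i j :
  (x * (transv i)^-1 \in H)%g -> (x * (transv j)^-1 \in H)%g -> i = j.
Proof.
rewrite -!mem_rcoset => /rcoset_eqP Ei /rcoset_eqP Ej.
by apply: enum_val_inj; rewrite !enum_val_transv -Ei -Ej.
Qed.

Lemma transv_ex i g :
  g \in G -> exists j, (transv i * g * (transv j)^-1 \in H)%g.
Proof.
move=> Gg; have /rcosetsP[x Gx Ex] := enum_valP i.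
have GHxg : (H :* (x * g))%g \in rcosets H G by apply/rcosetsP; exists (x * g)%g; rewrite ?groupM.
exists (enum_rank_in GHxg (H :* (x * g))%g); rewrite -mem_rcoset -enum_val_transv.
rewrite enum_rankK_in // rcosetM mem_rcoset mulgK -Ex enum_val_transv.
exact: rcoset_refl.
Qed.

Definition ind_hom n1 n2 (f : 'M[F]_(n1, n2)) :
    'M[F]_(\sum_(i < m) n1, \sum_(j < m) n2) :=
  \mxblock_(i < m, j < m) (if i == j then f else 0).

Lemma mul_ind_hom_mxblock n1 n2 (f : 'M[F]_(n1, n2)) (q : 'I_m -> nat)
    (A : forall i j, 'M[F]_(n2, q j)) :
  ind_hom f *m \mxblock_(i, j) A i j = \mxblock_(i, j) (f *m A i j).
Proof.
rewrite mul_mxblock; apply/eq_mxblock => i j.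
rewrite (bigD1 i) //= eqxx big1 ?addr0 // => k /negPf kj.
by rewrite eq_sym kj mul0mx.
Qed.

Lemma mul_mxblock_ind_hom n1 n2 (f : 'M[F]_(n1, n2)) (q : 'I_m -> nat)
    (A : forall i j, 'M[F]_(q i, n1)) :
  (\mxblock_(i, j) A i j) *m ind_hom f = \mxblock_(i, j) (A i j *m f).
Proof.
rewrite mul_mxblock; apply/eq_mxblock => i j.
by rewrite (bigD1 j) //= eqxx big1 ?addr0 // => k /negPf ->; rewrite mulmx0.
Qed.

Lemma ind_homM n1 n2 n3 (f : 'M[F]_(n1, n2)) (g : 'M[F]_(n2, n3)) :
  ind_hom (f *m g) = ind_hom f *m ind_hom g.
Proof.
rewrite {3}/ind_hom mul_ind_hom_mxblock; apply/eq_mxblock => i j.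
by case: ifP; rewrite ?mulmx0.
Qed.

Lemma ind_homD n1 n2 (f g : 'M[F]_(n1, n2)) :
  ind_hom (f + g) = ind_hom f + ind_hom g.
Proof.
rewrite /ind_hom -mxblockD; apply/eq_mxblock => i j.
by case: ifP; rewrite ?addr0.
Qed.

Lemma ind_hom0 n1 n2 : ind_hom (0 : 'M[F]_(n1, n2)) = 0.
Proof.
by rewrite /ind_hom -[RHS]mxblock0; apply/eq_mxblock => i j; rewrite if_same.
Qed.

Lemma ind_hom1 n : ind_hom (1%:M : 'M[F]_n) = 1%:M.
Proof.
rewrite -mxdiagZ /mxdiag; apply/eq_mxblock => i j.
by rewrite conform_mx_id.
Qed.

Section OneModule.
Variables (n : nat) (rH : mx_representation F H n).

(* The module obtained from the right FH-module V of rH by tensoring with FG  *)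
(* over FH: if t_i is the transversal, then (v (x) t_i) g = v h (x) t_j where *)
(* h = t_i g t_j^-1 lies in H for exactly one j.                              *)
Definition ind_mx (g : gT) : 'M[F]_(\sum_(i < m) n) :=
  \mxblock_(i < m, j < m)
    let h := (transv i * g * (transv j)^-1)%g in if h \in H then rH h else 0.

Fact ind_mx_repr : mx_repr G ind_mx.
Proof.
split=> [|x y Gx Gy].
  rewrite -ind_hom1; apply/eq_mxblock => i j; rewrite /= mulg1.
  case: eqP => [->|neq]; first by rewrite mulgV group1 repr_mx1.
  by case: ifP => // /transv_uniq Hij; case: neq; rewrite (Hij i) ?mulgV.
rewrite mul_mxblock; apply/eq_mxblock => i k /=.
have [j Hij] := transv_ex i Gx; rewrite (bigD1 j) //= Hij big1 ?addr0.
  set b := (transv j * y * _)%g; set c := (_ * _ * _)%g.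
  have ->: c = ((transv i * x * (transv j)^-1) * b)%g.
    by rewrite /c /b !mulgA mulgKV.
  by rewrite groupMl //; case: ifP => Hb; rewrite ?mulmx0 // repr_mxM.
move=> l neq; case: ifP => [Hil|_]; last by rewrite mul0mx.
by rewrite (transv_uniq Hil Hij) eqxx in neq.
Qed.

Definition ind_repr := MxRepresentation ind_mx_repr.

End OneModule.

Lemma hom_ind n1 n2 (r1 : mx_representation F H n1)
    (r2 : mx_representation F H n2) f :
  hom r1 r2 f -> hom (ind_repr r1) (ind_repr r2) (ind_hom f).
Proof.
move=> homf g _; rewrite /= /ind_mx mul_mxblock_ind_hom mul_ind_hom_mxblock.
by apply/eq_mxblock => i j /=; case: ifP => Hh; rewrite ?mul0mx ?mulmx0 ?homf.
Qed.

Definition ind_grepr (X : representation F H) : representation F G :=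
  Representation (ind_repr X).

Lemma ind_grepr_dadd Y X Z : iso Y (dadd_grepr X Z) ->
  iso (ind_grepr Y) (dadd_grepr (ind_grepr X) (ind_grepr Z)).
Proof.
case/iso_daddP=> i1 [i2] [p1] [p2] [[hi1 hi2 hp1 hp2] [e11 e22 e12 e21] e].
apply/iso_daddP.
exists (ind_hom i1), (ind_hom i2), (ind_hom p1), (ind_hom p2).
rewrite -!ind_homM -ind_homD e11 e22 e12 e21 e !ind_hom1 !ind_hom0.
by split=> //; split; apply: hom_ind.
Qed.

Lemma ind_grepr_perm X :
  permutation_module X -> permutation_module (ind_grepr X).
Proof.
case=> B uB permB; exists (ind_hom B).
  have [B' BB'] : exists B', B *m B' = 1%:M by exists (invmx B); rewrite mulmxV.
  rewrite -row_free_unit; apply/row_freeP; exists (ind_hom B').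
  by rewrite -ind_homM BB' ind_hom1.
move=> g Gg s /=; have [j Hj] := transv_ex (tagnat.sig1 s) Gg.
have [k Bk] := permB _ Hj (tagnat.sig2 s).
exists (tagnat.Rank j k); rewrite -row_mul mul_ind_hom_mxblock.
rewrite -[s in LHS]tagnat.sig2K.
have rowE (A : 'M[F]_(\sum_(i < m) rdegree X)) i r l :
    submxrow (row (tagnat.Rank i r) A) l = row r (submxblock A i l).
  by apply/rowP => c; rewrite !mxE.
apply/mxrowP => l; rewrite !rowE !mxblockK /=.
have [<-|neq] := eqVneq j l; first by rewrite Hj row_mul.
case: ifP => [Hl|_]; last by rewrite mulmx0 !row0.
by rewrite (transv_uniq Hj Hl) eqxx in neq.
Qed.

Lemma ind_grepr_pperm X : p_permutation X -> p_permutation (ind_grepr X).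
Proof.
case=> P permP [Z isoP]; exists (ind_grepr P); first exact: ind_grepr_perm.
by exists (ind_grepr Z); apply: ind_grepr_dadd.
Qed.

End Induction.
End Modules.

Section Exprojective.
Variables (F : fieldType) (gT : finGroupType) (G : {group gT}).

Definition inflation (K : {group gT}) (nsKG : (K <| G)%g)
    (P : representation F (G / K)%G) : representation F G :=
  Representation (morphim_repr P (normal_norm nsKG)).

Definition indec_exprojective (X : representation F G) : Prop :=
  exists (K : {group gT}) (nsKG : (K <| G)%g) (P : representation F (G / K)%G),
    projective P /\ iso X (inflation nsKG P).

Definition exprojective (X : representation F G) : Prop :=
  forall Y, indecomposable Y -> summand Y X -> indec_exprojective Y.

End Exprojective.

Section GrothendieckGroup.
Variables (F : fieldType) (gT : finGroupType).

Section OneGroup.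
Variable G : {group gT}.

Record ppmod := PPmod {
  ppmod_repr :> representation F G;
  ppmod_pperm : p_permutation ppmod_repr
}.

HB.instance Definition _ := gen_eqMixin ppmod.
HB.instance Definition _ := gen_choiceMixin ppmod.

(* An isomorphism between Y and the direct sum of X and Z amounts to a split  *)
(* short exact sequence 0 -> X -> Y -> Z -> 0.                                *)
Definition split_rel (v : {freeg ppmod / int}) : Prop :=
  exists X Y Z : ppmod,
    iso Y (dadd_grepr X Z) /\ v = << Y >> - << X >> - << Z >>.

(* Only the additive structure of the Grothendieck ring T(G) is defined.      *)
Definition Tgrp : Type := presmod split_rel.

HB.instance Definition _ := GRing.Lmodule.on Tgrp.

Definition Tclass (X : ppmod) : Tgrp := pgen split_rel X.

Definition Tex : {pred Tgrp} :=
  span (fun x => exists2 X : ppmod, exprojective X & x = Tclass X).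

Lemma Tclass_dadd (X Y Z : ppmod) :
  iso Y (dadd_grepr X Z) -> Tclass Y = Tclass X + Tclass Z.
Proof.
move=> isoY; apply/eqP; rewrite -subr_eq0 opprD addrA /Tclass /pgen -!raddfB.
rewrite -(raddf0 (pres _)); apply/eqP/presP; rewrite subr0.
by apply: mem_span; exists X, Y, Z.
Qed.

Definition is_Tex_proj (f : {additive Tgrp -> Tgrp}) : Prop :=
  [/\ forall x, f x \in Tex,
      forall x, x \in Tex -> f x = x
    & forall X : ppmod, indecomposable X -> ~ exprojective X ->
        f (Tclass X) = 0].

(* By the Krull-Schmidt theorem, Tgrp is free on the classes of               *)
(* indecomposable modules, so exactly one f satisfies is_Tex_proj f; the      *)
(* zero map is a dummy value.                                                 *)
Definition Tpi : {additive Tgrp -> Tgrp} :=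
  if pselect (exists f, is_Tex_proj f) is left exf then projT1 (cid exf)
  else \0.

End OneGroup.

Section Functors.
Variables G H : {group gT}.

Definition res_ppmod (X : ppmod G) : ppmod H :=
  PPmod (res_grepr_pperm H (ppmod_pperm X)).

Definition ind_ppmod (X : ppmod H) : ppmod G :=
  PPmod (ind_grepr_pperm G (ppmod_pperm X)).

Definition Tres : Tgrp G -> Tgrp H :=
  pres_lift (fun X => Tclass (res_ppmod X)).

Lemma Tres_rel v : @split_rel G v -> fglift (fun X => Tclass (res_ppmod X)) v = 0.
Proof.
case=> X [Y] [Z] [isoY ->]; rewrite !raddfB /= !liftU !scale1r.
rewrite (@Tclass_dadd _ (res_ppmod X) _ (res_ppmod Z)); last exact: res_grepr_dadd.
by rewrite addrAC addrK subrr.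
Qed.

HB.instance Definition _ := GRing.isZmodMorphism.Build (Tgrp G) (Tgrp H)
  Tres (pres_lift_is_zmod_morphism Tres_rel).

Lemma TresE X : Tres (Tclass X) = Tclass (res_ppmod X).
Proof. exact: (pres_lift_gen Tres_rel). Qed.

Definition Tind : Tgrp H -> Tgrp G :=
  pres_lift (fun X => Tclass (ind_ppmod X)).

Lemma Tind_rel v : @split_rel H v -> fglift (fun X => Tclass (ind_ppmod X)) v = 0.
Proof.
case=> X [Y] [Z] [isoY ->]; rewrite !raddfB /= !liftU !scale1r.
rewrite (@Tclass_dadd _ (ind_ppmod X) _ (ind_ppmod Z)); last exact: ind_grepr_dadd.
by rewrite addrAC addrK subrr.
Qed.

HB.instance Definition _ := GRing.isZmodMorphism.Build (Tgrp H) (Tgrp G)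
  Tind (pres_lift_is_zmod_morphism Tind_rel).

Lemma TindE X : Tind (Tclass X) = Tclass (ind_ppmod X).
Proof. exact: (pres_lift_gen Tind_rel). Qed.

End Functors.
End GrothendieckGroup.

Section Moebius.
Variable gT : finGroupType.
Implicit Types U V W : {group gT}.

(* mu(U,V) = - sum_(U <= W < V) mu(U,W) for U < V, with n >= #|V| as fuel; it *)
(* depends only on the interval from U to V, not on an ambient group.         *)
Fixpoint mobius_rec (n : nat) (U V : {group gT}) : int :=
  if U == V then 1 else
  if n is n'.+1 then
    - \sum_(W : {group gT} | (U \subset W) && (W \proper V)) mobius_rec n' U W
  else 0.

Definition mobius U V : int := mobius_rec #|V| U V.

Lemma mobius_recE n U V : (#|V| <= n)%N -> mobius_rec n U V = mobius U V.
Proof.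
have: (#|V| <= #|V|)%N by []; rewrite /mobius; move: {2 4}#|V| => k.
elim: n k V => [|n IHn] k V lek len; first by rewrite leqNgt cardG_gt0 in len.
case: k lek => [|k] lek; first by rewrite leqNgt cardG_gt0 in lek.
rewrite /=; case: ifP => // _; congr (- _).
apply: eq_bigr => W /andP[_ /proper_card ltWV].
by apply: IHn; rewrite -ltnS (leq_trans ltWV).
Qed.

Lemma mobius_refl U : mobius U U = 1.
Proof. by rewrite /mobius; case: #|U| => [|n] /=; rewrite eqxx. Qed.

Lemma mobius_notsub U V : ~~ (U \subset V) -> mobius U V = 0.
Proof.
move=> nsUV; have neqUV : U != V by apply: contraNneq nsUV => ->.
rewrite /mobius; case: #|V| => [|n] /=; rewrite (negPf neqUV) //.
rewrite big_pred0 ?oppr0 // => W; apply: contraNF nsUV => /andP[sUW].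
by move/proper_sub; apply: subset_trans.
Qed.

Lemma sum_mobius U V : U \proper V ->
  \sum_(W : {group gT} | (U \subset W) && (W \subset V)) mobius U W = 0.
Proof.
move=> ltUV; rewrite (bigD1 V) /=; last by rewrite subxx andbT proper_sub.
rewrite {1}/mobius; case EV: #|V| (cardG_gt0 V) => [|v] //= _.
have /negPf-> : U != V by apply: contraTneq ltUV => ->; rewrite properxx.
apply/eqP; rewrite addrC subr_eq0; apply/eqP.
have properE W : (W \proper V) = (W \subset V) && (W != V).
  by rewrite properEneq andbC.
apply: eq_big => W; first by rewrite properE andbA.
move=> /andP[/andP[sUW sWV] neqWV]; rewrite mobius_recE //.
by rewrite -ltnS -EV proper_card // properE sWV.
Qed.

End Moebius.

(* Main.v *)
From HB Require Import structures.
Require Import Defs.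
From mathcomp Require Import all_boot all_order all_algebra all_fingroup all_solvable all_character.
From mathcomp Require Import boolp freeg.

Set Implicit Arguments.
Unset Strict Implicit.
Unset Printing Implicit Defensive.

Import Order.TTheory GRing.Theory Num.Theory.
Local Open Scope ring_scope.

(** For a subgroup V let E_V be the operator on T(V) that is the sum over U <=
    V of #|U| mu(U, V) times restriction to U followed by induction to V
    (mobius_ires). Since restriction and induction are transitive, the
    right-hand side, multiplied by #|G|, is the sum over V of ind_V^G E_V pi_V
    res_V^G [X]. The same sum without the projections pi_V contains ind_U^G
    res_U^G [X] with the coefficient #|U| times the sum over V of mu(U, V);
    this is zero unless U = G, and what remains is #|G| [X]. It is therefore
    enough that E_V takes the same value on x and on pi_V x. As pi_V fixes
    exprojective modules and kills the other indecomposable ones, this means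
    that E_V kills the class of every indecomposable non-exprojective
    p-permutation module Y.

    Relations in T(V) are tested numerically. Two modules with the same Hom
    dimensions to all modules M are isomorphic (iso_of_hom_dim), so a linear
    relation between Hom dimensions is inherited by every additive function of
    modules (additive_relation). By Frobenius reciprocity, E_V [Y] = 0 follows
    if Y is null: the sum over U of #|U| mu(U, V) dim Hom_U(Y, M) is zero for
    every M (mobius_null). Modules induced from proper subgroups are null, by
    the Mackey formula and Weisner's identity for the Moebius function
    (mobius_null_ind).

    An indecomposable p-permutation module Y of H is a summand of the module
    induced from the trivial module of some p-subgroup Q (pperm_vertex). If Q
    is normal in H, then Y is inflated from a projective module of H / Q,
    hence exprojective (normal_exprojective). If Q is not normal, then a count
    of trivial summands over Q, in the manner of the Green correspondence,
    shows that up to modules that arise in the same way from smaller p-groups,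
    Y is induced from the proper subgroup N_H(Q), and Y is null by induction
    on Q (mobius_null_vertex). The induction may lead to a normal p-subgroup,
    but then p divides its index in H, and the module is null for another
    reason (mobius_null_normal). In that case <x> Q is a proper subgroup of H
    for every p'-element x, so the alternating sum of the modules ind_U res_U
    M vanishes on <x> for every M on which Q acts trivially. A combination of
    irreducible modules that vanishes on all cyclic p'-subgroups is zero
    (balanced0), and dim Hom(Y, _) depends only on composition factors because
    Y is projective over H / Q. *)

(** * Subspaces cut out by linear conditions *)

Section Subspaces.
Variable F : fieldType.
Implicit Types V W : vectType F.

Definition lin_closed V (P : V -> Prop) : Prop :=
  P 0 /\ forall a u v, P u -> P v -> P (a *: u + v).

Lemma subspace_ex V (P : V -> Prop) :
  lin_closed P -> exists U : {vspace V}, forall v, v \in U <-> P v.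
Proof.
case=> P0 Plin.
pose Q n := `[< exists2 U : {vspace V}, \dim U = n & forall v, v \in U -> P v >].
have Q0 : exists n, Q n.
  exists 0%N; apply/asboolP; exists 0%VS; first by rewrite dimv0.
  by move=> v; rewrite memv0 => /eqP->.
have Qle n : Q n -> (n <= dim V)%N.
  by case/asboolP=> U <- _; rewrite -dimvf dimvS ?subvf.
case: (ex_maxnP Q0 Qle) => n /asboolP[U dimU UP] maxU; exists U => v.
split=> [/UP //|Pv]; apply: contraT => nUv.
have /maxU : Q (\dim (U + <[v]>)%VS).
  apply/asboolP; exists (U + <[v]>)%VS => // _ /memv_addP[u Uu [_ /vlineP[a ->] ->]].
  by rewrite addrC; apply: Plin => //; apply: UP.
by rewrite leqNgt -dimU (ltn_leqif (dimv_leqif_sup (addvSl _ _))) subv_add subvv -memvE nUv.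
Qed.

(** The subspace of all solutions of P; the zero subspace is a default value
    when P is not linear. *)
Definition subspace_of V (P : V -> Prop) : {vspace V} :=
  if pselect (exists U : {vspace V}, forall v, v \in U <-> P v) is left exU
  then projT1 (cid exU) else 0%VS.

Lemma subspace_ofP V (P : V -> Prop) v : lin_closed P -> v \in subspace_of P <-> P v.
Proof.
move/subspace_ex=> exU; rewrite /subspace_of; case: pselect => // exU'.
by case: cid => U /= ->.
Qed.

Lemma dimv_inj V W (U : {vspace V}) (U' : {vspace W}) (phi : V -> W) :
  linear phi -> {in U, forall u, phi u \in U'} ->
  {in U, forall u, phi u = 0 -> u = 0} -> (\dim U <= \dim U')%N.
Proof.
move=> lin_phi phiU inj_phi.
pose phiL : {linear V -> W} := HB.pack phi (GRing.isLinear.Build _ _ _ _ phi lin_phi).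
have phiE : linfun phiL =1 phi by move=> u; rewrite lfunE.
rewrite -(@limg_dim_eq _ _ _ (linfun phiL)) ?dimvS //.
  by apply/subvP=> _ /memv_imgP[u Uu ->]; rewrite phiE phiU.
apply/eqP; rewrite -subv0; apply/subvP=> u; rewrite memv_cap memv_ker phiE memv0.
by case/andP=> Uu /eqP /(inj_phi _ Uu) ->.
Qed.

(** The maps i1, i2, p1, p2 exhibit U as a direct sum of U1 and U2:
    rank-nullity for p1 has image U1 and kernel i2(U2). *)
Lemma dim_split V V1 V2 (U : {vspace V}) (U1 : {vspace V1}) (U2 : {vspace V2})
    (i1 : {linear V1 -> V}) (i2 : {linear V2 -> V})
    (p1 : {linear V -> V1}) (p2 : {linear V -> V2}) :
    {in U, forall u, p1 u \in U1} -> {in U, forall u, p2 u \in U2} ->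
    {in U1, forall u, i1 u \in U} -> {in U2, forall u, i2 u \in U} ->
    (forall u, p1 (i1 u) = u) -> (forall u, p2 (i2 u) = u) ->
    (forall u, p1 (i2 u) = 0) -> (forall u, i1 (p1 u) + i2 (p2 u) = u) ->
  \dim U = (\dim U1 + \dim U2)%N.
Proof.
move=> Up1 Up2 Ui1 Ui2 e11 e22 e12 e; rewrite -(limg_ker_dim (linfun p1) U) addnC.
congr (_ + _)%N.
  congr (\dim _); apply/vspaceP=> u; apply/memv_imgP/idP => [[v Uv ->]|U1u].
    by rewrite lfunE Up1.
  by exists (i1 u); rewrite ?Ui1 // lfunE e11.
rewrite -(@limg_dim_eq _ _ _ (linfun i2) U2); last first.
  apply/eqP; rewrite -subv0; apply/subvP=> u.
  rewrite memv_cap memv_ker lfunE memv0 => /andP[_ /eqP iu0].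
  by rewrite -(e22 u) /= iu0 linear0.
congr (\dim _); apply/vspaceP=> u; rewrite memv_cap memv_ker lfunE /=.
apply/andP/memv_imgP => [[Uu /eqP p1u]|[v Uv ->]].
  by exists (p2 u); rewrite ?Up2 // lfunE /= -{1}(e u) /= p1u linear0 add0r.
by rewrite lfunE /= Ui2 // e12.
Qed.

End Subspaces.

(** * Homomorphisms over a subgroup, and direct summands *)

Section Homs.
Variables (F : fieldType) (gT : finGroupType).
Implicit Types (L : {set gT}).

(** Only the values on L of the matrix functions a and b matter, so that one
    notion covers homomorphisms between modules of different groups over a
    common subgroup, with no restriction functor in the way. *)
Definition hom_on L m n (a : gT -> 'M[F]_m) (b : gT -> 'M[F]_n) (f : 'M[F]_(m, n)) :=
  forall g, g \in L -> a g *m f = f *m b g.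

Definition homs L m n (a : gT -> 'M[F]_m) (b : gT -> 'M[F]_n) :
  {vspace 'M[F]_(m, n)} := subspace_of (hom_on L a b).

Definition hom_dim L m n (a : gT -> 'M[F]_m) (b : gT -> 'M[F]_n) : nat :=
  \dim (homs L a b).

Lemma hom_on_lin L m n (a : gT -> 'M[F]_m) (b : gT -> 'M[F]_n) : lin_closed (hom_on L a b).
Proof.
split=> [g _|c f h hf hh g Lg]; first by rewrite mulmx0 mul0mx.
by rewrite mulmxDr mulmxDl -scalemxAr -scalemxAl hf ?hh.
Qed.

Lemma homsP L m n (a : gT -> 'M[F]_m) (b : gT -> 'M[F]_n) f :
  f \in homs L a b <-> hom_on L a b f.
Proof. by apply: subspace_ofP; apply: hom_on_lin. Qed.

Lemma hom_on_comp L m n q (a : gT -> 'M[F]_m) (b : gT -> 'M[F]_n) (c : gT -> 'M[F]_q) f h :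
  hom_on L a b f -> hom_on L b c h -> hom_on L a c (f *m h).
Proof. by move=> hf hh g Lg; rewrite mulmxA hf // -mulmxA hh // mulmxA. Qed.

Lemma hom_on1 L m (a : gT -> 'M[F]_m) : hom_on L a a 1%:M.
Proof. by move=> g _; rewrite mulmx1 mul1mx. Qed.

Lemma hom_on0 L m n (a : gT -> 'M[F]_m) (b : gT -> 'M[F]_n) : hom_on L a b 0.
Proof. by case: (hom_on_lin L a b). Qed.

Lemma hom_onD L m n (a : gT -> 'M[F]_m) (b : gT -> 'M[F]_n) f h :
  hom_on L a b f -> hom_on L a b h -> hom_on L a b (f + h).
Proof. by move=> hf hh; rewrite -[f]scale1r; apply: (hom_on_lin L a b).2. Qed.

Lemma hom_onZ L m n (a : gT -> 'M[F]_m) (b : gT -> 'M[F]_n) c f :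
  hom_on L a b f -> hom_on L a b (c *: f).
Proof. by move=> hf; rewrite -[_ *: f]addr0; apply: (hom_on_lin L a b).2 => //; apply: hom_on0. Qed.

Lemma hom_onS L L' m n (a : gT -> 'M[F]_m) (b : gT -> 'M[F]_n) f :
  L' \subset L -> hom_on L a b f -> hom_on L' a b f.
Proof. by move=> /subsetP sL hf g /sL; apply: hf. Qed.

Definition summand_on L m n (a : gT -> 'M[F]_m) (b : gT -> 'M[F]_n) : Prop :=
  exists i p, [/\ hom_on L a b i, hom_on L b a p & i *m p = 1%:M].

Lemma summand_trans L m n q (a : gT -> 'M[F]_m) (b : gT -> 'M[F]_n) (c : gT -> 'M[F]_q) :
  summand_on L a b -> summand_on L b c -> summand_on L a c.
Proof.
move=> [i [p [hi hp ip]]] [j [q' [hj hq jq]]]; exists (i *m j), (q' *m p).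
split; [exact: hom_on_comp hj | exact: hom_on_comp hp |].
by rewrite mulmxA -(mulmxA i) jq mulmx1.
Qed.

Lemma summandS L L' m n (a : gT -> 'M[F]_m) (b : gT -> 'M[F]_n) :
  L' \subset L -> summand_on L a b -> summand_on L' a b.
Proof. by move=> sL [i [p [hi hp ip]]]; exists i, p; split=> //; apply: hom_onS sL _. Qed.

Lemma summand_trivial L (A : {set gT}) m n (a : gT -> 'M[F]_m) (b : gT -> 'M[F]_n) :
  A \subset L -> (forall q, q \in A -> b q = 1%:M) -> summand_on L a b ->
  forall q, q \in A -> a q = 1%:M.
Proof.
move=> /subsetP sAL b1 [i [p [hi hp ip]]] q Aq.
by rewrite -[LHS]mulmx1 -ip mulmxA hi ?sAL // b1 // mulmx1.
Qed.

Section Split.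
Definition split_by L m n1 n2 (b : gT -> 'M[F]_m) (a1 : gT -> 'M[F]_n1)
    (a2 : gT -> 'M[F]_n2) i1 i2 p1 p2 : Prop :=
  [/\ [/\ hom_on L a1 b i1, hom_on L a2 b i2, hom_on L b a1 p1 & hom_on L b a2 p2],
      [/\ i1 *m p1 = 1%:M, i2 *m p2 = 1%:M, i1 *m p2 = 0 & i2 *m p1 = 0]
    & p1 *m i1 + p2 *m i2 = 1%:M].

Variables (L : {set gT}) (m n1 n2 : nat) (b : gT -> 'M[F]_m).
Variables (a1 : gT -> 'M[F]_n1) (a2 : gT -> 'M[F]_n2).
Variables (i1 : 'M[F]_(n1, m)) (i2 : 'M[F]_(n2, m)).
Variables (p1 : 'M[F]_(m, n1)) (p2 : 'M[F]_(m, n2)).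
Hypothesis sp : split_by L b a1 a2 i1 i2 p1 p2.

Lemma hom_dim_splitl q (c : gT -> 'M[F]_q) : hom_dim L b c = (hom_dim L a1 c + hom_dim L a2 c)%N.
Proof.
case: sp => [[hi1 hi2 hp1 hp2] [e11 e22 e12 e21] e].
apply: (dim_split (i1 := mulmx p1) (i2 := mulmx p2) (p1 := mulmx i1) (p2 := mulmx i2)).
- by move=> u /homsP hu; apply/homsP; apply: hom_on_comp hu.
- by move=> u /homsP hu; apply/homsP; apply: hom_on_comp hu.
- by move=> u /homsP hu; apply/homsP; apply: hom_on_comp hu.
- by move=> u /homsP hu; apply/homsP; apply: hom_on_comp hu.
- by move=> u /=; rewrite mulmxA e11 mul1mx.
- by move=> u /=; rewrite mulmxA e22 mul1mx.
- by move=> u /=; rewrite mulmxA e12 mul0mx.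
by move=> u /=; rewrite !mulmxA -mulmxDl e mul1mx.
Qed.

Lemma dim_splitr q (U : {vspace 'M[F]_(q, m)}) (U1 : {vspace 'M[F]_(q, n1)})
    (U2 : {vspace 'M[F]_(q, n2)}) :
    {in U, forall u, u *m p1 \in U1} -> {in U, forall u, u *m p2 \in U2} ->
    {in U1, forall u, u *m i1 \in U} -> {in U2, forall u, u *m i2 \in U} ->
  \dim U = (\dim U1 + \dim U2)%N.
Proof.
case: sp => [_ [e11 e22 e12 e21] e] h1 h2 h3 h4.
apply: (dim_split (i1 := mulmxr i1) (i2 := mulmxr i2) (p1 := mulmxr p1) (p2 := mulmxr p2)) => //.
- by move=> u /=; rewrite -mulmxA e11 mulmx1.
- by move=> u /=; rewrite -mulmxA e22 mulmx1.
- by move=> u /=; rewrite -mulmxA e21 mulmx0.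
by move=> u /=; rewrite -!mulmxA -mulmxDr e mulmx1.
Qed.

Lemma hom_dim_splitr q (c : gT -> 'M[F]_q) : hom_dim L c b = (hom_dim L c a1 + hom_dim L c a2)%N.
Proof.
case: sp => [[hi1 hi2 hp1 hp2] _ _].
by apply: dim_splitr => u /homsP hu; apply/homsP; apply: hom_on_comp hu _.
Qed.

End Split.

Lemma split_byS L L' m n1 n2 (b : gT -> 'M[F]_m) (a1 : gT -> 'M[F]_n1)
    (a2 : gT -> 'M[F]_n2) i1 i2 p1 p2 :
  L' \subset L -> split_by L b a1 a2 i1 i2 p1 p2 -> split_by L' b a1 a2 i1 i2 p1 p2.
Proof.
by move=> sL [[h1 h2 h3 h4] h h']; split=> //; split; apply: hom_onS sL _.
Qed.

(** Equalities of Hom dimensions are obtained from two injections. *)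
Lemma hom_dim_le L m n (a : gT -> 'M[F]_m) (b : gT -> 'M[F]_n)
    L' m' n' (a' : gT -> 'M[F]_m') (b' : gT -> 'M[F]_n') phi :
  linear phi -> (forall f, hom_on L a b f -> hom_on L' a' b' (phi f)) ->
  (forall f, hom_on L a b f -> phi f = 0 -> f = 0) -> (hom_dim L a b <= hom_dim L' a' b')%N.
Proof.
move=> lin h inj; apply: (dimv_inj lin).
  by move=> f /homsP hf; apply/homsP; apply: h.
by move=> f /homsP hf; apply: inj.
Qed.

End Homs.

(** * Decomposition into indecomposable modules *)

Section KrullSchmidt.
Variables (F : fieldType) (gT : finGroupType) (G : {group gT}).
Implicit Types X Y Z M : representation F G.

(* Membership in lists of modules refers to this classical equality of
   representations. *)
HB.instance Definition _ := gen_eqMixin (representation F G).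

Lemma split_iso Y X Z :
  iso Y (dadd_grepr X Z) <-> exists i1 i2 p1 p2, split_by G Y X Z i1 i2 p1 p2.
Proof. exact: iso_daddP. Qed.

Lemma isoP X Y : iso X Y <->
  exists i p, [/\ hom_on G X Y i, hom_on G Y X p, i *m p = 1%:M & p *m i = 1%:M].
Proof.
split=> [isoXY|[i [p [hi hp ip pi]]]].
  case: isoXY => B eqn freeB homB.
  have [B' BB'] := row_freeP freeB.
  have B'B : B' *m B = 1%:M.
    case: Y B eqn freeB homB B' BB' => /= nY rY B eqn _ _; move: B; rewrite -eqn.
    by move=> B B'; apply: mulmx1C.
  exists B, B'; split=> // g Gg.
  by rewrite -[LHS]mul1mx -B'B -mulmxA (mulmxA B) -homB // -!mulmxA BB' mulmx1.
exists i => //; last by apply/row_freeP; exists p.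
apply/eqP; rewrite eqn_leq -{1}(mxrank1 F (rdegree X)) -ip.
rewrite (leq_trans (mxrankM_maxl _ _)) ?rank_leq_col //=.
by rewrite -{1}(mxrank1 F (rdegree Y)) -pi (leq_trans (mxrankM_maxl _ _)) ?rank_leq_col.
Qed.

Lemma iso_refl X : iso X X. Proof. exact: mx_rsim_refl. Qed.
Lemma iso_sym X Y : iso X Y -> iso Y X. Proof. exact: mx_rsim_sym. Qed.
Lemma iso_trans Y X Z : iso X Y -> iso Y Z -> iso X Z.
Proof. exact: mx_rsim_trans. Qed.

Lemma iso_summand X Y : iso X Y -> summand_on G X Y.
Proof. by case/isoP=> i [p [? ? ? _]]; exists i, p. Qed.

Lemma iso_add0 X : iso X (dadd_grepr X grepr0).
Proof.
apply/split_iso; exists 1%:M, 0, 1%:M, 0; split; last by rewrite !mulmx1 mulmx0 addr0.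
  by split=> g _; rewrite ?mulmx1 ?mul1mx ?mulmx0 ?mul0mx.
split; rewrite ?mulmx1 ?mul1mx ?mulmx0 ?mul0mx //.
by apply/matrixP=> -[].
Qed.

Lemma iso_addC X Y : iso (dadd_grepr X Y) (dadd_grepr Y X).
Proof.
have /split_iso[i1 [i2 [p1 [p2 [[h1 h2 h3 h4] [e1 e2 e3 e4] e]]]]] := iso_refl (dadd_grepr X Y).
by apply/split_iso; exists i2, i1, p2, p1; split=> //; rewrite addrC.
Qed.

Lemma split_summandl n m q (b : gT -> 'M[F]_n) (a1 : gT -> 'M[F]_m) (a2 : gT -> 'M[F]_q)
    L i1 i2 p1 p2 : split_by L b a1 a2 i1 i2 p1 p2 -> summand_on L a1 b.
Proof. by case=> [[h1 h2 h3 h4] [e1 e2 e3 e4] e]; exists i1, p1. Qed.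

Lemma split_summandr n m q (b : gT -> 'M[F]_n) (a1 : gT -> 'M[F]_m) (a2 : gT -> 'M[F]_q)
    L i1 i2 p1 p2 : split_by L b a1 a2 i1 i2 p1 p2 -> summand_on L a2 b.
Proof. by case=> [[h1 h2 h3 h4] [e1 e2 e3 e4] e]; exists i2, p2. Qed.

Lemma iso_summandl X Y Z : iso Y (dadd_grepr X Z) -> summand_on G X Y.
Proof. by case/split_iso=> i1 [i2 [p1 [p2 /split_summandl]]]. Qed.

Lemma iso_summandr X Y Z : iso Y (dadd_grepr X Z) -> summand_on G Z Y.
Proof. by case/split_iso=> i1 [i2 [p1 [p2 /split_summandr]]]. Qed.

Lemma rank_factor m n (f : 'M[F]_(m, n)) :
  exists k (c : 'M_(m, k)) (r : 'M_(k, n)),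
    [/\ k = \rank f, c *m r = f, exists c', c' *m c = 1%:M & exists r', r *m r' = 1%:M].
Proof.
exists (\rank f), (col_base f), (row_base f); rewrite mulmx_base; split=> //.
  by apply/row_fullP; exact: col_base_full.
by apply/row_freeP; exact: row_base_free.
Qed.

(** If e = p i is an idempotent endomorphism of Y with i p = 1, its image
    carries the action i Y(g) p. *)
Lemma corner_repr Y r (i : 'M[F]_(r, rdegree Y)) (p : 'M[F]_(rdegree Y, r)) :
  i *m p = 1%:M -> hom_on G Y Y (p *m i) -> mx_repr G (fun g : gT => i *m Y g *m p).
Proof.
move=> ip he; split=> [|x y Gx Gy]; first by rewrite repr_mx1 mulmx1.
rewrite repr_mxM // -!mulmxA (mulmxA p i) (mulmxA (p *m i)).
rewrite -he // !mulmxA.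
by rewrite -(mulmxA _ i) ip mulmx1.
Qed.

Lemma corner_rep Y r (i : 'M[F]_(r, rdegree Y)) (p : 'M[F]_(rdegree Y, r)) :
  i *m p = 1%:M -> hom_on G Y Y (p *m i) ->
  exists2 X : representation F G, rdegree X = r & exists i' p', [/\ hom_on G X Y i', hom_on G Y X p',
     i' *m p' = 1%:M & p' *m i' = p *m i].
Proof.
move=> ip he; exists (Representation (MxRepresentation (corner_repr ip he))) => //=.
exists i, p; split=> // g Gg /=.
  by rewrite -!mulmxA he // !mulmxA ip mul1mx.
by rewrite !mulmxA -he // -!mulmxA ip mulmx1.
Qed.

Lemma idem_split Y e : hom_on G Y Y e -> e *m e = e ->
  exists X Z i1 i2 p1 p2, split_by G Y X Z i1 i2 p1 p2 /\ p1 *m i1 = e.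
Proof.
have base f : hom_on G Y Y f -> f *m f = f ->
  exists (X : representation F G) i' p', [/\ hom_on G X Y i', hom_on G Y X p',
     i' *m p' = 1%:M & p' *m i' = f].
  move=> hf ff.
  have [k [c [r [_ cr [c' cc'] [r' rr']]]]] := rank_factor f.
  have ip : r *m c = 1%:M.
    have := congr1 (fun u => c' *m u *m r') ff.
    by rewrite -cr !mulmxA cc' mul1mx -!mulmxA rr' mulmx1 => ->.
  have hcr : hom_on G Y Y (c *m r) by rewrite cr.
  by have [X _ h] := corner_rep ip hcr; exists X; rewrite -cr.
move=> he ee; have [X [i1 [p1 [h1 h3 e11 pe]]]] := base e he ee.
have he' : hom_on G Y Y (1%:M - e).
  apply: hom_onD; first exact: hom_on1.
  by rewrite -scaleN1r; apply: hom_onZ.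
have ee' : (1%:M - e) *m (1%:M - e) = 1%:M - e.
  by rewrite mulmxBl mul1mx mulmxBr mulmx1 ee subrr subr0.
have [Z [i2 [p2 [h2 h4 e22 pe']]]] := base _ he' ee'.
exists X, Z, i1, i2, p1, p2; split=> //; split=> //; last by rewrite pe pe' addrC subrK.
split=> //.
  rewrite -[i1]mul1mx -e11 -[p2]mulmx1 -e22 !mulmxA -(mulmxA _ p1) pe.
  by rewrite -(mulmxA _ p2) pe' -(mulmxA i1) mulmxBr mulmx1 ee subrr mulmx0 mul0mx.
rewrite -[i2]mul1mx -e22 -[p1]mulmx1 -e11 !mulmxA -(mulmxA _ p2) pe'.
by rewrite -(mulmxA _ p1) pe -(mulmxA i2) mulmxBl mul1mx ee subrr mulmx0 mul0mx.
Qed.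

Lemma summand_split X Y : summand_on G X Y -> exists Z i1 i2 p1 p2, split_by G Y X Z i1 i2 p1 p2.
Proof.
case=> i [p [hi hp ip]].
have he : hom_on G Y Y (p *m i) by apply: hom_on_comp hi.
have ee : (p *m i) *m (p *m i) = p *m i by rewrite mulmxA -(mulmxA p) ip mulmx1.
have [X' [Z [i1 [i2 [p1 [p2 [[[h1 h2 h3 h4] [e11 e22 e12 e21] e] pe]]]]]]] := idem_split he ee.
exists Z, i, i2, p, p2; split=> //; last by rewrite -pe.
  split=> //.
  by rewrite -[i]mul1mx -ip -(mulmxA i p i) -pe -!mulmxA e12 !mulmx0.
by rewrite -[p]mulmx1 -ip !mulmxA -(mulmxA i2) -pe mulmxA e21 !mul0mx.
Qed.

Lemma summandP X Y : summand X Y <-> summand_on G X Y.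
Proof.
split; first by case=> Z /iso_summandl.
by case/summand_split=> Z h; exists Z; apply/split_iso.
Qed.

Lemma summand_deg L n m (a : gT -> 'M[F]_n) (b : gT -> 'M[F]_m) : summand_on L a b -> (n <= m)%N.
Proof.
case=> i [p [_ _ ip]]; rewrite -(mxrank1 F n) -ip.
by rewrite (leq_trans (mxrankM_maxl _ _)) ?rank_leq_col.
Qed.

Lemma split_deg L n m q (b : gT -> 'M[F]_n) (a1 : gT -> 'M[F]_m) (a2 : gT -> 'M[F]_q)
    i1 i2 p1 p2 : split_by L b a1 a2 i1 i2 p1 p2 -> n = (m + q)%N.
Proof.
move/(@split_byS _ _ L set0 _ _ _ _ _ _ _ _ _ _ (sub0set _)) => sp.
have h k (c : gT -> 'M[F]_k) : hom_dim set0 c (fun _ => 1%:M : 'M[F]_1) = k.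
  rewrite /hom_dim; have -> : homs set0 c (fun=> 1%:M : 'M[F]_1) = fullv.
    by apply/vspaceP=> f; rewrite memvf; apply/homsP=> g; rewrite inE.
  rewrite dimvf; exact: (etrans (dim_matrix _ _ _) (muln1 k)).
by have := hom_dim_splitl sp (fun _ => 1%:M : 'M[F]_1); rewrite !h.
Qed.

Lemma iso_deg X Y Z : iso Y (dadd_grepr X Z) -> rdegree Y = (rdegree X + rdegree Z)%N.
Proof. by case/split_iso=> i1 [i2 [p1 [p2 /split_deg]]]. Qed.

Lemma hom_on_inv L n (a : gT -> 'M[F]_n) f :
  f \in unitmx -> hom_on L a a f -> hom_on L a a (invmx f).
Proof.
by move=> uf hf g Lg; apply: (canRL (mulKmx uf)); rewrite mulmxA -hf // mulmxK.
Qed.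

Lemma indec_idem Y e : indecomposable Y -> hom_on G Y Y e -> e *m e = e -> e = 0 \/ e = 1%:M.
Proof.
case=> _ indY he ee; have [X [Z [i1 [i2 [p1 [p2 [sp pe]]]]]]] := idem_split he ee.
have [|dX|dZ] := indY X Z; first by apply/split_iso; exists i1, i2, p1, p2.
  by left; rewrite -pe; move: i1 p1 {sp pe}; rewrite dX => i1 p1; rewrite thinmx0 mul0mx.
right; case: sp => _ _ <-; rewrite pe -[LHS]addr0; congr (_ + _).
by move: i2 p2; rewrite dZ => i2 p2; rewrite thinmx0 mul0mx.
Qed.

(** For an indecomposable Y the powers of f have decreasing ranks until f is
    bijective on its image; that image is then a direct summand of Y, so f is
    bijective or nilpotent, and 1 - f is invertible in the second case. *)
Lemma fitting Y f : indecomposable Y -> hom_on G Y Y f ->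
  f \in unitmx \/ 1%:M - f \in unitmx.
Proof.
move=> indY; have [r] := ubnP (\rank f); elim: r f => // r IHr f lt_f_r hf.
have hff : hom_on G Y Y (f *m f) by exact: (hom_on_comp hf hf).
have [ltr|ger] := ltnP (\rank (f *m f)) (\rank f).
  have [|//||] := IHr (f *m f); first by rewrite -ltnS (leq_trans _ lt_f_r).
    by rewrite unitmx_mul => /andP[]; left.
  have -> : 1%:M - f *m f = (1%:M - f) *m (1%:M + f).
    by rewrite mulmxDr mulmx1 mulmxBl mul1mx addrA subrK.
  by rewrite unitmx_mul => /andP[]; right.
have [k [c [r' [rk cr _ _]]]] := rank_factor f.
have uS : r' *m c \in unitmx.
  rewrite -row_full_unit -[row_full _]/(_ == _) eqn_leq rank_leq_row /= {1}rk.
  rewrite (leq_trans ger) // -{1 2}cr !mulmxA -(mulmxA c).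
  by rewrite (leq_trans (mxrankM_maxl _ _)) // mxrankM_maxr.
(* f and f^2 have the same rank, so f is bijective on its image, and e is the
   projection onto this image along the kernel of f. *)
pose s := invmx (r' *m c).
pose e := c *m s *m r'; pose u := c *m s *m s *m r'.
have fu : f *m u = e by rewrite -cr /u !mulmxA -(mulmxA c) -(mulmxA c) mulmxV // mulmx1.
have uf : u *m f = e by rewrite -cr /u !mulmxA -(mulmxA _ r') -(mulmxA _ s) mulVmx // mulmx1.
have ef : e *m f = f by rewrite -cr /e !mulmxA -(mulmxA _ r') -(mulmxA _ s) mulVmx // mulmx1.
have fe : f *m e = f by rewrite -cr /e !mulmxA -(mulmxA c) -(mulmxA c) mulmxV // mulmx1.
have ee : e *m e = e by rewrite -{2}fu mulmxA ef fu.
have he : hom_on G Y Y e.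
  move=> g Gg; have <- : e *m (Y g *m e) = Y g *m e.
    by rewrite -fu (mulmxA (Y g)) hf // fu !mulmxA ef.
  have B : e *m Y g = u *m (Y g *m f) by rewrite hf // mulmxA uf.
  by rewrite mulmxA B -!mulmxA fe.
have [e0|e1] := indec_idem indY he ee.
  by right; rewrite -ef e0 mul0mx subr0 unitmx1.
by left; case/mulmx1_unit: (etrans fu e1).
Qed.

(** The endomorphism ring of an indecomposable module is local. *)
Lemma local_add Y f h : indecomposable Y -> hom_on G Y Y f -> hom_on G Y Y h ->
  f + h \in unitmx -> f \in unitmx \/ h \in unitmx.
Proof.
move=> indY hf hh ufh; set w := invmx (f + h).
have hw : hom_on G Y Y w by apply: hom_on_inv => //; apply: hom_onD.
have e : f *m w + h *m w = 1%:M by rewrite -mulmxDl mulmxV.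
have [|] := fitting indY (hom_on_comp hf hw); first by rewrite unitmx_mul => /andP[]; left.
by rewrite -e addrAC subrr add0r unitmx_mul => /andP[]; right.
Qed.

Lemma summand_unit L n m (a : gT -> 'M[F]_n) (b : gT -> 'M[F]_m) f h :
  hom_on L a b f -> hom_on L b a h -> f *m h \in unitmx -> summand_on L a b.
Proof.
move=> hf hh u; exists f, (h *m invmx (f *m h)); split=> //; last by rewrite mulmxA mulmxV.
exact: (hom_on_comp hh (hom_on_inv u (hom_on_comp hf hh))).
Qed.

(** The identity of Y is a sum of two endomorphisms, factoring through a1 and
    through a2; by locality one of them is invertible. *)
Lemma summand_indec_split Y n m q (b : gT -> 'M[F]_n) (a1 : gT -> 'M[F]_m) (a2 : gT -> 'M[F]_q)
    i1 i2 p1 p2 :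
  split_by G b a1 a2 i1 i2 p1 p2 -> indecomposable Y -> summand_on G Y b ->
  summand_on G Y a1 \/ summand_on G Y a2.
Proof.
move=> [[h1 h2 h3 h4] _ e] indY [i [p [hi hp ip]]].
have hA : hom_on G Y Y ((i *m p1) *m (i1 *m p)).
  exact: (hom_on_comp (hom_on_comp hi h3) (hom_on_comp h1 hp)).
have hB : hom_on G Y Y ((i *m p2) *m (i2 *m p)).
  exact: (hom_on_comp (hom_on_comp hi h4) (hom_on_comp h2 hp)).
have [|u|u] := local_add indY hA hB.
- rewrite -!mulmxA -mulmxDr (mulmxA p1) (mulmxA p2) -mulmxDl e mul1mx ip.
  exact: unitmx1.
- by left; apply: summand_unit u; [apply: hom_on_comp h3 | apply: hom_on_comp hp].
by right; apply: summand_unit u; [apply: hom_on_comp h4 | apply: hom_on_comp hp].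
Qed.

Lemma summand_indec_iso X Y : indecomposable X -> (0 < rdegree Y)%N -> summand_on G Y X -> iso Y X.
Proof.
move=> indX dY [i [p [hi hp ip]]].
have [||pi0|pi1] := @indec_idem X (p *m i) indX.
- exact: hom_on_comp hi.
- by rewrite mulmxA -(mulmxA p) ip mulmx1.
- have := mxrank1 F (rdegree Y); rewrite -ip -[i]mul1mx -ip -(mulmxA i) pi0 mulmx0 mul0mx.
  by rewrite mxrank0 => d0; rewrite -d0 in dY.
by apply/isoP; exists i, p.
Qed.

Definition dsum (s : seq (representation F G)) : representation F G :=
  foldr dadd_grepr grepr0 s.

Lemma iso_dadd X X' Y Y' : iso X X' -> iso Y Y' -> iso (dadd_grepr X Y) (dadd_grepr X' Y').
Proof.
move=> /isoP[i [p [hi hp ip pi]]] /isoP[j [q [hj hq jq qj]]].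
have /split_iso[i1 [i2 [p1 [p2 [[h1 h2 h3 h4] [e11 e22 e12 e21] e]]]]] := iso_refl (dadd_grepr X Y).
apply/split_iso; exists (p *m i1), (q *m i2), (p1 *m i), (p2 *m j); split.
- by split; [apply: hom_on_comp h1 | apply: hom_on_comp h2 | apply: hom_on_comp hi | apply: hom_on_comp hj].
- split; rewrite !mulmxA.
  + by rewrite -(mulmxA p) e11 mulmx1.
  + by rewrite -(mulmxA q) e22 mulmx1.
  + by rewrite -(mulmxA p) e12 mulmx0 mul0mx.
  + by rewrite -(mulmxA q) e21 mulmx0 mul0mx.
by rewrite !mulmxA -(mulmxA p1) ip mulmx1 -(mulmxA p2) jq mulmx1.
Qed.

Lemma iso_addA X Y Z : iso (dadd_grepr (dadd_grepr X Y) Z) (dadd_grepr X (dadd_grepr Y Z)).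
Proof.
have /split_iso[i1 [i2 [p1 [p2 [[h1 h2 h3 h4] [e11 e22 e12 e21] e]]]]] := iso_refl (dadd_grepr (dadd_grepr X Y) Z).
have /split_iso[j1 [j2 [q1 [q2 [[k1 k2 k3 k4] [f11 f22 f12 f21] f]]]]] := iso_refl (dadd_grepr X Y).
have /split_iso[l1 [l2 [r1 [r2 [[m1 m2 m3 m4] [g11 g22 g12 g21] g]]]]] := iso_refl (dadd_grepr Y Z).
apply/split_iso.
exists (j1 *m i1), (r1 *m (j2 *m i1) + r2 *m i2), (p1 *m q1), (p1 *m q2 *m l1 + p2 *m l2).
split.
- split.
  + exact: hom_on_comp h1.
  + exact: (hom_onD (hom_on_comp m3 (hom_on_comp k2 h1)) (hom_on_comp m4 h2)).
  + exact: hom_on_comp k3.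
  + exact: (hom_onD (hom_on_comp (hom_on_comp h3 k4) m1) (hom_on_comp h4 m2)).
- split.
  + by rewrite mulmxA -(mulmxA j1) e11 mulmx1.
  + rewrite mulmxDl !mulmxDr !mulmxA -(mulmxA _ i1) e11 mulmx1 -(mulmxA _ j2) f22 mulmx1.
    rewrite -(mulmxA _ i1) e12 mulmx0 mul0mx addr0 -(mulmxA _ i2 p1) e21 mulmx0 !mul0mx add0r.
    by rewrite -(mulmxA _ i2) e22 mulmx1.
  + rewrite mulmxDr !mulmxA -(mulmxA _ i1) e11 mulmx1 f12 mul0mx add0r.
    by rewrite -(mulmxA _ i1) e12 mulmx0 mul0mx.
  + rewrite mulmxDl !mulmxA -(mulmxA _ i1) e11 mulmx1 -(mulmxA _ j2) f21 mulmx0 add0r.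
    by rewrite -(mulmxA _ i2) e21 mulmx0 mul0mx.
rewrite mulmxDl !mulmxDr !mulmxA -(mulmxA _ l1 r1) g11 mulmx1 -(mulmxA _ l1 r2) g12 mulmx0 !mul0mx addr0.
rewrite -(mulmxA _ l2 r1) g21 mulmx0 !mul0mx add0r -(mulmxA _ l2 r2) g22 mulmx1.
by rewrite addrA -mulmxDl -!(mulmxA p1) -mulmxDr f mulmx1 e.
Qed.

Lemma iso_dsum_cat s t : iso (dsum (s ++ t)) (dadd_grepr (dsum s) (dsum t)).
Proof.
elim: s => [|X s IHs] /=; first exact: iso_trans (iso_add0 _) (iso_addC _ _).
by apply: iso_trans (iso_sym (iso_addA _ _ _)); apply: iso_dadd => //; apply: iso_refl.
Qed.

Lemma dsum_summand s Y : Y \in s -> summand_on G Y (dsum s).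
Proof.
elim: s => //= X s IHs; rewrite inE => /orP[/eqP->|/IHs sY].
  exact: iso_summandl (iso_refl _).
by apply: summand_trans sY _; apply: iso_summandr (iso_refl _).
Qed.

Lemma indec_decomposition X : exists2 s, (forall Y, Y \in s -> indecomposable Y) & iso X (dsum s).
Proof.
have [n] := ubnP (rdegree X); elim: n X => // n IHn X leX.
have [d0|dX] := posnP (rdegree X).
  by exists [::] => //; exists 0 => //; [apply/eqP; rewrite /row_free mxrank0 d0 | move=> g _; rewrite mulmx0 mul0mx].
have [indX|nindX] := pselect (indecomposable X).
  by exists [:: X] => [Y|]; [rewrite inE => /eqP-> | apply: iso_add0].
have [Y [Z [isoX dY dZ]]] : exists Y Z, [/\ iso X (dadd_grepr Y Z), (0 < rdegree Y)%N & (0 < rdegree Z)%N].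
  apply: contrapT => nex; apply: nindX; split=> // Y Z isoX.
  have [->|dY] := posnP (rdegree Y); first by left.
  have [->|dZ] := posnP (rdegree Z); first by right.
  by case: nex; exists Y, Z.
have dE := iso_deg isoX.
have [|s inds isoY] := IHn Y.
  by rewrite -ltnS (leq_trans _ leX) // ltnS dE -addn1 leq_add2l.
have [|t indt isoZ] := IHn Z.
  by rewrite -ltnS (leq_trans _ leX) // ltnS dE -add1n leq_add2r.
exists (s ++ t); first by move=> V; rewrite mem_cat => /orP[/inds|/indt].
apply: iso_trans isoX _; apply: iso_trans (iso_sym (iso_dsum_cat _ _)).
exact: iso_dadd.
Qed.

Lemma exists_indec_summand X : (0 < rdegree X)%N -> exists2 Y : representation F G, indecomposable Y & summand_on G Y X.
Proof.
have [[|Y s] inds isoX] := indec_decomposition X; first by rewrite {1}(mxrank_rsim isoX).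
move=> _; exists Y; first by apply: inds; rewrite mem_head.
by apply: summand_trans (iso_summand (iso_sym isoX)); apply: dsum_summand; rewrite mem_head.
Qed.

Definition additive_rep (Z : zmodType) (psi : representation F G -> Z) : Prop :=
  forall X Y X', iso Y (dadd_grepr X X') -> psi Y = psi X + psi X'.

Section Additive.
Variables (P : representation F G -> Prop) (Z : zmodType) (psi : representation F G -> Z).
Hypothesis psiD : forall X Y X', P X -> P Y -> P X' ->
  iso Y (dadd_grepr X X') -> psi Y = psi X + psi X'.
Hypothesis P0 : P grepr0.
Hypothesis PD : forall X Y, P X -> P Y -> P (dadd_grepr X Y).

Lemma additive_rep0 : psi grepr0 = 0.
Proof.
by apply: (addrI (psi grepr0)); rewrite addr0 -(psiD P0 P0 P0 (iso_add0 _)).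
Qed.

Lemma additive_rep_iso X Y : P X -> P Y -> iso X Y -> psi X = psi Y.
Proof.
move=> PX PY isoXY; rewrite (@psiD Y X grepr0) ?additive_rep0 ?addr0 //.
exact: iso_trans isoXY (iso_add0 _).
Qed.

Lemma closed_dsum s : (forall X, X \in s -> P X) -> P (dsum s).
Proof.
elim: s => //= X s IHs Ps; apply: PD; first by apply: Ps; rewrite mem_head.
by apply: IHs => Y sY; apply: Ps; rewrite inE sY orbT.
Qed.

Lemma additive_rep_dsum s : (forall X, X \in s -> P X) -> psi (dsum s) = \sum_(X <- s) psi X.
Proof.
elim: s => [|X s IHs] Ps; first by rewrite big_nil additive_rep0.
have Ps' Y : Y \in s -> P Y by move=> sY; apply: Ps; rewrite inE sY orbT.
have PX : P X by apply: Ps; rewrite mem_head.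
rewrite big_cons -IHs //.
exact: (psiD PX (PD PX (closed_dsum Ps')) (closed_dsum Ps') (iso_refl _)).
Qed.

(** An integer combination of modules is split as a difference of two modules,
    the sums of the terms with positive and with negative coefficients. *)
Definition spos (s : seq (int * representation F G)) :=
  dsum (flatten [seq nseq (if 0 <= c.1 then `|c.1|%N else 0%N) c.2 | c <- s]).
Definition sneg (s : seq (int * representation F G)) :=
  dsum (flatten [seq nseq (if 0 <= c.1 then 0%N else `|c.1|%N) c.2 | c <- s]).

Lemma additive_rep_signed s : (forall c, c \in s -> P c.2) ->
  \sum_(c <- s) psi c.2 *~ c.1 = psi (spos s) - psi (sneg s).
Proof.
move=> Ps; rewrite !additive_rep_dsum.
- rewrite !big_flatten !big_map /= -sumrB; apply: eq_bigr => -[c X] _ /=.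
  have nseqE n (T : Type) (x : T) (f : T -> Z) : \sum_(y <- nseq n x) f y = f x *+ n.
    by rewrite big_nseq iter_addr_0.
  rewrite !nseqE; case: c => n /=; first by rewrite subr0 -pmulrn.
  by rewrite mulr0n sub0r NegzE nmulrn.
- move=> X /flattenP[_ /mapP[c sc ->]]; rewrite mem_nseq => /andP[_ /eqP->].
  exact: Ps.
move=> X /flattenP[_ /mapP[c sc ->]]; rewrite mem_nseq => /andP[_ /eqP->].
exact: Ps.
Qed.

Lemma closed_spos s : (forall c, c \in s -> P c.2) -> P (spos s).
Proof.
move=> Ps; apply: closed_dsum => X /flattenP[_ /mapP[c sc ->]].
by rewrite mem_nseq => /andP[_ /eqP->]; apply: Ps.
Qed.

Lemma closed_sneg s : (forall c, c \in s -> P c.2) -> P (sneg s).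
Proof.
move=> Ps; apply: closed_dsum => X /flattenP[_ /mapP[c sc ->]].
by rewrite mem_nseq => /andP[_ /eqP->]; apply: Ps.
Qed.

End Additive.
End KrullSchmidt.

(** * Multiplicities and the Krull-Schmidt theorem *)

Section Multiplicity.
Variables (F : fieldType) (gT : finGroupType) (G : {group gT}).
Implicit Types X Y Z M : representation F G.

(** The radical homomorphisms Y -> X, for indecomposable Y: no composite Y ->
    X -> Y through f is invertible. *)
Definition radp Y X (f : 'M[F]_(rdegree Y, rdegree X)) : Prop :=
  hom_on G Y X f /\ forall h, hom_on G X Y h -> f *m h \notin unitmx.

(** The number of summands of X isomorphic to Y times the constant mult Y Y,
    which for an indecomposable Y is positive and equal to the dimension of
    End(Y) modulo its radical; unlike the number itself it is visibly additive
    in X. *)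
Definition mult Y X : int := (hom_dim G Y X)%:Z - (\dim (subspace_of (@radp Y X)))%:Z.

Lemma unitmx0n n : (0 < n)%N -> (0 : 'M[F]_n) \notin unitmx.
Proof. by move=> n0; rewrite -row_free_unit /row_free mxrank0 eq_sym -lt0n. Qed.

Lemma radp_lin Y X : indecomposable Y -> lin_closed (@radp Y X).
Proof.
move=> indY; split.
  split; first exact: hom_on0.
  by move=> h _; rewrite mul0mx unitmx0n //; case: indY.
move=> a f h [hf rf] [hh rh]; split; first exact: (hom_on_lin G Y X).2.
move=> k hk; rewrite mulmxDl -scalemxAl scalemxAr; apply/negP=> u.
have hak : hom_on G X Y (a *: k) by apply: hom_onZ.
have [u1|u2] := local_add indY (hom_on_comp hf hak) (hom_on_comp hh hk) u.
  by have := rf _ hak; rewrite u1.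
by have := rh _ hk; rewrite u2.
Qed.

Lemma radvP Y X f : indecomposable Y -> f \in subspace_of (@radp Y X) <-> radp f.
Proof. by move=> indY; apply/subspace_ofP/radp_lin. Qed.

Lemma hom_dim_additive n (a : gT -> 'M[F]_n) : additive_rep (fun X => (hom_dim G a X)%:Z).
Proof.
by move=> X Y X' /split_iso[i1 [i2 [p1 [p2 sp]]]]; rewrite (hom_dim_splitr sp) PoszD.
Qed.

Lemma hom_dim_additivel (L : {set gT}) n (a : gT -> 'M[F]_n) : L \subset G ->
  additive_rep (fun X => (hom_dim L X a)%:Z).
Proof.
move=> sLG X Y X' /split_iso[i1 [i2 [p1 [p2 /(split_byS sLG) sp]]]].
by rewrite (hom_dim_splitl sp) PoszD.
Qed.

Lemma hom_dim_isol (L : {set gT}) n (b : gT -> 'M[F]_n) X Y : L \subset G ->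
  iso X Y -> hom_dim L X b = hom_dim L Y b.
Proof.
move=> sLG isoXY; apply/eqP; rewrite -eqz_nat; apply/eqP.
apply: (@additive_rep_iso _ _ _ (fun=> True) _ (fun Z => (hom_dim L Z b)%:Z)) => // a a' a'' _ _ _.
exact: hom_dim_additivel.
Qed.

Lemma hom_dim_isor n (a : gT -> 'M[F]_n) X Y : iso X Y -> hom_dim G a X = hom_dim G a Y.
Proof.
move=> isoXY; apply/eqP; rewrite -eqz_nat; apply/eqP.
apply: (@additive_rep_iso _ _ _ (fun=> True) _ (fun Z => (hom_dim G a Z)%:Z)) => // X1 X2 X3 _ _ _.
exact: hom_dim_additive.
Qed.

Lemma radp_comp Y X X' f k : radp f -> hom_on G X X' k -> @radp Y X' (f *m k).
Proof.
case=> hf rf hk; split; first exact: hom_on_comp hk.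
by move=> h hh; rewrite -mulmxA rf //; apply: hom_on_comp hh.
Qed.

(** Both Hom(Y, _) and its radical part are additive functors. *)
Lemma mult_additive Y : indecomposable Y -> additive_rep (mult Y).
Proof.
move=> indY X1 X X2 isoX; rewrite /mult (hom_dim_additive Y isoX).
have [i1 [i2 [p1 [p2 sp]]]] := (split_iso _ _ _).1 isoX.
have [[h1 h2 h3 h4] _ _] := sp.
suff -> : \dim (subspace_of (@radp Y X)) = (\dim (subspace_of (@radp Y X1)) + \dim (subspace_of (@radp Y X2)))%N.
  by rewrite PoszD opprD addrACA.
by apply: (dim_splitr sp) => u /(radvP _ indY) ru; apply/(radvP _ indY); apply: radp_comp ru _.
Qed.

Lemma radp_sub_homs Y X : indecomposable Y -> (subspace_of (@radp Y X) <= homs G Y X)%VS.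
Proof.
by move=> indY; apply/subvP=> f /(radvP _ indY) [hf _]; apply/homsP.
Qed.

Lemma mult_ge0 Y X : indecomposable Y -> 0 <= mult Y X.
Proof. by move=> indY; rewrite subr_ge0 lez_nat dimvS ?radp_sub_homs. Qed.

Lemma mult_self Y : indecomposable Y -> 0 < mult Y Y.
Proof.
move=> indY; rewrite subr_gt0 ltz_nat.
rewrite (ltn_leqif (dimv_leqif_sup (radp_sub_homs _ indY))).
apply/negP=> /subvP sub.
have h1 : 1%:M \in homs G Y Y by apply/homsP/hom_on1.
have [_ /(_ 1%:M (@hom_on1 _ _ _ _ _))] := (radvP _ indY).1 (sub _ h1).
by rewrite mulmx1 unitmx1.
Qed.

Lemma mult_other Y X : indecomposable Y -> indecomposable X -> ~ iso Y X -> mult Y X = 0.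
Proof.
move=> indY indX niso; apply/eqP; rewrite subr_eq0; apply/eqP; congr (Posz _).
congr (\dim _); apply/vspaceP=> f; apply/idP/idP; last by move/(subvP (radp_sub_homs X indY)).
move/homsP=> hf; apply/(radvP _ indY); split=> // h hh; apply/negP=> u.
apply: niso; apply: summand_indec_iso indX _ _; first by case: indY.
exact: summand_unit hf hh u.
Qed.

Lemma mult_dsum Y s : indecomposable Y -> mult Y (dsum s) = \sum_(X <- s) mult Y X.
Proof.
move=> indY; apply: (@additive_rep_dsum _ _ _ (fun _ => True)) => // *; exact: mult_additive.
Qed.

Lemma mult_iso Y X X' : indecomposable Y -> iso X X' -> mult Y X = mult Y X'.
Proof.
move=> indY isoX; apply: (@additive_rep_iso _ _ _ (fun _ => True)) => // *; exact: mult_additive.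
Qed.

Lemma mult_summand_gt0 Y X : indecomposable Y -> summand_on G Y X -> 0 < mult Y X.
Proof.
move=> indY /summand_split[Z [i1 [i2 [p1 [p2 sp]]]]].
rewrite (@mult_additive Y indY Y X Z); last by apply/split_iso; exists i1, i2, p1, p2.
exact: ltr_wpDr (mult_ge0 _ _) (mult_self _).
Qed.

Lemma mult_gt0_summand Y X : indecomposable Y -> 0 < mult Y X -> summand_on G Y X.
Proof.
move=> indY; have [s inds isoX] := indec_decomposition X.
rewrite (mult_iso indY isoX) mult_dsum // => m0.
suff [Z sZ isoZ] : exists2 Z, Z \in s & iso Y Z.
  apply: summand_trans (iso_summand isoZ) _; apply: summand_trans (dsum_summand sZ) _.
  exact: iso_summand (iso_sym isoX).
apply: contrapT => nex; move: m0; rewrite big_seq big1 ?ltxx // => Z sZ.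
apply: mult_other => //; first exact: inds.
by move=> isoZ; apply: nex; exists Z.
Qed.

Definition iso_count Y (s : seq (representation F G)) := count (fun X => `[< iso Y X >]) s.

Lemma mult_iso_count Y s : indecomposable Y -> (forall X, X \in s -> indecomposable X) ->
  mult Y (dsum s) = mult Y Y *+ iso_count Y s.
Proof.
move=> indY; rewrite mult_dsum //.
elim: s => [|X s IHs] inds /=; first by rewrite big_nil mulr0n.
rewrite big_cons IHs => [|Z sZ]; last by apply: inds; rewrite inE sZ orbT.
rewrite mulrnDr; congr (_ + _).
case: asboolP => [isoY|niso]; first by rewrite mulr1n; apply: mult_iso => //; apply: iso_sym.
by rewrite mulr0n mult_other //; apply: inds; rewrite mem_head.
Qed.

(** By mult_iso_count, mult Y determines the number of summands isomorphic to
    Y. *)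
Theorem krull_schmidt s t : (forall X, X \in s -> indecomposable X) ->
  (forall X, X \in t -> indecomposable X) -> iso (dsum s) (dsum t) ->
  forall Y, indecomposable Y -> iso_count Y s = iso_count Y t.
Proof.
move=> inds indt isost Y indY; have := mult_iso indY isost.
by rewrite !mult_iso_count // => /mulrIn; apply; rewrite gt_eqF ?mult_self.
Qed.

(** Lists of indecomposable modules with the same multiplicities agree up to a
    permutation and isomorphisms, so an isomorphism invariant psi has the same
    sum over both. *)
Lemma iso_count_sum (Z : zmodType) (psi : representation F G -> Z) s t :
  (forall X, X \in s -> indecomposable X) -> (forall X, X \in t -> indecomposable X) ->
  {in s & t, forall X Y, iso X Y -> psi X = psi Y} ->
  (forall Y, indecomposable Y -> iso_count Y s = iso_count Y t) ->
  \sum_(X <- s) psi X = \sum_(X <- t) psi X.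
Proof.
elim: s t => [|X s IHs] t inds indt inv eqc.
  case: t indt inv eqc => [|Y t] // indt _ /(_ Y (indt _ (mem_head _ _))) /=.
  by rewrite (asboolT (iso_refl Y)).
have indX : indecomposable X by apply: inds; rewrite mem_head.
have : (0 < iso_count X t)%N by rewrite -eqc //= (asboolT (iso_refl X)).
rewrite -has_count => /hasP[Y tY /asboolP isoXY].
have indY : indecomposable Y by apply: indt.
rewrite big_cons (perm_big _ (perm_to_rem tY)) big_cons /=; congr (_ + _).
  by apply: inv => //; rewrite mem_head.
have sub_t : {subset rem Y t <= t} by apply: mem_rem.
have sub_s : {subset s <= X :: s} by move=> V sV; rewrite inE sV orbT.
apply: IHs => [V /sub_s/inds //|V /sub_t/indt //|V W sV tW|V indV].
  by apply: inv; [apply: sub_s | apply: sub_t].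
have := eqc V indV; rewrite /iso_count (seq.permP (perm_to_rem tY)) /=.
have -> : `[< iso V X >] = `[< iso V Y >].
  apply/asboolP/asboolP => h; apply: iso_trans h _ => //; exact: iso_sym.
by move/addnI.
Qed.

End Multiplicity.

(** * Modules are determined by the dimensions of their Hom spaces *)

Section Bongartz.
Variables (F : fieldType) (gT : finGroupType) (G : {group gT}).
Implicit Types X Y Z M A B D : representation F G.

Lemma iso_deg0 A B : rdegree A = 0%N -> rdegree B = 0%N -> iso A B.
Proof.
move=> dA dB; exists 0; first by rewrite dA dB.
  by rewrite /row_free mxrank0 dA.
by move=> g _; rewrite mulmx0 mul0mx.
Qed.

(** D is a direct sum of copies of B, one for each homomorphism in fs, and f
    is given by these homomorphisms on the copies. *)
Lemma multi_hom A B (fs : seq 'M[F]_(rdegree B, rdegree A)) :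
  (forall f, f \in fs -> hom_on G B A f) ->
  exists D (f : 'M[F]_(rdegree D, rdegree A)), [/\ hom_on G D A f,
    forall X, hom_dim G X D = (size fs * hom_dim G X B)%N,
    forall h, h \in fs -> exists2 i, hom_on G B D i & i *m f = h
    & forall Y, indecomposable Y -> summand_on G Y D -> summand_on G Y B].
Proof.
elim: fs => [|h fs IH] hfs.
  exists grepr0, 0; split=> //; first exact: hom_on0.
    move=> X; rewrite mul0n; apply/eqP; rewrite -leqn0.
    by rewrite (leq_trans (dimvS (subvf _))) // dimvf /dim /= muln0.
  by move=> Y [dY _] /summand_deg; rewrite leqNgt dY.
have [|D [f [hf dD facD indD]]] := IH; first by move=> k fk; apply: hfs; rewrite inE fk orbT.
have hh : hom_on G B A h by apply: hfs; rewrite mem_head.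
have isoD := iso_refl (dadd_grepr B D).
have [i1 [i2 [p1 [p2 sp]]]] := (split_iso _ _ _).1 isoD.
have [[h1 h2 h3 h4] [e11 e22 e12 e21] e] := sp.
exists (dadd_grepr B D), (p1 *m h + p2 *m f); split.
- exact: (hom_onD (hom_on_comp h3 hh) (hom_on_comp h4 hf)).
- by move=> X; rewrite (hom_dim_splitr sp) dD mulSn.
- move=> k; rewrite inE => /orP[/eqP->|/facD[i hi <-]].
    by exists i1 => //; rewrite mulmxDr !mulmxA e11 e12 mul1mx mul0mx addr0.
  exists (i *m i2); first exact: hom_on_comp h2.
  by rewrite mulmxDr !mulmxA -(mulmxA i i2 p1) -(mulmxA i i2 p2) e21 e22 mulmx1 mulmx0 mul0mx add0r.
by move=> Y indY /(summand_indec_split sp indY)[|/(indD _ indY)].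
Qed.

(** K is the kernel of f: by left exactness of Hom(X, _), the kernel of the
    composition with f is Hom(X, K). *)
Lemma hom_kernel D A (f : 'M[F]_(rdegree D, rdegree A)) : hom_on G D A f ->
  exists K : representation F G, forall X : representation F G,
    (hom_dim G X K + \dim (linfun (mulmxr f) @: homs G X D))%N = hom_dim G X D.
Proof.
move=> hf.
have modK : mxmodule D (kermx f).
  apply/mxmoduleP=> g Gg; apply/sub_kermxP.
  by rewrite -mulmxA (hf g Gg) mulmxA mulmx_ker mul0mx.
exists (Representation (submod_repr modK)) => X; rewrite [RHS]/hom_dim -(limg_ker_dim (linfun (mulmxr f)) (homs G X D)).
congr (_ + _)%N; apply/eqP; rewrite eqn_leq; apply/andP; split.
  apply: (@dimv_inj _ _ _ _ _ (@val_submod _ _ (kermx f) (rdegree X))).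
  - exact: linearP.
  - move=> h /homsP hh; rewrite memv_cap memv_ker lfunE /=; apply/andP; split.
      apply/homsP=> g Gg; rewrite -val_submodJ // -(hh g Gg).
      by rewrite [LHS]mulmxA.
    by apply/eqP/sub_kermxP; apply: val_submodP.
  by move=> h _ /eqP; rewrite val_submod_eq0 => /eqP.
apply: (@dimv_inj _ _ _ _ _ (@in_submod _ _ (kermx f) (rdegree X))).
- exact: linearP.
- move=> h; rewrite memv_cap memv_ker lfunE /= => /andP[/homsP hh /eqP/sub_kermxP hK].
  apply/homsP=> g Gg; rewrite [RHS](esym (in_submodJ modK g hK)) -(hh g Gg).
  by rewrite [LHS]mulmxA.
move=> h; rewrite memv_cap memv_ker lfunE /= => /andP[_ /eqP/sub_kermxP hK] h0.
by rewrite -(in_submodK hK) h0 linear0.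
Qed.

(** Bongartz's theorem. A and B turn out to have a common indecomposable
    summand, which is cancelled, and induction on the degree finishes the
    proof. The common summand is found inside A, shown to be a summand of a
    power of B. *)
Theorem iso_of_hom_dim A B :
  (forall X : representation F G, hom_dim G A X = hom_dim G B X) -> iso A B.
Proof.
have [n] := ubnP (rdegree A); elim: n A B => // n IHn A B leA eqh.
have [dA|dA] := posnP (rdegree A).
  apply: iso_deg0 => //; apply/eqP; apply: contraT; rewrite -lt0n => dB.
  have := eqh B; have -> : hom_dim G A B = 0%N.
    apply/eqP; rewrite -leqn0 (leq_trans (dimvS (subvf _))) // dimvf /dim /=.
    by rewrite leqn0 muln_eq0 dA.
  move/esym/eqP; rewrite dimv_eq0 => /eqP h0.
  have : 1%:M \in homs G B B by apply/homsP/hom_on1.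
  rewrite h0 memv0 -mxrank_eq0 mxrank1 => /eqP dB0; by rewrite dB0 in dB.
(* D is a power of B, and f : D -> A combines a basis of Hom(B, A), so that
   every homomorphism B -> A lifts to D. Since A and B have equal Hom
   dimensions to A, to D and to the kernel of f, every homomorphism A -> A
   lifts as well, in particular the identity. *)
pose fs := vbasis (homs G B A).
have [|D [f [hf dD facD indD]]] := @multi_hom A B fs.
  by move=> f /vbasis_mem /homsP.
have [K dK] := hom_kernel hf.
have szfs : size fs = hom_dim G B A by rewrite size_tuple.
have imB : (linfun (mulmxr f) @: homs G B D)%VS = homs G B A.
  apply/vspaceP=> h; apply/idP/idP.
    by case/memv_imgP=> k /homsP hk ->; rewrite lfunE /=; apply/homsP; apply: hom_on_comp hf.
  suff sub : (homs G B A <= linfun (mulmxr f) @: homs G B D)%VS by move/(subvP sub).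
  rewrite -(span_basis (vbasisP (homs G B A))); apply/span_subvP=> k /facD[i hi <-].
  by apply/memv_imgP; exists i; [apply/homsP | rewrite lfunE].
have : (\dim (linfun (mulmxr f) @: homs G A D) = hom_dim G A A)%N.
  have := dK B; rewrite imB dD szfs -/(hom_dim G B A) -(eqh K) -(eqh A).
  have := dK A; rewrite dD szfs -(eqh A) (eqh B) => <-.
  by move/eqP; rewrite eqn_add2l => /eqP.
move=> dimA.
have sub : (linfun (mulmxr f) @: homs G A D <= homs G A A)%VS.
  by apply/subvP=> _ /memv_imgP[k /homsP hk ->]; rewrite lfunE /=; apply/homsP; apply: hom_on_comp hf.
have summAD : summand_on G A D.
  have : 1%:M \in homs G A A by apply/homsP/hom_on1.
  have /eqP <- : (linfun (mulmxr f) @: homs G A D)%VS == homs G A A.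
    by rewrite eqEdim sub dimA leqnn.
  by case/memv_imgP=> k /homsP hk; rewrite lfunE /= => e; exists k, f.
have [Y indY sYA] := exists_indec_summand dA.
have sYB : summand_on G Y B by apply: (indD _ indY); apply: summand_trans summAD.
have [A' [i1 [i2 [p1 [p2 spA]]]]] := summand_split sYA.
have [B' [j1 [j2 [q1 [q2 spB]]]]] := summand_split sYB.
have isoA : iso A (dadd_grepr Y A') by apply/split_iso; exists i1, i2, p1, p2.
have isoB : iso B (dadd_grepr Y B') by apply/split_iso; exists j1, j2, q1, q2.
have dAE := iso_deg isoA.
apply: iso_trans isoA _; apply: iso_trans (iso_sym isoB); apply: iso_dadd; first exact: iso_refl.
apply: IHn.
  rewrite -ltnS (leq_trans _ leA) // ltnS dAE -add1n leq_add2r.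
  by case: indY.
move=> X; have := eqh X; rewrite (hom_dim_splitl spA) (hom_dim_splitl spB).
by move/eqP; rewrite eqn_add2l => /eqP.
Qed.

(** A linear relation between Hom dimensions is inherited by every function
    psi that is additive on a class P of modules closed under direct sums: the
    relation says that the modules spos s and sneg s have the same Hom
    dimensions, hence are isomorphic. This is how relations in the
    Grothendieck group are derived from numerical ones. *)
Theorem additive_relation (P : representation F G -> Prop) (Z : zmodType)
    (psi : representation F G -> Z) (s : seq (int * representation F G)) :
  (forall X Y X', P X -> P Y -> P X' -> iso Y (dadd_grepr X X') -> psi Y = psi X + psi X') ->
  P grepr0 -> (forall X Y, P X -> P Y -> P (dadd_grepr X Y)) ->
  (forall c, c \in s -> P c.2) ->
  (forall M : representation F G, \sum_(c <- s) (hom_dim G c.2 M)%:Z *~ c.1 = 0) ->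
  \sum_(c <- s) psi c.2 *~ c.1 = 0.
Proof.
move=> psiD P0 PD Ps hs; rewrite (additive_rep_signed psiD P0 PD Ps).
rewrite (additive_rep_iso psiD P0 (closed_spos P0 PD Ps) (closed_sneg P0 PD Ps)) ?subrr //.
apply: iso_of_hom_dim => M; have := hs M.
have hadd := @hom_dim_additivel F gT G G _ M (subxx _).
rewrite (@additive_rep_signed _ _ _ (fun _ => True) _ (fun X => (hom_dim G X M)%:Z)) //; last first.
  by move=> X Y X' _ _ _; apply: hadd.
by move/eqP; rewrite subr_eq0 => /eqP[].
Qed.

End Bongartz.

(** * Equivariant families of matrices *)

Section Families.
Variables (F : fieldType) (gT : finGroupType) (L D : {group gT}) (T : finType).
Variables (to : action D T) (sLD : L \subset D).
Variables (m n : nat) (A : gT -> 'M[F]_m) (B : gT -> 'M[F]_n).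
Hypotheses (reprA : mx_repr L A) (reprB : mx_repr L B).

Definition famp (S : {set T}) (f : {ffun T -> 'M[F]_(m, n)}) : Prop :=
  (forall x, x \notin S -> f x = 0) /\
  forall x g, x \in S -> g \in L -> A g *m f (to x g) = f x *m B g.

Definition fam S : {vspace {ffun T -> 'M[F]_(m, n)}} := subspace_of (famp S).

Lemma famp_lin S : lin_closed (famp S).
Proof.
split; first by split=> [x _|x g _ _]; rewrite !ffunE ?mulmx0 ?mul0mx.
move=> a f h [f0 ff] [h0 hh]; split=> [x nSx|x g Sx Lg].
  by rewrite !ffunE f0 // h0 // scaler0 addr0.
by rewrite !ffunE mulmxDr mulmxDl -scalemxAr -scalemxAl ff ?hh.
Qed.

Lemma famP S f : f \in fam S <-> famp S f.
Proof. exact/subspace_ofP/famp_lin. Qed.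

Lemma famp_restr (S O : {set T}) f : [acts L, on O | to] -> famp S f -> O \subset S ->
  famp O [ffun x => if x \in O then f x else 0].
Proof.
move=> actO [_ ff] /subsetP sOS; split=> [x /negPf nOx|x g Ox Lg]; first by rewrite ffunE nOx.
by rewrite !ffunE (acts_act actO Lg) Ox ff // sOS.
Qed.

Lemma dim_fam_split (S O : {set T}) : [acts L, on O | to] -> [acts L, on S | to] -> O \subset S ->
  \dim (fam S) = (\dim (fam O) + \dim (fam (S :\: O)))%N.
Proof.
move=> actO actS sOS.
have actSO : [acts L, on S :\: O | to] by apply: actsD.
have sub (S' : {set T}) : S' \subset S -> [acts L, on S' | to] -> (fam S' <= fam S)%VS.
  move=> sS' actS'; apply/subvP=> f /famP[f0 ff]; apply/famP; split=> [x nSx|x g Sx Lg].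
    by apply: f0; apply: contra nSx; apply: (subsetP sS').
  have [S'x|nS'x] := boolP (x \in S'); first exact: ff.
  by rewrite !f0 ?mulmx0 ?mul0mx // (acts_act actS' Lg).
rewrite -dimv_disjoint_sum; last first.
  apply/eqP; rewrite -subv0; apply/subvP=> f; rewrite memv_cap memv0.
  case/andP=> /famP[f0 _] /famP[f0' _]; apply/eqP/ffunP=> x; rewrite ffunE.
  by have [Ox|/f0 //] := boolP (x \in O); apply: f0'; rewrite inE Ox.
congr (\dim _); apply: subv_anti; rewrite subv_add !sub ?subsetDl // !andbT.
apply/subvP=> f /famP fS.
have -> : f = [ffun x => if x \in O then f x else 0] + [ffun x => if x \in S :\: O then f x else 0].
  apply/ffunP=> x; rewrite !ffunE inE; case: ifP => [Ox|nOx] /=; first by rewrite addr0.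
  by rewrite add0r; case: ifP => // /negbT/fS.1.
apply: memv_add; apply/famP; apply: famp_restr fS _ => //; exact: subsetDl.
Qed.

Lemma mulAV g : g \in L -> A g *m A g^-1%g = 1%:M.
Proof. by case: reprA => A1 AM Lg; rewrite -AM ?groupV // mulgV A1. Qed.
Lemma mulVA g : g \in L -> A g^-1%g *m A g = 1%:M.
Proof. by case: reprA => A1 AM Lg; rewrite -AM ?groupV // mulVg A1. Qed.

Lemma stab1P x g : (g \in ('C_L[x | to])%g) = (g \in L) && (to x g == x).
Proof.
by rewrite !inE sub1set inE; case Lg: (g \in L); rewrite //= (subsetP sLD).
Qed.

(** An equivariant family on an orbit is determined by its value at one point,
    which is an arbitrary homomorphism over the stabiliser of that point. *)
Lemma dim_fam_orbit x : \dim (fam (orbit to L x)) = hom_dim ('C_L[x | to])%g A B.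
Proof.
have [A1 AM] := reprA; have [B1 BM] := reprB.
have stabP := stab1P x.
apply/eqP; rewrite eqn_leq; apply/andP; split.
  apply: (@dimv_inj _ _ _ _ _ (fun f : {ffun T -> 'M[F]_(m, n)} => f x)).
  - by move=> a f h; rewrite !ffunE.
  - move=> f /famP[_ ff]; apply/homsP=> g; rewrite stabP => /andP[Lg /eqP xg].
    by rewrite -(ff x g) ?orbit_refl // xg.
  move=> f /famP[f0 ff] fx0; apply/ffunP=> y; rewrite ffunE.
  have [/orbitP[g Lg <-]|/f0 //] := boolP (y \in orbit to L x).
  rewrite -[f _]mul1mx -(mulVA Lg) -mulmxA ff ?orbit_refl //.
  by rewrite fx0 mul0mx mulmx0.
(* tr y moves x to y; the choice among such elements is immaterial because v
   is a homomorphism over the stabiliser. *)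
pose tr y := odflt 1%g [pick g in L | to x g == y].
have trP y : y \in orbit to L x -> tr y \in L /\ to x (tr y) = y.
  move=> /orbitP[g Lg xg]; rewrite /tr; case: pickP => [h /andP[Lh /eqP]|/(_ g)] //=.
  by rewrite Lg xg eqxx.
pose psi (v : 'M[F]_(m, n)) : {ffun T -> 'M[F]_(m, n)} :=
  [ffun y => if y \in orbit to L x then A (tr y)^-1%g *m v *m B (tr y) else 0].
apply: (@dimv_inj _ _ _ _ _ psi).
- move=> a u v; apply/ffunP=> y; rewrite !ffunE; case: ifP => _; last by rewrite scaler0 addr0.
  by rewrite mulmxDr mulmxDl -scalemxAr -scalemxAl.
- move=> v /homsP hv; apply/famP; split=> [y /negPf nOy|y g Oy Lg]; first by rewrite ffunE nOy.
  have [Lt xt] := trP y Oy.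
  have Oyg : to y g \in orbit to L x.
    by rewrite -xt -actMin ?(subsetP sLD) //; apply: mem_orbit; rewrite groupM.
  have [Lt' xt'] := trP _ Oyg.
  set t := tr y in Lt xt *; set t' := tr (to y g) in Lt' xt' *.
  have Ch : (t * g * t'^-1)%g \in ('C_L[x | to])%g.
    have Lh : (t * g * t'^-1)%g \in L by rewrite !groupM ?groupV.
    rewrite stabP Lh /=; apply/eqP.
    by rewrite !actMin ?groupM ?groupV ?(subsetP sLD) // xt -xt' actKin // (subsetP sLD).
  have := hv _ Ch; rewrite !AM ?groupM ?groupV // !BM ?groupM ?groupV // => hv'.
  rewrite !ffunE Oyg Oy -/t -/t'.
  have := congr1 (fun w => A t^-1%g *m w *m B t') hv'.
  rewrite !mulmxA mulVA // mul1mx => ->; rewrite -!mulmxA; congr (_ *m (_ *m _)).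
  by rewrite -!BM ?groupM ?groupV // mulVg mulg1.
move=> v /homsP hv /ffunP/(_ x); rewrite !ffunE orbit_refl.
have [Lt xt] := trP x (orbit_refl _ _ _) => h0.
have Ct : tr x \in ('C_L[x | to])%g.
  by rewrite stabP Lt /= xt.
have := congr1 (fun w => A (tr x) *m w *m B (tr x)^-1%g) h0.
rewrite !mulmxA mulAV // mul1mx -mulmxA -BM ?groupV // mulgV B1 mulmx1.
by rewrite mulmx0 mul0mx.
Qed.

(** The orbit formula, with each orbit counted through all of its points by
    means of the orbit-stabiliser theorem; this avoids choosing
    representatives. *)
Lemma dim_fam (S : {set T}) : [acts L, on S | to] ->
  (#|L| * \dim (fam S) = \sum_(x in S) #|('C_L[x | to])%g| * hom_dim ('C_L[x | to])%g A B)%N.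
Proof.
have [k] := ubnP #|S|; elim: k S => // k IHk S leS actS.
have [S0|[x Sx]] := set_0Vmem S.
  rewrite S0 big_set0; suff -> : fam set0 = 0%VS by rewrite dimv0 muln0.
  apply/eqP; rewrite -subv0; apply/subvP=> f /famP[f0 _]; rewrite memv0.
  by apply/eqP/ffunP=> y; rewrite ffunE f0 // inE.
set O := orbit to L x.
have actO : [acts L, on O | to] by apply: acts_orbit.
have sOS : O \subset S by rewrite acts_sub_orbit.
rewrite (dim_fam_split actO actS sOS) mulnDr (IHk (S :\: O)) ?actsD //; last first.
  rewrite -ltnS (leq_trans _ leS) // ltnS proper_card // properEneq subsetDl andbT.
  by apply: contraTneq Sx => <-; rewrite inE orbit_refl.
rewrite [RHS](big_setID O) /= (setIidPr sOS); congr (_ + _)%N.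
have Oeq y : y \in O -> orbit to L y = O by move=> Oy; apply/orbit_in_eqP.
have cO y : y \in O -> (#|O| * #|('C_L[y | to])%g| = #|L|)%N.
  by move=> Oy; rewrite -(@card_orbit_in_stab _ _ _ to L y sLD) Oeq.
rewrite (eq_bigr (fun y => #|('C_L[y | to])%g| * \dim (fam O))%N) => [|y Oy]; last first.
  by rewrite -dim_fam_orbit Oeq.
rewrite -big_distrl /=; congr (_ * _)%N; apply/eqP.
rewrite -(eqn_pmul2l (cardG_gt0 L)) big_distrr /=; apply/eqP.
have O0 : (0 < #|O|)%N by apply/card_gt0P; exists x; apply: orbit_refl.
apply/eqP; rewrite -(eqn_pmul2l O0) big_distrr /= (eq_bigr (fun=> #|L| * #|L|)%N); last first.
  by move=> y Oy; rewrite mulnCA cO.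
by rewrite sum_nat_const.
Qed.

End Families.

(** * Induction and Frobenius reciprocity *)

Section InductionBlocks.
Variables (F : fieldType) (gT : finGroupType) (G H : {group gT}) (n : nat).
Variable (rH : mx_representation F H n).

Local Notation m := #|rcosets H G|.
Local Notation mc := (\sum_(i < m) n)%N.

(** Block columns of a matrix with values in an induced module (blkr), and
    block rows of a matrix defined on one (blkc): the coordinates of an
    induced module are grouped by the cosets of H. *)
Definition blkr q (A : 'M[F]_(q, mc)) (j : 'I_m) : 'M_(q, n) := submxrow A j.
Definition blkc q (A : 'M[F]_(mc, q)) (j : 'I_m) : 'M_(n, q) := submxcol A j.

Lemma blkrP q (A B : 'M[F]_(q, mc)) : blkr A =1 blkr B -> A = B.
Proof. by move=> e; apply/mxrowP. Qed.

Lemma blkcP q (A B : 'M[F]_(mc, q)) : blkc A =1 blkc B -> A = B.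
Proof. by move=> e; apply/mxcolP. Qed.

Lemma blkr_mul q r (C : 'M[F]_(r, q)) (A : 'M[F]_(q, mc)) j :
  blkr (C *m A) j = C *m blkr A j.
Proof. exact/esym/mul_submxrow. Qed.

Lemma blkc_mul q r (A : 'M[F]_(mc, q)) (C : 'M[F]_(q, r)) j :
  blkc (A *m C) j = blkc A j *m C.
Proof. by apply/matrixP=> i k; rewrite !mxE; apply: eq_bigr => l _; rewrite !mxE. Qed.

Lemma blkr0 q j : blkr (0 : 'M[F]_(q, mc)) j = 0. Proof. exact: submxrow0. Qed.
Lemma blkc0 q j : blkc (0 : 'M[F]_(mc, q)) j = 0. Proof. exact: submxcol0. Qed.

Lemma blkr_lin q a (A B : 'M[F]_(q, mc)) j : blkr (a *: A + B) j = a *: blkr A j + blkr B j.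
Proof. by apply/matrixP=> i k; rewrite !mxE. Qed.

Lemma blkc_lin q a (A B : 'M[F]_(mc, q)) j : blkc (a *: A + B) j = a *: blkc A j + blkc B j.
Proof. by apply/matrixP=> i k; rewrite !mxE. Qed.

Lemma blkr_row q (f : 'I_m -> 'M[F]_(q, n)) j : blkr (\mxrow_(k < m) f k) j = f j.
Proof. exact: mxrowK. Qed.

Lemma blkc_col q (f : 'I_m -> 'M[F]_(n, q)) j : blkc (\mxcol_(k < m) f k) j = f j.
Proof. exact: mxcolK. Qed.

Lemma blkr_ind q (A : 'M[F]_(q, mc)) g j k :
  (transv j * g * (transv k)^-1)%g \in H ->
  blkr (A *m ind_mx G rH g) k = blkr A j *m rH (transv j * g * (transv k)^-1)%g.
Proof.
move=> Hjk; rewrite -{1}[A]submxrowK /ind_mx mul_mxrow_mxblock /blkr mxrowK.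
rewrite (bigD1 j) //= Hjk big1 ?addr0 // => i neq.
case: ifP => [Hik|_]; last by rewrite mulmx0.
case/eqP: neq; apply: (@transv_uniq _ G H (transv k * g^-1)%g).
  by rewrite -groupV !invMg !invgK mulgA.
by rewrite -groupV !invMg !invgK mulgA.
Qed.

Lemma blkc_ind q (B : 'M[F]_(mc, q)) g j k :
  (transv j * g * (transv k)^-1)%g \in H ->
  blkc (ind_mx G rH g *m B) j = rH (transv j * g * (transv k)^-1)%g *m blkc B k.
Proof.
move=> Hjk; rewrite -{1}[B]submxcolK /ind_mx mul_mxblock_mxrow /blkc mxcolK.
rewrite (bigD1 k) //= Hjk big1 ?addr0 // => i neq.
case: ifP => [Hik|_]; last by rewrite mul0mx.
by case/eqP: neq; apply: transv_uniq Hik Hjk.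
Qed.

Lemma transv_exl (k : 'I_m) g : g \in G -> exists j : 'I_m, (transv j * g * (transv k)^-1)%g \in H.
Proof.
move=> Gg; have [|j Hj] := @transv_ex _ G H k g^-1%g; first by rewrite groupV.
by exists j; rewrite -groupV !invMg !invgK mulgA.
Qed.

Lemma transvG (j : 'I_m) : H \subset G -> transv j \in G.
Proof.
move=> sHG; have /rcosetsP[x Gx Ex] := enum_valP j.
rewrite /transv Ex; case: repr_rcosetP => h Hh.
by apply: groupM => //; apply: (subsetP sHG).
Qed.

Lemma enum_val_coset (j k : 'I_m) g : (transv j * g * (transv k)^-1)%g \in H ->
  (enum_val j :* g)%g = enum_val k.
Proof.
rewrite !enum_val_transv -rcosetM -mem_rcoset => /rcoset_eqP; exact.
Qed.

Lemma transv1 : exists2 j : 'I_m, transv j = 1%g & enum_val j = H.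
Proof.
have GH : (H : {set gT}) \in rcosets H G.
  by apply/rcosetsP; exists 1%g; rewrite ?mulg1.
exists (enum_rank_in GH H); rewrite ?enum_rankK_in // /transv enum_rankK_in //.
exact: repr_group.
Qed.

End InductionBlocks.

Section Induction.
Variables (F : fieldType) (gT : finGroupType).
Implicit Types G H L U Q C N : {group gT}.

Definition restrict G H (sHG : H \subset G) (X : representation F G) : representation F H :=
  Representation (subg_repr X sHG).

Lemma res_greprE G H (sHG : H \subset G) (X : representation F G) : res_grepr H X = restrict sHG X.
Proof.
rewrite /res_grepr; case: {-}_ / idP => // sHG'.
by rewrite /restrict (bool_irrelevance sHG' sHG).
Qed.

Lemma mx_repr_sub G H (sHG : H \subset G) (X : representation F G) : mx_repr H X.
Proof. exact: (subg_mx_repr X sHG). Qed.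

Lemma hom_dim_resl G H L (X : representation F G) n (b : gT -> 'M[F]_n) : H \subset G ->
  hom_dim L (res_grepr H X) b = hom_dim L X b.
Proof. by move=> sHG; rewrite (res_greprE sHG). Qed.

Lemma hom_dim_resr G H L (X : representation F G) n (b : gT -> 'M[F]_n) : H \subset G ->
  hom_dim L b (res_grepr H X) = hom_dim L b X.
Proof. by move=> sHG; rewrite (res_greprE sHG). Qed.

Lemma summand_resl G H L (X : representation F G) n (b : gT -> 'M[F]_n) : H \subset G ->
  summand_on L X b <-> summand_on L (res_grepr H X) b.
Proof. by move=> sHG; rewrite (res_greprE sHG). Qed.

Lemma summand_resr G H L (X : representation F G) n (b : gT -> 'M[F]_n) : H \subset G ->
  summand_on L b X <-> summand_on L b (res_grepr H X).
Proof. by move=> sHG; rewrite (res_greprE sHG). Qed.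

(** Frobenius reciprocity: a homomorphism from the induced module is
    determined by its block at the coset H, and any homomorphism f over L
    extends by the blocks f M(t_i). *)
Lemma hom_dim_ind H L (sLH : L \subset H) (W : representation F L) (M : representation F H) :
  hom_dim H (ind_grepr H W) M = hom_dim L W M.
Proof.
have [j0 t0 _] := @transv1 _ H L.
have H1 := group1 H.
apply/eqP; rewrite eqn_leq; apply/andP; split.
  apply: (hom_dim_le (phi := fun f => @blkc _ _ H L _ _ f j0)).
  - by move=> a f h; rewrite blkc_lin.
  - move=> f hf l Ll; rewrite -blkc_mul -(hf l) ?(subsetP sLH) //.
    have Ht : (transv j0 * l * (transv j0)^-1)%g \in L by rewrite t0 mul1g invg1 mulg1.
    by rewrite (blkc_ind _ _ Ht) t0 mul1g invg1 mulg1.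
  move=> f hf f0; apply: blkcP => j; rewrite blkc0.
  have Ht : (transv j0 * transv j * (transv j)^-1)%g \in L by rewrite mulgK t0 group1.
  have := @blkc_ind _ _ H L _ W _ f (transv j) j0 j Ht.
  rewrite mulgK t0 repr_mx1 mul1mx => <-.
  by have -> := hf _ (transvG j sLH); rewrite blkc_mul f0 mul0mx.
apply: (hom_dim_le (phi := fun f => \mxcol_(i < #|rcosets L H|) (f *m M (transv i)))).
- move=> a f h; apply: blkcP => i; rewrite blkc_lin !blkc_col.
  by rewrite mulmxDl -scalemxAl.
- move=> f hf g Hg; apply: blkcP => j.
  have [k Hjk] := transv_ex j Hg.
  rewrite (blkc_ind _ _ Hjk) blkc_mul !blkc_col mulmxA (hf _ Hjk).
  by rewrite -!mulmxA -!repr_mxM ?groupM ?groupV ?transvG // mulgKV.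
move=> f hf /(congr1 (fun A => blkc A j0)); rewrite blkc_col blkc0 t0.
by rewrite repr_mx1 mulmx1.
Qed.

Section IndRes.
Variables (H U L : {group gT}) (sUH : U \subset H) (sLH : L \subset H).
Variable (M : representation F H).

Local Notation famS A B := (@fam F gT L [set: gT]%G _ 'Rs%act _ _ A B (rcosets U H)).

(** A homomorphism to the module obtained from M by restriction to U and
    induction to H is a family of maps to M indexed by the cosets of U, namely
    its blocks multiplied by M(t_j); the equivariance of the family over L no
    longer involves the transversal. *)
Lemma hom_dim_ires_r n (X : gT -> 'M[F]_n) : mx_repr L X ->
  hom_dim L X (ind_grepr H (res_grepr U M)) = \dim (famS X M).
Proof.
move=> reprX; rewrite (res_greprE sUH); set W := restrict sUH M.
have Mt (j : 'I_#|rcosets U H|) : M (transv j) *m M (transv j)^-1%g = 1%:M.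
  by rewrite -repr_mxM ?groupV ?transvG // mulgV repr_mx1.
have Mt' (j : 'I_#|rcosets U H|) : M (transv j)^-1%g *m M (transv j) = 1%:M.
  by rewrite -repr_mxM ?groupV ?transvG // mulVg repr_mx1.
have tL (j : 'I_#|rcosets U H|) : transv j \in H by apply: transvG.
have Mh (j k : 'I_#|rcosets U H|) g : g \in H ->
  M (transv j * g * (transv k)^-1)%g *m M (transv k) = M (transv j) *m M g.
  by move=> Hg; rewrite -!repr_mxM ?groupM ?groupV ?tL // mulgKV.
have Mh' (j k : 'I_#|rcosets U H|) g : g \in H ->
  M (transv j)^-1%g *m M (transv j * g * (transv k)^-1)%g = M g *m M (transv k)^-1%g.
  by move=> Hg; rewrite -!repr_mxM ?groupM ?groupV ?tL // !mulgA mulVg mul1g.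
have sLH' := subsetP sLH.
apply/eqP; rewrite eqn_leq; apply/andP; split.
  pose phi (f : 'M[F]_(n, rdegree (ind_grepr H W))) : {ffun {set gT} -> 'M[F]_(n, rdegree M)} :=
    [ffun s => \sum_(j | enum_val j == s) @blkr _ _ H U _ _ f j *m M (transv j)].
  have phiE f j : phi f (enum_val j) = @blkr _ _ H U _ _ f j *m M (transv j).
    rewrite ffunE (bigD1 j) //= big1 ?addr0 // => k /andP[/eqP/enum_val_inj->].
    by rewrite eqxx.
  apply: (@dimv_inj _ _ _ _ _ phi).
  - move=> a f h; apply/ffunP=> s; rewrite !ffunE scaler_sumr -big_split /=.
    apply: eq_bigr => j _; rewrite scalemxAl -mulmxDl; congr (_ *m _).
    by rewrite blkr_lin.
  - move=> f /homsP hf; apply/famP; split=> [s nS|s g Ss Lg].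
      by rewrite ffunE big1 // => j /eqP sE; rewrite -sE enum_valP in nS.
    have [k sE] : exists k : 'I_#|rcosets U H|, s = enum_val k.
      by exists (enum_rank_in Ss s); rewrite enum_rankK_in.
    rewrite {s Ss}sE; have [j Hj] := transv_ex k (sLH' _ Lg).
    have -> : 'Rs%act (enum_val k) g = enum_val j.
      by rewrite /= rcosetE; apply: enum_val_coset Hj.
    rewrite !phiE mulmxA -blkr_mul (hf g Lg) (blkr_ind _ _ Hj) -!mulmxA; congr (_ *m _).
    exact: Mh (sLH' _ Lg).
  move=> f _ f0; apply: blkrP => j; rewrite blkr0.
  rewrite -[LHS]mulmx1 -(Mt j) mulmxA.
  by have := phiE f j; rewrite f0 ffunE => /esym ->; rewrite mul0mx.
pose psi (f : {ffun {set gT} -> 'M[F]_(n, rdegree M)}) : 'M[F]_(n, rdegree (ind_grepr H W)) :=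
  \mxrow_(j < #|rcosets U H|) (f (enum_val j) *m M (transv j)^-1%g).
have psiE f j : @blkr _ _ H U _ _ (psi f) j = f (enum_val j) *m M (transv j)^-1%g.
  exact: blkr_row.
apply: (@dimv_inj _ _ _ _ _ psi).
- move=> a f h; apply: blkrP => j; rewrite blkr_lin !psiE !ffunE.
  by rewrite mulmxDl -scalemxAl.
- move=> f /famP[_ ff]; apply/homsP=> g Lg; apply: blkrP => k.
  have [j Hj] := transv_exl k (sLH' _ Lg).
  rewrite (blkr_ind _ _ Hj) blkr_mul !psiE mulmxA.
  have -> : enum_val k = 'Rs%act (enum_val j) g.
    by rewrite /= rcosetE; apply/esym; apply: enum_val_coset Hj.
  rewrite ff ?enum_valP // -!mulmxA; congr (_ *m _).
  exact/esym/(Mh' _ _ _ (sLH' _ Lg)).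
move=> f /famP[f0 _] psif0; apply/ffunP=> s; rewrite ffunE.
have [Ss|/f0 //] := boolP (s \in rcosets U H).
have [k sE] : exists k : 'I_#|rcosets U H|, s = enum_val k.
  by exists (enum_rank_in Ss s); rewrite enum_rankK_in.
rewrite sE -[LHS]mulmx1 -(Mt' k) mulmxA -psiE psif0.
by rewrite blkr0 mul0mx.
Qed.

Lemma hom_dim_ires_l n (X : gT -> 'M[F]_n) : mx_repr L X ->
  hom_dim L (ind_grepr H (res_grepr U M)) X = \dim (famS M X).
Proof.
move=> reprX; rewrite (res_greprE sUH); set W := restrict sUH M.
have Mt (j : 'I_#|rcosets U H|) : M (transv j) *m M (transv j)^-1%g = 1%:M.
  by rewrite -repr_mxM ?groupV ?transvG // mulgV repr_mx1.
have Mt' (j : 'I_#|rcosets U H|) : M (transv j)^-1%g *m M (transv j) = 1%:M.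
  by rewrite -repr_mxM ?groupV ?transvG // mulVg repr_mx1.
have tL (j : 'I_#|rcosets U H|) : transv j \in H by apply: transvG.
have Mh (j k : 'I_#|rcosets U H|) g : g \in H ->
  M (transv j * g * (transv k)^-1)%g *m M (transv k) = M (transv j) *m M g.
  by move=> Hg; rewrite -!repr_mxM ?groupM ?groupV ?tL // mulgKV.
have Mh' (j k : 'I_#|rcosets U H|) g : g \in H ->
  M (transv j)^-1%g *m M (transv j * g * (transv k)^-1)%g = M g *m M (transv k)^-1%g.
  by move=> Hg; rewrite -!repr_mxM ?groupM ?groupV ?tL // !mulgA mulVg mul1g.
have sLH' := subsetP sLH.
apply/eqP; rewrite eqn_leq; apply/andP; split.
  pose phi (f : 'M[F]_(rdegree (ind_grepr H W), n)) : {ffun {set gT} -> 'M[F]_(rdegree M, n)} :=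
    [ffun s => \sum_(j | enum_val j == s) M (transv j)^-1%g *m @blkc _ _ H U _ _ f j].
  have phiE f j : phi f (enum_val j) = M (transv j)^-1%g *m @blkc _ _ H U _ _ f j.
    rewrite ffunE (bigD1 j) //= big1 ?addr0 // => k /andP[/eqP/enum_val_inj->].
    by rewrite eqxx.
  apply: (@dimv_inj _ _ _ _ _ phi).
  - move=> a f h; apply/ffunP=> s; rewrite !ffunE scaler_sumr -big_split /=.
    apply: eq_bigr => j _; rewrite scalemxAr -mulmxDr; congr (_ *m _).
    by rewrite blkc_lin.
  - move=> f /homsP hf; apply/famP; split=> [s nS|s g Ss Lg].
      by rewrite ffunE big1 // => j /eqP sE; rewrite -sE enum_valP in nS.
    have [k sE] : exists k : 'I_#|rcosets U H|, s = enum_val k.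
      by exists (enum_rank_in Ss s); rewrite enum_rankK_in.
    rewrite {s Ss}sE; have [j Hj] := transv_ex k (sLH' _ Lg).
    have -> : 'Rs%act (enum_val k) g = enum_val j.
      by rewrite /= rcosetE; apply: enum_val_coset Hj.
    rewrite !phiE -mulmxA -blkc_mul -(hf g Lg) (blkc_ind _ _ Hj) !mulmxA; congr (_ *m _).
    exact/esym/(Mh' _ _ _ (sLH' _ Lg)).
  move=> f _ f0; apply: blkcP => j; rewrite blkc0.
  rewrite -[LHS]mul1mx -(Mt j) -mulmxA.
  by have := phiE f j; rewrite f0 ffunE => /esym ->; rewrite mulmx0.
pose psi (f : {ffun {set gT} -> 'M[F]_(rdegree M, n)}) : 'M[F]_(rdegree (ind_grepr H W), n) :=
  \mxcol_(j < #|rcosets U H|) (M (transv j) *m f (enum_val j)).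
have psiE f j : @blkc _ _ H U _ _ (psi f) j = M (transv j) *m f (enum_val j).
  exact: blkc_col.
apply: (@dimv_inj _ _ _ _ _ psi).
- move=> a f h; apply: blkcP => j; rewrite blkc_lin !psiE !ffunE.
  by rewrite mulmxDr -scalemxAr.
- move=> f /famP[_ ff]; apply/homsP=> g Lg; apply: blkcP => k.
  have [j Hj] := transv_ex k (sLH' _ Lg).
  rewrite (blkc_ind _ _ Hj) blkc_mul !psiE -mulmxA.
  rewrite -ff ?enum_valP // mulmxA.
  have -> : enum_val j = 'Rs%act (enum_val k) g.
    by rewrite /= rcosetE; apply/esym; apply: enum_val_coset Hj.
  rewrite !mulmxA; congr (_ *m _).
  exact: Mh (sLH' _ Lg).
move=> f /famP[f0 _] psif0; apply/ffunP=> s; rewrite ffunE.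
have [Ss|/f0 //] := boolP (s \in rcosets U H).
have [k sE] : exists k : 'I_#|rcosets U H|, s = enum_val k.
  by exists (enum_rank_in Ss s); rewrite enum_rankK_in.
rewrite sE -[LHS]mul1mx -(Mt' k) -mulmxA -psiE psif0.
by rewrite blkc0 mulmx0.
Qed.

End IndRes.
End Induction.

(** * The Moebius function of the subgroup poset *)

Section Moebius.
Variable gT : finGroupType.
Implicit Types U V W Q C H L : {group gT}.

(** The matrices of mu and of the inclusion relation are inverse to each other
    on one side by definition, hence on both sides. *)
Lemma mobius_dual U V : U \proper V ->
  \sum_(W : {group gT} | (U \subset W) && (W \subset V)) mobius W V = 0.
Proof.
move=> ltUV.
pose k := #|{: {group gT}}|.
pose e (i : 'I_k) : {group gT} := enum_val i.
pose M : 'M[int]_k := \matrix_(i, j) mobius (e i) (e j).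
pose Z : 'M[int]_k := \matrix_(i, j) (e i \subset e j)%:R.
have MZ : M *m Z = 1%:M.
  apply/matrixP=> i j; rewrite !mxE.
  under eq_bigr do rewrite !mxE.
  rewrite (reindex (@enum_rank {group gT})) /=; last exact/onW_bij/enum_rank_bij.
  under eq_bigr do rewrite /e enum_rankK.
  have [sij|nsij] := boolP (e i \subset e j); last first.
    rewrite big1 => [|W _].
      by case: eqP nsij => // ->; rewrite subxx.
    have [siW|] := boolP (e i \subset W); last by move/mobius_notsub->; rewrite mul0r.
    have [sWj|] := boolP (W \subset e j); last by rewrite mulr0.
    by rewrite (subset_trans siW sWj) in nsij.
  rewrite (bigID (fun W : {group gT} => (e i \subset W) && (W \subset e j))) /=.
  rewrite addrC big1 ?add0r => [|W]; last first.
    by rewrite negb_and => /orP[/mobius_notsub->|/negPf->]; rewrite ?mul0r ?mulr0.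
  rewrite (eq_bigr (fun W : {group gT} => mobius (e i) W)) => [|W /andP[_ ->]]; last by rewrite mulr1.
  have [eij|neq] := eqVneq i j.
    rewrite eij (big_pred1 (e j)) ?mobius_refl // => W.
    by rewrite /= eq_sym -val_eqE /= eqEsubset.
  rewrite sum_mobius // properEneq sij andbT; apply: contra neq => /eqP eqE.
  by apply/eqP/enum_val_inj/val_inj.
have := mulmx1C MZ => /matrixP/(_ (enum_rank U) (enum_rank V)).
rewrite !mxE; under eq_bigr do rewrite !mxE.
rewrite (reindex (@enum_rank {group gT})) /=; last exact/onW_bij/enum_rank_bij.
under eq_bigr do rewrite /e !enum_rankK.
have -> : (enum_rank U == enum_rank V) = false.
  rewrite (inj_eq enum_rank_inj); apply/negP=> /eqP eUV.
  by rewrite eUV properxx in ltUV.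
rewrite (bigID (fun W : {group gT} => (U \subset W) && (W \subset V))) /=.
rewrite addrC big1 ?add0r => [|W]; last first.
  by rewrite negb_and => /orP[/negPf->|/mobius_notsub->]; rewrite ?mul0r ?mulr0.
by apply: etrans; apply: eq_bigr => W /andP[-> _]; rewrite mul1r.
Qed.

(** Weisner's identity for a single intersection L. Every U containing L has
    its intersection with C between L and C, and the sum of mu(U, H) over all
    these U vanishes by mobius_dual; induction on #|C| - #|L| removes the
    intersections larger than L. *)
Lemma weisner0 C H L : C \proper H -> L \subset C ->
  \sum_(U : {group gT} | (U \subset H) && ((U :&: C)%G == L)) mobius U H = 0.
Proof.
move=> ltCH; have [k] := ubnP (#|C| - #|L|); elim: k L => // k IHk L leL sLC.
have ltLH : L \proper H by apply: sub_proper_trans ltCH.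
have := mobius_dual ltLH.
rewrite (partition_big (fun U : {group gT} => (U :&: C)%G)
  (fun L' : {group gT} => (L \subset L') && (L' \subset C))) /=; last first.
  by move=> U /andP[sLU _]; rewrite subsetI sLU sLC subsetIr.
rewrite (bigD1 L) ?subxx //= [X in _ + X]big1 ?addr0 => [h0|L' /andP[/andP[sLL' sL'C] neq]].
  rewrite -[RHS]h0; apply: eq_bigl => U; case: eqP => [<-|]; rewrite ?andbF // !andbT.
  by rewrite subsetIl.
rewrite -[RHS](IHk L') //.
  apply: eq_bigl => U; case: eqP => [e|]; rewrite ?andbF // !andbT.
  by rewrite (subset_trans sLL') // -e subsetIl.
have ltLL' : L \proper L'.
  by rewrite properEneq sLL' andbT; apply: contra neq => /eqP eLC; apply/eqP/val_inj.
rewrite -ltnS (leq_trans _ leL) // ltnS ltn_sub2l ?proper_card //.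
exact: proper_sub_trans ltLL' sL'C.
Qed.

Lemma weisner Q C H (phi : {group gT} -> int) : C \proper H -> Q \subset C ->
  \sum_(U : {group gT} | (Q \subset U) && (U \subset H)) mobius U H * phi (U :&: C)%G = 0.
Proof.
move=> ltCH sQC.
rewrite (partition_big (fun U : {group gT} => (U :&: C)%G)
  (fun L : {group gT} => (Q \subset L) && (L \subset C))) /=; last first.
  by move=> U /andP[sQU _]; rewrite subsetI sQU sQC subsetIr.
rewrite big1 // => L /andP[sQL sLC].
rewrite (eq_bigr (fun U => mobius U H * phi L)) => [|U /andP[_ /eqP->] //].
rewrite -mulr_suml (eq_bigl (fun U : {group gT} => (U \subset H) && ((U :&: C)%G == L))) => [|U].
  by rewrite weisner0 // mul0r.
case: eqP => [e|]; rewrite ?andbF // !andbT.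
by rewrite (subset_trans sQL) // -e subsetIl.
Qed.

(** Each coset s arises as U g for exactly #|U| elements g. *)
Lemma sum_rcosets U H (f : {set gT} -> nat) : U \subset H ->
  (\sum_(g in H) f (U :* g)%g = #|U| * \sum_(s in rcosets U H) f s)%N.
Proof.
move=> sUH; rewrite (partition_big (fun g => (U :* g)%g) (mem (rcosets U H))) /=; last first.
  by move=> g Hg; apply/rcosetsP; exists g.
rewrite big_distrr /=; apply: eq_bigr => s /rcosetsP[x Hx ->].
rewrite (eq_bigr (fun=> f (U :* x)%g)) => [|g /andP[_ /eqP->] //].
rewrite sum_nat_const -(card_rcoset U x); congr (_ * _)%N; apply: eq_card => g.
rewrite unfold_in /=; apply/andP/idP => [[_ /eqP/rcoset_eqP]|Ug] //.
by rewrite (rcoset_eqP Ug) eqxx; split=> //; case/rcosetP: Ug => u /(subsetP sUH) Hu ->; rewrite groupM.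
Qed.

End Moebius.

(** * The Mackey formula for Hom dimensions, and null modules *)

Section Mackey.
Variables (F : fieldType) (gT : finGroupType).
Implicit Types G H L U Q C N : {group gT}.

Lemma stabRs L U g : ('C_L[(U :* g)%g : {set gT} | 'Rs])%g = (L :&: U :^ g)%g.
Proof.
have := astab1_act 'Rs%act (U : {set gT}) g.
by rewrite /= rcosetE astab1Rs => ->.
Qed.

(** The stabiliser in L of the coset U g is the intersection of L and U^g. *)
Lemma mackey_sum H U L n1 n2 (A : gT -> 'M[F]_n1) (B : gT -> 'M[F]_n2) :
    U \subset H -> L \subset H -> mx_repr L A -> mx_repr L B ->
  (#|L| * #|U| * \dim (@fam F gT L [set: gT]%G _ 'Rs%act _ _ A B (rcosets U H))
    = \sum_(g in H) #|(L :&: U :^ g)%g| * hom_dim (L :&: U :^ g)%g A B)%N.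
Proof.
move=> sUH sLH rA rB.
rewrite (eq_bigr (fun g => #|('C_L[(U :* g)%g : {set gT} | 'Rs])%g|
    * hom_dim ('C_L[(U :* g)%g : {set gT} | 'Rs])%g A B)%N) => [|g _]; last by rewrite stabRs.
rewrite (sum_rcosets (fun s => #|('C_L[s | 'Rs])%g| * hom_dim ('C_L[s | 'Rs])%g A B)%N sUH).
have actL : [acts L, on rcosets U H | 'Rs] by apply: subset_trans sLH (actsRs_rcosets _ _).
by rewrite -(dim_fam (subsetT L) rA rB actL) mulnCA mulnA.
Qed.

(** The Mackey formula at the level of Hom dimensions. Summing over elements g
    of H instead of double cosets turns the formula into a plain sum with
    weights #|L :&: U^g|. *)
Lemma mackey_r H U L (M : representation F H) n (X : gT -> 'M[F]_n) :
    U \subset H -> L \subset H -> mx_repr L X ->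
  (#|L| * #|U| * hom_dim L X (ind_grepr H (res_grepr U M))
    = \sum_(g in H) #|(L :&: U :^ g)%g| * hom_dim (L :&: U :^ g)%g X M)%N.
Proof. by move=> sUH sLH rX; rewrite hom_dim_ires_r // mackey_sum //; apply: mx_repr_sub sLH M. Qed.

Lemma mackey_l H U L (M : representation F H) n (X : gT -> 'M[F]_n) :
    U \subset H -> L \subset H -> mx_repr L X ->
  (#|L| * #|U| * hom_dim L (ind_grepr H (res_grepr U M)) X
    = \sum_(g in H) #|(L :&: U :^ g)%g| * hom_dim (L :&: U :^ g)%g M X)%N.
Proof. by move=> sUH sLH rX; rewrite hom_dim_ires_l // mackey_sum //; apply: mx_repr_sub sLH M. Qed.

Lemma hom_dim_ires H U (M : representation F H) n (X : gT -> 'M[F]_n) :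
  U \subset H -> mx_repr H X -> hom_dim H X (ind_grepr H (res_grepr U M)) = hom_dim U X M.
Proof.
move=> sUH rX; rewrite hom_dim_ires_r // -orbitRs.
rewrite (dim_fam_orbit 'Rs%act (subsetT H) rX (mx_repr_sub (subxx H) M)).
by rewrite astab1Rs (setIidPr sUH).
Qed.

(** By Frobenius reciprocity and additive_relation, this numerical condition
    says that the sum over U of #|U| mu(U, H) times the class of the module
    obtained from Y by restriction to U and induction to H vanishes in the
    Grothendieck group. *)
Definition mobius_null H (Y : representation F H) : Prop :=
  forall M : representation F H,
  \sum_(U : {group gT} | U \subset H) (#|U|%:Z * mobius U H) * (hom_dim U Y M)%:Z = 0.

Lemma mobius_null_split H (X Y Z : representation F H) : iso Y (dadd_grepr X Z) ->
  mobius_null Z -> mobius_null X <-> mobius_null Y.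
Proof.
move=> isoY nZ.
have e (M : representation F H) : \sum_(U : {group gT} | U \subset H) (#|U|%:Z * mobius U H) * (hom_dim U Y M)%:Z
   = \sum_(U : {group gT} | U \subset H) (#|U|%:Z * mobius U H) * (hom_dim U X M)%:Z.
  rewrite -[RHS]addr0 -[X in _ = _ + X](nZ M) -big_split /=; apply: eq_bigr => U sUH.
  by rewrite (hom_dim_additivel M sUH isoY) mulrDr.
by split=> nX M; [rewrite e | rewrite -e].
Qed.

Lemma mobius_null0 H : mobius_null (@grepr0 F gT H).
Proof.
move=> M; apply: big1 => U _; suff -> : hom_dim U (@grepr0 F gT H) M = 0%N by rewrite mulr0.
by apply/eqP; rewrite -leqn0 (leq_trans (dimvS (subvf _))) // dimvf /dim /= mul0n.
Qed.

Lemma mobius_null_iso H (X Y : representation F H) : iso X Y -> mobius_null X -> mobius_null Y.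
Proof.
move=> isoXY; have isoY := iso_trans (iso_sym isoXY) (iso_add0 X).
exact: (mobius_null_split isoY (@mobius_null0 H)).1.
Qed.

Lemma mobius_null_dsum H (s : seq (representation F H)) :
  (forall X, X \in s -> mobius_null X) -> mobius_null (dsum s).
Proof.
elim: s => [|X s IHs] nul /=; first exact: mobius_null0.
have nX : mobius_null X by apply: nul; rewrite mem_head.
apply: (mobius_null_split (iso_refl (dadd_grepr X (dsum s))) _).1 => //.
by apply: IHs => Y sY; apply: nul; rewrite inE sY orbT.
Qed.

(** By the Mackey formula the alternating sum becomes, for each g in H, the
    sum over U of mu(U, H) times a function of the intersection of U with the
    proper subgroup L^(g^-1), which vanishes by Weisner's identity. *)
Lemma mobius_null_ind H L (W : representation F L) : L \proper H -> mobius_null (ind_grepr H W).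
Proof.
move=> ltLH M; have sLH := proper_sub ltLH.
have rW : mx_repr L W by apply: mx_repr_sub (subxx L) W.
apply/eqP; rewrite -(inj_eq (@mulfI _ (#|L|%:Z : int) _)) ?mulr0; last by rewrite eqz_nat -lt0n.
rewrite big_distrr /=.
pose phi g (S : {group gT}) : int := (#|(S :^ g)%g| * hom_dim (S :^ g)%g W M)%N%:Z.
rewrite (eq_bigr (fun U : {group gT} => \sum_(g in H) mobius U H * phi g (U :&: (L :^ g^-1))%G)) => [|U sUH].
  rewrite exchange_big /= big1 // => g Hg.
  rewrite -[RHS](@weisner _ 1%G (L :^ g^-1)%G H (phi g)) ?sub1G //.
    by apply: eq_bigl => U; rewrite sub1G.
  by rewrite /= -(conjGid (groupVr Hg)) properJ.
rewrite -mulr_sumr.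
have -> : \sum_(g in H) phi g (U :&: L :^ g^-1)%G = (#|L| * #|U| * hom_dim U (ind_grepr H W) M)%N%:Z.
  rewrite -(hom_dim_ires M sUH (mx_repr_sub (subxx H) (ind_grepr H W))) hom_dim_ind //.
  rewrite mackey_r // (big_morph Posz PoszD (erefl _)).
  apply: eq_bigr => g Hg.
  by rewrite /phi /= conjIg conjsgKV setIC.
by rewrite !PoszM !mulrA; congr (_ * _); rewrite mulrC mulrA.
Qed.

End Mackey.

(** * Relative projectivity *)

Section Higman.
Variables (F : fieldType) (gT : finGroupType).
Implicit Types G H L U Q C N S : {group gT}.

Lemma hom_dim_ind_gen G U L (W : representation F L) (M : representation F G) :
  L \subset U -> U \subset G -> hom_dim U (ind_grepr U W) M = hom_dim L W M.
Proof.
by move=> sLU sUG; rewrite -(hom_dim_resr _ _ _ sUG) hom_dim_ind // hom_dim_resr.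
Qed.

(** Both sides have the same Hom dimensions by Frobenius reciprocity. *)
Lemma ind_trans H U L (W : representation F L) : L \subset U -> U \subset H ->
  iso (ind_grepr H (ind_grepr U W)) (ind_grepr H W).
Proof.
move=> sLU sUH; apply: iso_of_hom_dim => M.
by rewrite !hom_dim_ind ?(subset_trans sLU) // hom_dim_ind_gen.
Qed.

Lemma summand_ind H L (X Y : representation F L) :
  summand_on L X Y -> summand_on H (ind_grepr H X) (ind_grepr H Y).
Proof.
case=> i [p [hi hp ip]]; exists (ind_hom H L i), (ind_hom H L p); split.
- exact: (Defs.hom_ind (G := H) hi).
- exact: (Defs.hom_ind (G := H) hp).
by rewrite -ind_homM ip ind_hom1.
Qed.

(** M is the block of the induced module at the coset N. *)
Lemma summand_res_ind H N (M : representation F N) : N \subset H -> summand_on N M (ind_grepr H M).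
Proof.
move=> sNH; have [j0 t0 _] := @transv1 _ H N.
have tN (j k : 'I_#|rcosets N H|) g : g \in N -> (transv j * g * (transv k)^-1)%g \in N ->
    (j == j0) = (k == j0).
  move=> Ng Hjk; apply/eqP/eqP => e.
    rewrite e t0 mul1g in Hjk; apply: (@transv_uniq _ H N g) => //.
    by rewrite t0 invg1 mulg1.
  rewrite e t0 invg1 mulg1 in Hjk; apply: (@transv_uniq _ H N g^-1%g).
    by rewrite -groupV invMg !invgK.
  by rewrite t0 invg1 mulg1 groupV.
have sN := subsetP sNH.
exists (\mxrow_(j < #|rcosets N H|) ((if j == j0 then 1%:M else 0) : 'M[F]_(rdegree M))),
       (\mxcol_(j < #|rcosets N H|) ((if j == j0 then 1%:M else 0) : 'M[F]_(rdegree M))); split.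
- move=> g Ng; apply: blkrP => k; have [j Hj] := transv_exl k (sN _ Ng).
  rewrite (blkr_ind _ _ Hj) blkr_mul !blkr_row (tN _ _ _ Ng Hj).
  case: (eqVneq k j0) => [ek|_]; last by rewrite mul0mx mulmx0.
  have /eqP ej : j == j0 by rewrite (tN _ _ _ Ng Hj) ek.
  by rewrite ek ej t0 mul1g invg1 mulg1 mulmx1 mul1mx.
- move=> g Ng; apply: blkcP => j; have [k Hj] := transv_ex j (sN _ Ng).
  rewrite (blkc_ind _ _ Hj) blkc_mul !blkc_col -(tN _ _ _ Ng Hj).
  case: (eqVneq j j0) => [ej|_]; last by rewrite mul0mx mulmx0.
  have /eqP ek : k == j0 by rewrite -(tN _ _ _ Ng Hj) ej.
  by rewrite ek ej t0 mul1g invg1 mulg1 mulmx1 mul1mx.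
rewrite mul_mxrow_mxcol (bigD1 j0) //= eqxx big1 ?addr0 ?mulmx1 // => k /negPf->.
by rewrite mul0mx.
Qed.

(** Higman's criterion: the blocks Y(t_j^-1) theta and Y(t_j) define
    homomorphisms to and from the induced module, whose composite is the
    relative trace of theta. *)
Lemma higman H Q (Y : representation F H) (theta : 'M[F]_(rdegree Y)) : Q \subset H ->
  hom_on Q Y Y theta ->
  \sum_(j < #|rcosets Q H|) Y (transv j)^-1%g *m theta *m Y (transv j) = 1%:M ->
  summand_on H Y (ind_grepr H (res_grepr Q Y)).
Proof.
move=> sQH hth sum1; rewrite (res_greprE sQH).
have tH (j : 'I_#|rcosets Q H|) : transv j \in H by apply: transvG.
exists (\mxrow_(j < #|rcosets Q H|) (Y (transv j)^-1%g *m theta)),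
       (\mxcol_(j < #|rcosets Q H|) Y (transv j)); split; last by rewrite mul_mxrow_mxcol.
- move=> g Hg; apply: blkrP => k; have [j Hj] := transv_exl k Hg.
  rewrite (blkr_ind _ _ Hj) blkr_mul !blkr_row.
  rewrite -[RHS]mulmxA -(hth _ Hj) !mulmxA; congr (_ *m _).
  by rewrite -!repr_mxM ?groupM ?groupV ?tH // !mulgA mulVg mul1g.
move=> g Hg; apply: blkcP => j; have [k Hj] := transv_ex j Hg.
rewrite (blkc_ind _ _ Hj) blkc_mul !blkc_col.
have e : Y (transv j * g * (transv k)^-1)%g *m Y (transv k) = Y (transv j) *m Y g.
  by rewrite -!repr_mxM ?groupM ?groupV ?tH // mulgKV.
exact: e.
Qed.

(** Higman's criterion for theta the scalar inverse of the index. *)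
Lemma summand_index H Q (Y : representation F H) : Q \subset H ->
  (#|H : Q|%g)%:R != 0 :> F -> summand_on H Y (ind_grepr H (res_grepr Q Y)).
Proof.
move=> sQH n0; apply: (@higman _ _ _ ((#|H : Q|%g)%:R^-1%:M)) => //.
  by move=> g _; rewrite scalar_mxC.
rewrite (eq_bigr (fun=> ((#|H : Q|%g)%:R^-1)%:M)) => [|j _]; last first.
  by rewrite scalar_mxC -mulmxA -repr_mxM ?groupV ?transvG // mulVg repr_mx1 mulmx1.
rewrite sumr_const card_ord -scaler_nat scale_scalar_mx.
by rewrite mulfV.
Qed.

(** Converse of Higman's criterion: theta is the composite, through the block
    at the coset Q, of the injection and the projection that make Y a summand. *)
Lemma relative_trace H Q (Y : representation F H) (W : representation F Q) : Q \subset H ->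
  summand_on H Y (ind_grepr H W) -> exists2 theta, hom_on Q Y Y theta &
  \sum_(j < #|rcosets Q H|) Y (transv j)^-1%g *m theta *m Y (transv j) = 1%:M.
Proof.
move=> sQH [i [p [hi hp ip]]]; have [j0 t0 _] := @transv1 _ H Q.
have sQ := subsetP sQH.
exists (@blkr _ _ H Q _ _ i j0 *m @blkc _ _ H Q _ _ p j0).
  move=> q Qq.
  have Hq : (transv j0 * q * (transv j0)^-1)%g \in Q by rewrite t0 mul1g invg1 mulg1.
  have := blkr_ind W i Hq; rewrite t0 mul1g invg1 mulg1 => ei.
  have := blkc_ind W p Hq; rewrite t0 mul1g invg1 mulg1 => ep.
  rewrite mulmxA -blkr_mul -mulmxA -blkc_mul.
  have -> := hi _ (sQ _ Qq); have <- := hp _ (sQ _ Qq).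
  by rewrite /= ei ep mulmxA.
rewrite -ip -{2}[i]submxrowK -{2}[p]submxcolK mul_mxrow_mxcol; apply: eq_bigr => j _.
have Hj : (transv j * (transv j)^-1 * (transv j0)^-1)%g \in Q by rewrite t0 mulgV invg1 mulg1.
have Hj' : (transv j0 * transv j * (transv j)^-1)%g \in Q by rewrite mulgK t0.
have tH : transv j \in H by apply: transvG.
rewrite mulmxA -blkr_mul -mulmxA -blkc_mul.
have -> := hi _ (groupVr tH); have <- := hp _ tH.
rewrite (blkr_ind _ _ Hj) (blkc_ind _ _ Hj').
by rewrite t0 mulgV invg1 mulg1 mul1g mulgV repr_mx1 mulmx1 mul1mx.
Qed.

Lemma relative_summand H Q (Y : representation F H) (W : representation F Q) : Q \subset H ->
  summand_on H Y (ind_grepr H W) -> summand_on H Y (ind_grepr H (res_grepr Q Y)).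
Proof. by move=> sQH /(relative_trace sQH)[theta]; apply: higman. Qed.

(** * Permutation modules *)

Section Perm.
Variable L : {group gT}.

Lemma triv_repr : mx_repr L (fun _ : gT => 1%:M : 'M[F]_1).
Proof. by split=> // x y _ _; rewrite mulmx1. Qed.

Definition triv : representation F L := Representation (MxRepresentation triv_repr).

Lemma perm_triv : permutation_module triv.
Proof.
exists 1%:M; first exact: unitmx1.
by move=> g _ i; exists i; rewrite mulmx1.
Qed.

End Perm.

Section PermModule.
Variables (L : {group gT}) (X : representation F L).
Variables (B : 'M[F]_(rdegree X)) (uB : B \in unitmx).
Hypothesis permB : forall g, g \in L -> forall i, exists j, row i B *m X g = row j B.

(** The action of L on the indices of a permutation basis; the identity
    outside L is a default value. *)
Definition row_to (i : 'I_(rdegree X)) (g : gT) : 'I_(rdegree X) :=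
  if g \in L then odflt i [pick j | row i B *m X g == row j B] else i.

Lemma basis_row_inj i j : row i B = row j B -> i = j.
Proof.
move=> e; have : delta_mx 0 i = delta_mx 0 j :> 'rV[F]_(rdegree X).
  by apply: (row_free_inj (etrans (row_free_unit B) uB)); rewrite -!rowE.
by move/matrixP/(_ 0 i); rewrite !mxE !eqxx /=; case: eqP => // _ /eqP; rewrite oner_eq0.
Qed.

Lemma row_toE i g : g \in L -> row i B *m X g = row (row_to i g) B.
Proof.
move=> Lg; rewrite /row_to Lg; case: pickP => [j /eqP //|no].
by have [j e] := permB Lg i; have := no j; rewrite e eqxx.
Qed.

Lemma row_to_action : is_action L row_to.
Proof.
split=> [g i j /= e|i g h Lg Lh].
  have [Lg|nLg] := boolP (g \in L); last by rewrite /row_to (negPf nLg) in e.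
  have back k : row k B = row (row_to k g) B *m X g^-1%g.
    by rewrite -row_toE // -mulmxA -repr_mxM ?groupV // mulgV repr_mx1 mulmx1.
  by apply: basis_row_inj; rewrite (back i) (back j) e.
apply: basis_row_inj; rewrite -row_toE ?groupM // repr_mxM // mulmxA row_toE //.
by rewrite row_toE.
Qed.

Definition row_action := Action row_to_action.

Lemma hom_dim_perm n (M : gT -> 'M[F]_n) : mx_repr L M ->
  hom_dim L X M = \dim (@fam F gT L L _ row_action _ _ (triv L) M setT).
Proof.
move=> rM; apply/eqP; rewrite eqn_leq; apply/andP; split.
  apply: (@dimv_inj _ _ _ _ _ (fun f : 'M[F]_(rdegree X, n) => [ffun i => row i (B *m f)])).
  - move=> a f h; apply/ffunP=> i; rewrite !ffunE mulmxDr -scalemxAr.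
    by apply/rowP=> k; rewrite !mxE.
  - move=> f /homsP hf; apply/famP; split=> [i|i g _ Lg]; first by rewrite inE.
    rewrite !ffunE mul1mx !row_mul -(row_toE _ Lg) -!mulmxA.
    by rewrite (hf g Lg).
  move=> f _ /ffunP f0; apply: (can_inj (mulKmx uB)); rewrite mulmx0.
  by apply/row_matrixP=> i; have := f0 i; rewrite !ffunE row0.
apply: (@dimv_inj _ _ _ _ _ (fun f : {ffun 'I_(rdegree X) -> 'M[F]_(1, n)} =>
   invmx B *m \matrix_i f i)).
- move=> a f h; rewrite scalemxAr -mulmxDr; congr (_ *m _).
  by apply/matrixP=> i j; rewrite !mxE !ffunE !mxE.
- move=> f /famP[_ ff]; apply/homsP=> g Lg; apply: (can_inj (mulKmx uB)).
  rewrite !mulmxA mulmxV // mul1mx; apply/row_matrixP=> i.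
  rewrite !row_mul row_toE // -!row_mul mulmxV // mul1mx !row_mul !rowK.
  by rewrite -ff ?inE // mul1mx.
move=> f _ /(congr1 (mulmx B)); rewrite mulmxA mulmxV // mul1mx mulmx0 => f0.
by apply/ffunP=> i; rewrite ffunE -(rowK f i) f0 row0.
Qed.

(** A permutation module is the sum of the modules induced from the trivial
    modules of stabilisers of orbit representatives; the formula counts each
    orbit through all of its points. *)
Lemma perm_hom_dim_sum (M : representation F L) :
  (#|L| * hom_dim L X M = \sum_i #|('C_L[i | row_action])%g| *
     hom_dim L (ind_grepr L (triv ('C_L[i | row_action])%G)) M)%N.
Proof.
have rM : mx_repr L M by apply: mx_repr_sub (subxx L) M.
rewrite (hom_dim_perm rM) (dim_fam (subxx L) (triv_repr L) rM); last first.
  by apply/subsetP=> g Lg; rewrite !inE Lg; apply/subsetP=> i; rewrite !inE.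
by apply: eq_big => [i|i _]; rewrite ?inE // hom_dim_ind ?subsetIl.
Qed.

End PermModule.

(** perm_hom_dim_sum carried over to an arbitrary additive function. *)
Lemma perm_additive L (X : representation F L) (Z : zmodType) (psi : representation F L -> Z) :
  additive_rep psi -> permutation_module X ->
  exists s : seq {group gT}, (forall S, S \in s -> S \subset L) /\
    psi X *+ #|L| = \sum_(S <- s) psi (ind_grepr L (triv S)) *+ #|S|.
Proof.
move=> psiD [B uB permB].
exists [seq ('C_L[i | row_action uB permB])%G | i <- enum 'I_(rdegree X)]; split.
  by move=> S /mapP[i _ ->]; apply: subsetIl.
apply/eqP; rewrite -subr_eq0 big_map big_enum /=; apply/eqP.
pose C i := ('C_L[i | row_action uB permB])%G.
have := @additive_relation _ _ L (fun=> True) Z psi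
   ((#|L|%:Z, X) :: [seq (- #|C i|%:Z, ind_grepr L (triv (C i))) | i <- enum 'I_(rdegree X)]).
rewrite big_cons big_map big_enum /= => h; rewrite -[RHS]h //.
- by rewrite -pmulrn -sumrN; congr (_ + _); apply: eq_bigr => i _; rewrite mulrNz -pmulrn.
- by move=> *; apply: psiD.
move=> M; rewrite big_cons big_map big_enum /=.
rewrite mulrzz -PoszM mulnC (perm_hom_dim_sum uB permB) /=.
rewrite (big_morph Posz PoszD (erefl _)) -big_split /= big1 // => i _.
by rewrite mulrNz mulrzz -PoszM mulnC subrr.
Qed.
End Higman.

(** * Independence of irreducible traces *)

Section Independence.
Variables (F : closedFieldType) (gT : finGroupType) (G : {group gT}).
Implicit Types S T X : representation F G.

(** The action of the element with coefficients a of the group algebra. *)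
Definition act_by n (X : gT -> 'M[F]_n) (a : gT -> F) : 'M[F]_n := \sum_(g in G) a g *: X g.

Lemma act_by_lin n (X : gT -> 'M[F]_n) I (r : seq I) (c : I -> F) (a : I -> gT -> F) :
  act_by X (fun g => \sum_(i <- r) c i * a i g) = \sum_(i <- r) c i *: act_by X (a i).
Proof.
rewrite /act_by; under eq_bigr do rewrite scaler_suml.
rewrite exchange_big /=; apply: eq_bigr => i _; rewrite scaler_sumr.
by apply: eq_bigr => g _; rewrite scalerA.
Qed.

Lemma act_by_mul a b : exists c, forall X, act_by X c = act_by X a *m act_by X b.
Proof.
exists (fun g => \sum_(x in G) a x * b (x^-1 * g)%g) => X; rewrite /act_by mulmx_suml.
under eq_bigr do rewrite scaler_suml.
rewrite exchange_big /=; apply: eq_bigr => x Gx; rewrite mulmx_sumr.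
rewrite (reindex_inj (mulgI x)) /=.
apply: eq_big => [y|y Gy]; first by rewrite groupMl.
by rewrite groupMl // in Gy; rewrite mulKg repr_mxM // -scalemxAr -scalemxAl scalerA mulrC.
Qed.

Lemma act_by_delta x : x \in G -> exists a, forall X, act_by X a = X x.
Proof.
move=> Gx; exists (fun g => (g == x)%:R) => X; rewrite /act_by (bigD1 x) //= eqxx scale1r.
by rewrite big1 ?addr0 // => y /andP[_ /negPf->]; rewrite scale0r.
Qed.

(** Burnside's theorem, over an algebraically closed field. *)
Lemma act_by_full S (A : 'M[F]_(rdegree S)) : mx_irreducible S -> exists a, act_by S a = A.
Proof.
move=> irrS; have /andP[_ fullS] := @group_closure_closed_field F gT G _ S irrS.
have /envelop_mxP[a ->] : (A \in enveloping_algebra_mx S)%MS by apply: submx_full.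
by exists a.
Qed.

Lemma schur_iso T S (f : 'M[F]_(rdegree T, rdegree S)) :
  mx_irreducible T -> mx_irreducible S -> hom_on G T S f -> f != 0 -> iso T S.
Proof.
move=> /mx_irrP[_ irrT] /mx_irrP[_ irrS] hf f0.
have free : row_free f.
  rewrite -kermx_eq0; apply: contraTT f0 => k0; rewrite negbK.
  have modK : mxmodule T (kermx f).
    apply/mxmoduleP=> g Gg; apply/sub_kermxP.
    by rewrite -mulmxA (hf g Gg) mulmxA mulmx_ker mul0mx.
  have /row_fullP[u uk] := irrT _ modK k0.
  by rewrite -[f]mul1mx -uk -mulmxA mulmx_ker mulmx0.
have full : row_full f.
  have modf : mxmodule S <<f>>%MS.
    apply/mxmoduleP=> g Gg; rewrite (eqmxMr _ (genmxE f)) genmxE -(hf g Gg).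
    exact: submxMl.
  have := irrS _ modf; rewrite -!mxrank_eq0 genmxE mxrank_eq0 => /(_ f0).
  by rewrite /row_full genmxE.
by exists f => //; rewrite -(eqP free) (eqP full).
Qed.

(** Otherwise the annihilator of T kills S, so that S becomes a module for the
    full matrix algebra of T. The images of a vector w of S under the matrix
    units of a row i then define a homomorphism f i from T to S; as S and T
    are not isomorphic, it is zero by Schur's lemma for all i, although w is
    the sum over i of its images under the diagonal matrix units. *)
Lemma separate_two S T : mx_irreducible S -> mx_irreducible T -> ~ iso T S ->
  exists a, act_by T a = 0 /\ act_by S a != 0.
Proof.
move=> irrS irrT niso; apply: contrapT => nex.
have sub a : act_by T a = 0 -> act_by S a = 0.
  by move=> Ta; apply/eqP; apply: contrapT => /negP Sa; apply: nex; exists a.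
have eqTS a b : act_by T a = act_by T b -> act_by S a = act_by S b.
  move=> e; have evB n (X : gT -> 'M[F]_n) : act_by X (fun g => a g - b g) = act_by X a - act_by X b.
    by rewrite /act_by -sumrB; apply: eq_bigr => g _; rewrite scalerBl.
  by apply/eqP; rewrite -subr_eq0 -evB; apply/eqP/sub; rewrite evB e subrr.
have dS : (0 < rdegree S)%N by case/mx_irrP: irrS.
pose w : 'rV[F]_(rdegree S) := const_mx 1.
have w0 : w != 0.
  by apply/eqP=> /matrixP/(_ 0 (Ordinal dS)) /eqP; rewrite !mxE oner_eq0.
have [al alE] : exists al : 'I_(rdegree T) -> 'I_(rdegree T) -> gT -> F,
    forall i j, act_by T (al i j) = delta_mx i j.
  have ex i j : exists a, act_by T a = delta_mx i j by apply: act_by_full.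
  by exists (fun i j => projT1 (cid (ex i j))) => i j; case: cid.
pose f i : 'M[F]_(rdegree T, rdegree S) := \matrix_j (w *m act_by S (al i j)).
have hf i : hom_on G T S (f i).
  move=> g Gg; apply/row_matrixP=> j; rewrite !row_mul rowK -mulmxA.
  have [b bE] := act_by_delta Gg; have [c cE] := act_by_mul (al i j) b.
  rewrite -(bE S) -cE.
  have -> : act_by S c = act_by S (fun h => \sum_k T g j k * al i k h).
    apply: eqTS; rewrite cE bE alE act_by_lin; apply/matrixP=> x y.
    rewrite !mxE summxE (bigD1 j) //= [X in _ + X]big1 ?addr0 => [|k /negPf kj]; last first.
      by rewrite !mxE kj andbF mul0r.
    rewrite [RHS](bigD1 y) //= [X in _ + X]big1 ?addr0 => [|k /negPf ky]; last first.
      by rewrite !alE !mxE [y == k]eq_sym ky andbF mulr0.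
    by rewrite alE !mxE !eqxx !andbT mulrC.
  rewrite act_by_lin mulmx_sumr mulmx_sum_row; apply: eq_bigr => k _.
  by rewrite !mxE rowK -scalemxAr.
have [i fi0|f0] := pickP (fun i => f i != 0).
  by apply: niso; apply: schur_iso (hf i) fi0.
have wz : w *m act_by S (fun h => \sum_i 1 * al i i h) = 0.
  rewrite act_by_lin mulmx_sumr big1 // => i _; rewrite scale1r.
  by have /negbFE/eqP/row_matrixP/(_ i) := f0 i; rewrite rowK row0.
case/eqP: w0; rewrite -[w]mulmx1 -(repr_mx1 S); have [e eE] := act_by_delta (group1 G).
rewrite -eE -wz; congr (_ *m _); apply: eqTS; rewrite eE act_by_lin repr_mx1.
rewrite mx1_sum_delta; apply: eq_bigr => i _; by rewrite scale1r alE.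
Qed.

(** Elements separating S from each module of the list are multiplied
    together, with matrix units of S inserted in between so that the product
    does not vanish on S. *)
Lemma separate_from S (s : seq (representation F G)) : mx_irreducible S ->
  (forall T, T \in s -> mx_irreducible T /\ ~ iso T S) ->
  exists a, (forall T, T \in s -> act_by T a = 0) /\ \tr (act_by S a) != 0.
Proof.
move=> irrS irrs; have nzE n (A : 'M[F]_n) : A != 0 -> exists i j, A i j != 0.
  move=> A0; apply: contrapT => nex; case/eqP: A0; apply/matrixP=> i j; rewrite mxE.
  by apply/eqP; apply: contrapT => /negP Aij; apply: nex; exists i, j.
suff [a [a0 aS]] : exists a, (forall T, T \in s -> act_by T a = 0) /\ act_by S a != 0.
  have [i [j Aij]] := nzE _ _ aS; have [b bE] := act_by_full (delta_mx j i) irrS.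
  have [c cE] := act_by_mul a b; exists c; split=> [T sT|]; first by rewrite cE a0 ?mul0mx.
  rewrite cE bE (_ : \tr _ = act_by S a i j) // /mxtrace.
  under eq_bigr do rewrite mxE.
  rewrite (bigD1 i) //= [X in _ + X]big1 ?addr0 => [|k /negPf ki]; last first.
    by rewrite big1 // => l _; rewrite mxE ki andbF mulr0.
  rewrite (bigD1 j) //= big1 ?addr0 => [|l /negPf lj]; first by rewrite mxE !eqxx mulr1.
  by rewrite mxE lj mulr0.
elim: s irrs => [|T s IHs] irrs.
  have [e eE] := act_by_delta (group1 G); exists e; split=> //.
  by rewrite eE repr_mx1 -mxrank_eq0 mxrank1 -lt0n; case/mx_irrP: irrS.
have [|a [a0 aS]] := IHs; first by move=> V sV; apply: irrs; rewrite inE sV orbT.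
have [irrT nisoT] := irrs T (mem_head _ _).
have [b [b0 bS]] := separate_two irrS irrT nisoT.
have [i [j Aij]] := nzE _ _ aS; have [k [l Bkl]] := nzE _ _ bS.
have [x xE] := act_by_full (delta_mx j k) irrS.
have [c cE] := act_by_mul x b; have [d dE] := act_by_mul a c.
exists d; split=> [V|].
  rewrite inE => /orP[/eqP->|sV]; rewrite dE; first by rewrite cE b0 !mulmx0.
  by rewrite a0 // mul0mx.
rewrite dE cE xE; apply/eqP=> /matrixP/(_ i l) /eqP.
rewrite mulmxA !mxE (bigD1 k) //= [X in _ + X]big1 ?addr0 => [|y /negPf yk]; last first.
  by rewrite mxE big1 ?mul0r // => z _; rewrite mxE yk andbF mulr0.
rewrite mxE (bigD1 j) //= [X in _ + X]big1 ?addr0 => [|y /negPf yj]; last first.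
  by rewrite mxE yj mulr0.
by rewrite mxE !eqxx mulr1 mulf_eq0 (negPf Aij) (negPf Bkl).
Qed.

Lemma tr_act_by n (X : gT -> 'M[F]_n) a : \tr (act_by X a) = \sum_(g in G) a g * \tr (X g).
Proof. by rewrite /act_by raddf_sum; apply: eq_bigr => g _; apply: mxtraceZ. Qed.

(** Evaluate the relation at an element that acts as zero on all the other
    modules and with non-zero trace on S. *)
Lemma irr_tr_indep (r : seq (representation F G)) (c : representation F G -> F) :
  uniq r -> (forall S, S \in r -> mx_irreducible S) ->
  {in r &, forall S T, iso S T -> S = T} ->
  (forall h, h \in G -> \sum_(S <- r) c S * \tr (S h) = 0) ->
  forall S, S \in r -> c S = 0.
Proof.
move=> uniq_r irr noniso tr0 S rS.
have [|a [a0 aS]] := @separate_from S (rem S r) (irr S rS).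
  move=> T; rewrite mem_rem_uniq // inE => /andP[neq rT]; split; first exact: irr.
  by move=> isoTS; case/eqP: neq; apply: noniso.
have : \sum_(T <- r) c T * \tr (act_by T a) = 0.
  transitivity (\sum_(g in G) a g * \sum_(T <- r) c T * \tr (T g)).
    under [RHS]eq_bigr do rewrite mulr_sumr.
    rewrite exchange_big /=; apply: eq_bigr => T _; rewrite tr_act_by mulr_sumr.
    by apply: eq_bigr => g _; rewrite mulrCA.
  by rewrite !big1 // => g Gg; rewrite tr0 ?mulr0.
rewrite (perm_big _ (perm_to_rem rS)) big_cons /= [X in _ + X]big_seq big1 ?addr0 => [/eqP|T sT].
  by rewrite mulf_eq0 (negPf aS) orbF => /eqP.
by rewrite a0 // mxtrace0 mulr0.
Qed.

End Independence.

Section PRegular.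
Variables (F : closedFieldType) (p : nat) (charF : p \in [pchar F]).
Variables (gT : finGroupType) (G : {group gT}).
Implicit Types X : representation F G.

(** All eigenvalues are zero. *)
Lemma nilpotent_tr n (A : 'M[F]_n.+1) k : A ^+ k = 0 -> \tr A = 0.
Proof.
move=> Ak; have [r rE] := closed_field_poly_normal (char_poly A).
rewrite (monicP (char_poly_monic A)) scale1r in rE.
have r0 z : z \in r -> z = 0.
  move=> rz; have : root (char_poly A) z by rewrite rE root_prod_XsubC.
  rewrite -root_mxminpoly => rootz.
  have : mxminpoly A %| 'X^k by apply: mxminpoly_min; rewrite rmorphXn /= horner_mx_X.
  case/dvdpP=> q qE; have : root 'X^k z by rewrite qE rootM rootz orbT.
  by rewrite /root hornerXn expf_eq0 => /andP[_ /eqP].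
have cE : char_poly A = 'X^(size r).
  rewrite rE big_seq (eq_bigr (fun=> 'X)) => [|z /r0->]; last by rewrite subr0.
  by rewrite -big_seq big_const_seq count_predT iter_mulr_1.
have szr : size r = n.+1 by have := size_char_poly A; rewrite cE size_polyXn => -[].
have := char_poly_trace A (ltn0Sn n); rewrite cE szr coefXn /=.
by rewrite ltn_eqF // => /esym/eqP; rewrite oppr_eq0 => /eqP.
Qed.

(** In characteristic p, the difference of the commuting matrices X(h) and
    X(h_p') has p^k-th power X(h^(p^k)) - X(h_p'^(p^k)), which is zero when
    p^k is the order of the p-part of h. *)
Lemma tr_pregular X h : h \in G -> \tr (X h) = \tr (X (h.`_p^')%g).
Proof.
move=> Gh; have Gc : (h.`_p^')%g \in G by rewrite groupX.
case: X => [[|n] rX] /=; first by rewrite /mxtrace !big_ord0.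
apply/eqP; rewrite -subr_eq0 -raddfB; apply/eqP.
apply: (@nilpotent_tr _ _ #[h.`_p]%g).
have charM : p \in [pchar 'M[F]_n.+1].
  by rewrite pchar_lalg.
have comm : GRing.comm (rX h) (rX (h.`_p^')%g).
  by rewrite /GRing.comm -!repr_mxMr // (commuteX _ (commute_refl h)).
have [k qE] : exists k, #[h.`_p]%g = (p ^ k)%N.
  by have /p_natP[k ->] : p.-nat #[h.`_p]%g; [apply: p_elt_constt | exists k].
have frob j : (rX h - rX (h.`_p^')%g) ^+ (p ^ j) = rX h ^+ (p ^ j) - rX (h.`_p^')%g ^+ (p ^ j).
  elim: j => [|j IHj]; first by rewrite !expr1.
  rewrite expnSr !exprM IHj -!(pFrobenius_autE charM) pFrobenius_autB_comm //.
  exact/commrX/commr_sym/commrX/commr_sym.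
rewrite qE frob -qE -!repr_mxX // -{1}(consttC p h) expgMn; last first.
  by apply: commuteX2; apply: commute_refl.
by rewrite expg_order mul1g subrr.
Qed.
End PRegular.

(** * Short exact sequences *)

Section Factors.
Variables (F : fieldType) (gT : finGroupType) (G : {group gT}).
Implicit Types X Y S T M K C : representation F G.

(** A short exact sequence of modules 0 -> K -> M -> C -> 0 with maps i1 and
    p2, and a splitting j1, j2 of the underlying vector spaces. *)
Definition ses M K C (i1 : 'M[F]_(rdegree K, rdegree M)) (p2 : 'M[F]_(rdegree M, rdegree C))
    (j1 : 'M[F]_(rdegree M, rdegree K)) (j2 : 'M[F]_(rdegree C, rdegree M)) : Prop :=
  [/\ hom_on G K M i1, hom_on G M C p2, i1 *m p2 = 0, i1 *m j1 = 1%:M &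
      j2 *m p2 = 1%:M /\ j1 *m i1 + p2 *m j2 = 1%:M].

Lemma submod_ses M (U : 'M[F]_(rdegree M)) : mxmodule M U ->
  exists K C i1 p2 j1 j2, [/\ @ses M K C i1 p2 j1 j2, rdegree K = \rank U,
    rdegree C = (rdegree M - \rank U)%N & (i1 :=: U)%MS].
Proof.
move=> modU; exists (Representation (submod_repr modU)), (Representation (factmod_repr modU)).
exists (val_submod 1%:M), (in_factmod U 1%:M), (in_submod U 1%:M), (val_factmod 1%:M).
split=> //=; [split | by rewrite mxrank_coker | exact: val_submod1].
- by move=> g Gg; rewrite /= -[LHS]val_submodE -[submod_mx _ _]mul1mx val_submodJ.
- by move=> g Gg; rewrite /= -in_factmodE -[M g]mul1mx in_factmodJ.
- by apply/eqP; rewrite -in_factmodE in_factmod_eq0 val_submodP.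
- by rewrite -in_submodE val_submodK.
split; first by rewrite -in_factmodE val_factmodK.
by rewrite -[RHS](add_sub_fact_mod U) [val_submod _ in RHS]val_submodE [val_factmod _ in RHS]val_factmodE.
Qed.

Variables (M K C : representation F G).
Variables (i1 : 'M[F]_(rdegree K, rdegree M)) (p2 : 'M[F]_(rdegree M, rdegree C)).
Variables (j1 : 'M[F]_(rdegree M, rdegree K)) (j2 : 'M[F]_(rdegree C, rdegree M)).
Hypothesis sesM : ses i1 p2 j1 j2.

Lemma ses_hom_dim_le Y : (hom_dim G Y M <= hom_dim G Y K + hom_dim G Y C)%N.
Proof.
case: sesM => h1 h2 e12 e11 [e22 e].
rewrite [X in (X <= _)%N]/hom_dim -(limg_ker_dim (linfun (mulmxr p2))) leq_add //.
  apply: (@dimv_inj _ _ _ _ _ (fun f : 'M[F]_(rdegree Y, rdegree M) => f *m j1)).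
  - by move=> a f h; rewrite mulmxDl -scalemxAl.
  - move=> f; rewrite memv_cap memv_ker lfunE /= => /andP[/homsP hf /eqP fp].
    have fE : f *m j1 *m i1 = f.
      by rewrite -[RHS]mulmx1 -e mulmxDr !mulmxA fp mul0mx addr0.
    apply/homsP=> g Gg; rewrite -[LHS]mulmx1 -[RHS]mulmx1 -e11 [LHS]mulmxA [RHS]mulmxA; congr (_ *m _).
    by rewrite -[LHS]mulmxA fE -[RHS]mulmxA (h1 g Gg) mulmxA fE hf.
  move=> f; rewrite memv_cap memv_ker lfunE /= => /andP[/homsP hf /eqP fp] fj.
  by rewrite -[f]mulmx1 -e mulmxDr !mulmxA fp fj !mul0mx addr0.
apply: dimvS; apply/subvP=> _ /memv_imgP[f /homsP hf ->]; rewrite lfunE /=.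
by apply/homsP; apply: hom_on_comp hf _.
Qed.

(** A projection P onto K that is a homomorphism over L splits the sequence
    over L. *)
Lemma ses_split (L : {set gT}) (P : 'M[F]_(rdegree M)) : L \subset G -> hom_on L M M P ->
  i1 *m P = i1 -> P *m p2 = 0 -> exists j1' j2', split_by L M K C i1 j2' j1' p2.
Proof.
move=> sLG hP iP Pp; case: sesM => h1 h2 e12 e11 [e22 e].
have Pji : P *m j1 *m i1 = P.
  by rewrite -[RHS]mulmx1 -e mulmxDr !mulmxA Pp mul0mx addr0.
have pj : p2 *m j2 *m (1%:M - P) = 1%:M - P.
  have : (j1 *m i1 + p2 *m j2) *m (1%:M - P) = 1%:M - P by rewrite e mul1mx.
  rewrite mulmxDl (_ : j1 *m i1 *m _ = 0) ?add0r //.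
  by rewrite mulmxBr mulmx1 -mulmxA iP subrr.
exists (P *m j1), (j2 *m (1%:M - P)); split; first split.
- exact: hom_onS sLG h1.
- move=> g Lg; have Gg := subsetP sLG g Lg.
  have : p2 *m (C g *m (j2 *m (1%:M - P))) = p2 *m (j2 *m (1%:M - P) *m M g).
    rewrite !mulmxA -(h2 g Gg) pj -[LHS]mulmxA -[LHS]mulmxA (mulmxA p2) pj.
    by rewrite mulmxBr mulmxBl mulmx1 mul1mx hP.
  by move/(congr1 (mulmx j2)); rewrite !(mulmxA j2) e22 !mul1mx -!mulmxA.
- move=> g Lg; have Gg := subsetP sLG g Lg.
  rewrite -[LHS]mulmx1 -[RHS]mulmx1 -e11 [LHS]mulmxA [RHS]mulmxA; congr (_ *m _).
  by rewrite -[LHS]mulmxA Pji -[RHS]mulmxA (h1 g Gg) mulmxA Pji hP.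
- exact: hom_onS sLG h2.
- split.
  + by rewrite mulmxA iP e11.
  + by rewrite mulmxBr mulmx1 mulmxBl e22 -mulmxA Pp mulmx0 subr0.
  + exact: e12.
  + have PP : P *m (P *m j1) = P *m j1.
      by rewrite -{1}Pji -!mulmxA (mulmxA i1) iP e11 mulmx1.
    by rewrite -mulmxA mulmxBl mul1mx PP subrr mulmx0.
by rewrite Pji mulmxA pj addrC subrK.
Qed.

End Factors.

(** * Composition factors and p-regular elements *)

Section Representatives.
Variables (F : fieldType) (gT : finGroupType) (G : {group gT}).
Implicit Types (s t r : seq (representation F G)).

Lemma iso_reps t : exists r, [/\ uniq r, {subset r <= t},
  {in r &, forall S T, iso S T -> S = T} & forall S, S \in t -> exists2 R, R \in r & iso R S].
Proof.
elim: t => [|S t [r [ur srt dr rt]]]; first by exists [::].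
have [[R rR isoRS]|nex] := pselect (exists2 R, R \in r & iso R S).
  exists r; split=> // [V /srt|V]; rewrite inE; first by rewrite orbC => ->.
  by case/orP=> [/eqP->|/rt //]; exists R.
exists (S :: r); split=> /=.
- rewrite ur andbT; apply/negP=> rS; apply: nex; exists S => //; exact: iso_refl.
- by move=> V; rewrite !inE => /orP[->//|/srt->]; rewrite orbT.
- move=> V W; rewrite !inE => /orP[/eqP->|rV] /orP[/eqP->|rW] // isoVW.
  + by case: nex; exists W => //; apply: iso_sym.
  + by case: nex; exists V.
  + exact: dr.
move=> V; rewrite inE => /orP[/eqP->|/rt[R rR isoRV]].
  by exists S; rewrite ?mem_head //; apply: iso_refl.
by exists R; rewrite // inE rR orbT.
Qed.

Lemma sum_reps (phi : representation F G -> int) t r s :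
  uniq r -> {in r &, forall S T, iso S T -> S = T} ->
  (forall S, S \in t -> exists2 R, R \in r & iso R S) -> {subset s <= t} ->
  (forall S T, iso S T -> phi S = phi T) ->
  \sum_(S <- s) phi S = \sum_(R <- r) (iso_count R s)%:Z * phi R.
Proof.
move=> ur dr rt st phi_iso; elim: s st => [|S s IHs] st.
  by rewrite big_nil big1 // => R _; rewrite mul0r.
rewrite big_cons IHs => [|V sV]; last by apply: st; rewrite inE sV orbT.
have [R rR isoRS] := rt S (st S (mem_head _ _)).
rewrite /iso_count /=; under [RHS]eq_bigr do rewrite PoszD mulrDl.
rewrite [RHS]big_split /=; congr (_ + _).
rewrite (big_rem R) //= (asboolT isoRS) mul1r big_seq big1 ?addr0 => [|V].
  exact/esym/phi_iso.
rewrite mem_rem_uniq // inE => /andP[neq rV]; rewrite (asboolF _) ?mul0r // => isoVS.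
case/eqP: neq; apply: dr => //; apply: iso_trans isoVS (iso_sym isoRS).
Qed.
End Representatives.

Section BrauerNesbitt.
Variables (F : closedFieldType) (p : nat) (charF : p \in [pchar F]).
Variables (gT : finGroupType) (G : {group gT}).
Implicit Types X Y S T M : representation F G.
Implicit Types (s t r : seq (representation F G)).

Lemma tr_additive (L : {group gT}) x : x \in L ->
  additive_rep (fun X : representation F L => \tr (X x)).
Proof.
move=> Lx X Y Z /split_iso[i1 [i2 [p1 [p2 [[h1 h2 h3 h4] [e11 e22 e12 e21] e]]]]].
rewrite -[Y x]mulmx1 -e mulmxDr mxtraceD !mulmxA; congr (_ + _).
  by rewrite h3 // -mulmxA mxtrace_mulC -mulmxA e11 mulmx1.
by rewrite h4 // -mulmxA mxtrace_mulC -mulmxA e22 mulmx1.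
Qed.

(** The combination of irreducible modules with coefficients d vanishes on
    restriction to every cyclic p'-subgroup, where modules are semisimple and
    classes are detected by Hom dimensions. *)
Definition balanced r (d : representation F G -> int) : Prop :=
  forall x, x \in G -> (p^'.-elt x)%g -> forall X : representation F <[x]>%G,
  \sum_(S <- r) d S * (hom_dim <[x]>%g S X)%:Z = 0.

(** The traces of the combination vanish at p'-elements, hence everywhere by
    tr_pregular; independence of the traces of irreducible modules gives d S =
    0 in F. *)
Lemma balanced_dvd r d : uniq r -> (forall S, S \in r -> mx_irreducible S) ->
  {in r &, forall S T, iso S T -> S = T} -> balanced r d ->
  forall S, S \in r -> (p %| d S)%Z.
Proof.
move=> ur irr dr bal S rS; rewrite (dvdz_pcharf charF); apply/eqP.
apply: (irr_tr_indep (c := fun S => (d S)%:~R) ur irr dr _ rS) => h Gh.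
set x := (h.`_p^')%g; have Gx : x \in G by rewrite groupX.
have px : (p^'.-elt x)%g by apply: p_elt_constt.
have sxG : <[x]>%G \subset G by rewrite cycle_subG.
have := @additive_relation _ _ _ (fun=> True) F _ [seq (d V, restrict sxG V) | V <- r]
  (fun a b c _ _ _ => @tr_additive <[x]>%G x (cycle_id x) a b c).
rewrite big_map /= => H; rewrite -[RHS]H //.
  by apply: eq_bigr => T _; rewrite (tr_pregular charF) // mulrzl.
move=> X; rewrite big_map /= -[RHS](bal x Gx px X).
by apply: eq_bigr => T _; rewrite mulrzz mulrC.
Qed.

(** In the spirit of Brauer and Nesbitt, but without Brauer characters: the
    coefficients are divisible by p, and d / p is balanced again. *)
Lemma balanced0 r d : uniq r -> (forall S, S \in r -> mx_irreducible S) ->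
  {in r &, forall S T, iso S T -> S = T} -> balanced r d ->
  forall S, S \in r -> d S = 0.
Proof.
move=> ur irr dr bal S rS.
have pn n : forall d, balanced r d -> ((p ^ n)%N %| d S)%Z.
  elim: n => [|n IHn] d' bal'; first by rewrite dvd1z.
  have dvd := balanced_dvd ur irr dr bal'.
  have bal'' : balanced r (fun T => (d' T %/ p)%Z).
    move=> x Gx px X; apply/eqP.
    have p0 : (p%:Z != 0) by rewrite eqz_nat -lt0n prime_gt0 // (pcharf_prime charF).
    have := bal' x Gx px X; set S0 := (X in _ -> X == 0) => bal0.
    suff : p%:Z * S0 == 0 by rewrite mulf_eq0 (negPf p0).
    apply/eqP; rewrite -[RHS]bal0 big_distrr /= [LHS]big_seq [RHS]big_seq.
    apply: eq_bigr => T rT.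
    by rewrite mulrA; congr (_ * _); rewrite mulrC divzK ?dvd.
  by rewrite -(divzK (dvd _ rS)) expnSr PoszM; apply: dvdz_mul; [exact: (IHn _ bal'') | exact: dvdzz].
have := pn `|d S|%N d bal; rewrite dvdzE /= => dv.
apply/eqP; rewrite -absz_eq0; apply: contraT; rewrite -lt0n => d0.
have := dvdn_leq d0 dv; rewrite leqNgt ltn_expl // prime_gt1 //.
exact: pcharf_prime charF.
Qed.

(** On a cyclic p'-subgroup the filtration splits by Maschke's theorem, so Hom
    dimensions add up there; over G they are only subadditive. *)
Lemma composition_factors (Q : {group gT}) M : Q \subset G -> (forall q, q \in Q -> M q = 1%:M) ->
  exists s : seq (representation F G), [/\
    forall S, S \in s -> mx_irreducible S /\ forall q, q \in Q -> S q = 1%:M,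
    rdegree M = (\sum_(S <- s) rdegree S)%N,
    forall Y, (hom_dim G Y M <= \sum_(S <- s) hom_dim G Y S)%N
    & forall x, x \in G -> (p^'.-elt x)%g -> forall X : representation F <[x]>%G,
      hom_dim <[x]>%g M X = (\sum_(S <- s) hom_dim <[x]>%g S X)%N].
Proof.
move=> /subsetP sQG; have [n] := ubnP (rdegree M); elim: n M => // n IHn M leM QM.
have [dM|dM] := posnP (rdegree M).
  exists [::]; split=> [//||Y|x Gx px X]; rewrite big_nil //.
    by rewrite (leq_trans (dimvS (subvf _))) // dimvf /dim /= dM muln0.
  by apply/eqP; rewrite -leqn0 (leq_trans (dimvS (subvf _))) // dimvf /dim /= dM mul0n.
have [irrM|nirrM] := pselect (mx_irreducible M).
  exists [:: M]; split=> [S|||]; rewrite ?big_seq1 //.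
    by rewrite inE => /eqP->.
  by move=> Y; rewrite big_seq1.
  by move=> x _ _ X; rewrite big_seq1.
have [U [modU U0 fullU]] : exists U : 'M[F]_(rdegree M), [/\ mxmodule M U, U != 0 & ~~ row_full U].
  apply: contrapT => nex; apply: nirrM; apply/mx_irrP; split=> // U modU U0.
  by apply: contraT => nfull; case: nex; exists U.
have [K [C [i1 [p2 [j1 [j2 [sesM dK dC eqU]]]]]]] := submod_ses modU.
have [h1 h2 e12 e11 [e22 e]] := sesM.
have rU : (0 < \rank U < rdegree M)%N.
  by rewrite lt0n mxrank_eq0 U0 /= ltn_neqAle rank_leq_col andbT.
case/andP: rU => rU0 rUM.
have QK q : q \in Q -> K q = 1%:M.
  by move=> Qq; rewrite -[LHS]mulmx1 -e11 mulmxA h1 ?sQG // QM // mulmx1.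
have QC q : q \in Q -> C q = 1%:M.
  by move=> Qq; rewrite -[LHS]mul1mx -e22 -mulmxA -h2 ?sQG // QM // mul1mx.
have [|s [s1 s2 s3 s4]] := IHn K _ QK; first by rewrite dK -ltnS (leq_trans _ leM).
have [|t [t1 t2 t3 t4]] := IHn C _ QC.
  by rewrite dC -ltnS (leq_trans _ leM) // ltnS ltn_subrL rU0 (leq_trans rU0 (ltnW rUM)).
exists (s ++ t); split.
- by move=> S; rewrite mem_cat => /orP[/s1|/t1].
- by rewrite big_cat /= -s2 -t2 dK dC subnKC // ltnW.
- move=> Y; rewrite big_cat /= (leq_trans (ses_hom_dim_le sesM Y)) //.
  exact: leq_add (s3 Y) (t3 Y).
move=> x Gx px X; rewrite big_cat /= -s4 // -t4 //.
have sxG : <[x]>%G \subset G by rewrite cycle_subG.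
have pL : ([pchar F]^'.-group <[x]>)%g.
  by rewrite /pgroup (eq_pnat _ (eq_negn (pcharf_eq charF))).
have modU' : mxmodule (restrict sxG M) U by apply: mxmodule_subg.
have [W modW defW dxW] := @mx_Maschke_pchar _ _ _ _ (restrict sxG M) pL U modU' (submx1 U).
have dx0 : (U :&: W = 0)%MS by apply/mxdirect_addsP.
have hP : hom_on <[x]>%g M M (proj_mx U W).
  have := proj_mx_hom dx0 modU' modW; rewrite defW => /hom_mxP h g xg.
  by have := h g xg; rewrite !mul1mx.
have [||j1' [j2' sp]] := ses_split sesM sxG hP.
- by apply: proj_mx_id; rewrite // eqU.
- have /submxP[D ->] : (proj_mx U W <= i1)%MS.
    by rewrite eqU -[proj_mx U W]mul1mx proj_mx_sub.
  by rewrite -mulmxA e12 mulmx0.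
exact: (hom_dim_splitl sp X).
Qed.

End BrauerNesbitt.

(** * Normal subgroups of index divisible by p *)

Section NormalVertex.
Variables (F : closedFieldType) (p : nat) (charF : p \in [pchar F]).
Variables (gT : finGroupType) (H Q : {group gT}).
Hypotheses (nsQH : (Q <| H)%g) (pHQ : (p %| #|H : Q|%g)%N).
Implicit Types X Y M : representation F H.
Implicit Types U L : {group gT}.

Let sQH : Q \subset H := normal_sub nsQH.

Lemma ind_trivial_on U (W : representation F U) : Q \subset U -> U \subset H ->
  (forall q, q \in Q -> W q = 1%:M) -> forall q, q \in Q -> ind_grepr H W q = 1%:M.
Proof.
move=> sQU sUH QW q Qq; apply: blkrP => k; rewrite -[LHS]/(blkr (ind_mx H W q) k).
have Qk : (transv k * q * (transv k)^-1)%g \in Q.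
  by rewrite -mulgA -{1}[transv k]invgK -conjgE memJ_norm // groupV (subsetP (normal_norm nsQH)) ?transvG.
have Uk := subsetP sQU _ Qk.
by rewrite -[ind_mx H W q]mul1mx (blkr_ind W _ Uk) QW // mulmx1.
Qed.

(** The module induced from the trivial module of Q is the regular module of H
    / Q. *)
Lemma hom_dim_triv_deg M : (forall q, q \in Q -> M q = 1%:M) ->
  hom_dim H (ind_grepr H (triv F Q)) M = rdegree M.
Proof.
move=> QM; rewrite hom_dim_ind // /hom_dim (_ : homs Q _ _ = fullv).
  by rewrite dimvf /dim /= mul1n.
apply/vspaceP=> f; rewrite memvf; apply/homsP => g Qg /=.
by rewrite mul1mx QM // mulmx1.
Qed.

Section OneModule.
Variables (Y M : representation F H).
Hypothesis sYQ : summand_on H Y (ind_grepr H (triv F Q)).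

Let P U := (Q \subset U) && (U \subset H).
Let c U : int := #|U|%:Z * mobius U H.
Let MU U : representation F H := ind_grepr H (res_grepr U M).

(** The index of Q in H is divisible by p, while the index of Q in the join
    divides the order of x, which is prime to p. *)
Lemma proper_join x : (p^'.-elt x)%g -> x \in H -> (<[x]> <*> Q)%G \proper H.
Proof.
move=> px Hx; rewrite properE join_subG cycle_subG Hx sQH /=.
apply/negP=> sHxQ.
have nQx : <[x]>%g \subset 'N(Q)%g by rewrite cycle_subG (subsetP (normal_norm nsQH)).
have : (p %| #|(<[x]> / Q)%g|)%N.
  apply: dvdn_trans pHQ _; rewrite -card_quotient ?normal_norm //.
  rewrite -(quotientYidr nQx); apply: cardSg; exact: quotientS.
have := dvdn_quotient <[x]>%G Q => dv1 dv2.
have := dvdn_trans dv2 dv1; apply/negP.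
rewrite -prime_coprime ?(pcharf_prime charF) // coprime_sym.
move: px; rewrite /p_elt => px; apply: (p'nat_coprime px).
by rewrite pnat_id ?(pcharf_prime charF).
Qed.

(** The argument of mobius_null_ind, restricted to the subgroups containing Q. *)
Lemma hom_dim_sum_proper (C : {group gT}) (X : representation F C) : Q \subset C -> C \proper H ->
  \sum_(U : {group gT} | P U) c U * (hom_dim C (MU U) X)%:Z = 0.
Proof.
move=> sQC ltCH; have sCH := proper_sub ltCH.
have C0 : #|C|%:Z != 0 :> int by rewrite eqz_nat -lt0n.
apply/eqP; suff : #|C|%:Z * (\sum_(U : {group gT} | P U) c U * (hom_dim C (MU U) X)%:Z) == 0.
  by rewrite mulf_eq0 (negPf C0).
rewrite big_distrr /=.
pose phi g (S : {group gT}) : int := (#|(S :^ g)%g| * hom_dim (S :^ g)%g M X)%N%:Z.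
rewrite (eq_bigr (fun U : {group gT} => \sum_(g in H) mobius U H * phi g (U :&: (C :^ g^-1))%G)) => [|U PU].
  rewrite exchange_big /= big1 // => g Hg; apply: weisner.
    by rewrite /= -(conjGid (groupVr Hg)) properJ.
  have nQg : (Q :^ g^-1 = Q)%g by apply: (normsP (normal_norm nsQH)); rewrite groupV.
  by rewrite /= -nQg conjSg.
rewrite -mulr_sumr; case/andP: PU => sQU sUH.
have -> : \sum_(g in H) phi g (U :&: C :^ g^-1)%G = (#|C| * #|U| * hom_dim C (MU U) X)%N%:Z.
  rewrite mackey_l //; last exact: mx_repr_sub (subxx C) X.
  rewrite (big_morph Posz PoszD (erefl _)); apply: eq_bigr => g Hg.
  by rewrite /phi /= conjIg conjsgKV setIC.
by rewrite /c !PoszM !mulrA; congr (_ * _); rewrite mulrC mulrA.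
Qed.

Lemma hom_dim_sum_pregular x (X : representation F <[x]>%G) : x \in H -> (p^'.-elt x)%g ->
  \sum_(U : {group gT} | P U) c U * (hom_dim <[x]>%g (MU U) X)%:Z = 0.
Proof.
move=> Hx px; have ltCH := proper_join px Hx.
set C := (<[x]> <*> Q)%G in ltCH; have sCH := proper_sub ltCH.
have sxC : <[x]>%g \subset C by apply: joing_subl.
have := @additive_relation _ _ C (fun=> True) int (fun Z => (hom_dim <[x]>%g Z X)%:Z)
  [seq (c U, restrict sCH (MU U)) | U <- enum P].
rewrite big_map big_enum /= => h.
rewrite (eq_bigr (fun U => (hom_dim <[x]>%g (MU U) X)%:Z *~ c U)) => [|U _]; last by rewrite mulrzz mulrC.
apply: h => // [a b d _ _ _|Z]; first exact: hom_dim_additivel.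
rewrite big_map big_enum /= -[RHS](hom_dim_sum_proper Z (joing_subr _ _) ltCH).
by apply: eq_bigr => U _; rewrite mulrzz mulrC.
Qed.

Hypothesis QM : forall q, q \in Q -> M q = 1%:M.

(** For M with trivial action of Q, the alternating sum of the modules MU U
    vanishes on every cyclic p'-subgroup, hence has all composition
    multiplicities zero by balanced0. The dimension of Hom(Y, _) on Q-trivial
    modules is determined by the composition factors, because Y is a summand
    of the free module of rank one over H / Q. *)
Lemma hom_dim_sum_trivial : \sum_(U : {group gT} | P U) c U * (hom_dim U Y M)%:Z = 0.
Proof.
have QMU U : P U -> forall q, q \in Q -> MU U q = 1%:M.
  case/andP=> sQU sUH; apply: ind_trivial_on => // q Qq.
  by rewrite (res_greprE sUH) /= QM.
(* The Hom dimensions from Y and from its complement Z to a Q-trivial module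
   add up to its degree, and each is at most the sum over the composition
   factors. The two sums also add up to the degree, so both inequalities are
   equalities. *)
have facE U : exists s : seq (representation F H), P U -> [/\
    forall S, S \in s -> mx_irreducible S,
    forall x, x \in H -> (p^'.-elt x)%g -> forall X : representation F <[x]>%G,
      hom_dim <[x]>%g (MU U) X = (\sum_(S <- s) hom_dim <[x]>%g S X)%N
    & hom_dim H Y (MU U) = (\sum_(S <- s) hom_dim H Y S)%N].
  have [PU|] := boolP (P U); last by exists [::].
  have [s [s1 s2 s3 s4]] := composition_factors charF sQH (QMU U PU).
  exists s => _; split=> // [S /s1[] //|].
  have [Z [i1 [i2 [p1 [p2 sp]]]]] := summand_split sYQ.
  have degE S : S \in MU U :: s -> (hom_dim H Y S + hom_dim H Z S)%N = rdegree S.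
    move=> sS; rewrite -(hom_dim_splitl sp) hom_dim_triv_deg //.
    by move: sS; rewrite inE => /orP[/eqP->|/s1[]//]; apply: QMU.
  have : (hom_dim H Y (MU U) + hom_dim H Z (MU U) = \sum_(S <- s) (hom_dim H Y S + hom_dim H Z S))%N.
    apply: etrans (degE _ (mem_head _ _)) _; apply: etrans s2 _.
    by apply: eq_big_seq => S sS; rewrite degE // inE sS orbT.
  rewrite big_split /=; have := s3 Y; have := s3 Z.
  set a := hom_dim H Y _; set b := hom_dim H Z _.
  set a' := (\sum_(S <- s) hom_dim H Y S)%N.
  set b' := (\sum_(S <- s) hom_dim H Z S)%N.
  move=> leb lea e; apply/eqP; rewrite eqn_leq lea /= -(leq_add2r b) e leq_add2l //.
pose s U := projT1 (cid (facE U)).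
have sP U : P U -> _ := projT2 (cid (facE U)).
pose t := flatten [seq s U | U <- enum P].
have st U : P U -> {subset s U <= t}.
  by move=> PU S sS; apply/flattenP; exists (s U) => //; apply: map_f; rewrite mem_enum.
have [r [ur rt dr tr]] := iso_reps t.
(* The multiplicity of R in the alternating sum of the modules MU U. *)
pose d R := \sum_(U : {group gT} | P U) c U * (iso_count R (s U))%:Z.
have sum_d (phi : representation F H -> int) : (forall S T : representation F H, iso S T -> phi S = phi T) ->
  \sum_(R <- r) d R * phi R = \sum_(U : {group gT} | P U) c U * \sum_(S <- s U) phi S.
  move=> phi_iso; under eq_bigr do rewrite mulr_suml.
  rewrite exchange_big /=; apply: eq_bigr => U PU.
  rewrite (sum_reps ur dr tr (st U PU) phi_iso) mulr_sumr.
  by apply: eq_bigr => R _; rewrite mulrA.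
have bal : balanced p r d.
  move=> x Hx px X; rewrite sum_d; last first.
    by move=> S T isoST; congr (Posz _); apply: hom_dim_isol isoST; rewrite cycle_subG.
  rewrite -[RHS](hom_dim_sum_pregular X Hx px); apply: eq_bigr => U PU; congr (_ * _).
  have [_ -> //] := sP U PU.
  by rewrite (big_morph Posz PoszD (erefl _)).
have irr_r R : R \in r -> mx_irreducible R.
  move=> rR; have /flattenP[x /mapP[U]] := rt R rR; rewrite mem_enum => PU -> sR.
  by have [h _ _] := sP U PU; apply: h.
have d0 := balanced0 charF ur irr_r dr bal.
transitivity (\sum_(U : {group gT} | P U) c U * \sum_(S <- s U) (hom_dim H Y S)%:Z).
  apply: eq_bigr => U PU; congr (_ * _); have [_ _ e] := sP U PU.
  case/andP: (PU) => sQU sUH; rewrite -(hom_dim_ires M sUH (mx_repr_sub (subxx H) Y)).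
  by rewrite -/(MU U) e (big_morph Posz PoszD (erefl _)).
rewrite -sum_d; last by move=> S T isoST; congr (Posz _); apply: hom_dim_isor.
by rewrite big_seq big1 // => R rR; rewrite d0 ?mul0r.
Qed.

End OneModule.

(** Q acts trivially on Y, so the sum over the subgroups containing Q in
    hom_dim_sum_trivial vanishes for arbitrary M, which can be replaced by its
    Q-fixed points. As a relation between the modules induced from the
    subgroups U containing Q, it expresses #|H| times Y through modules
    induced from proper subgroups, and those are null. *)
Lemma mobius_null_normal Y : summand_on H Y (ind_grepr H (triv F Q)) -> mobius_null Y.
Proof.
move=> sYQ.
have QY : forall q, q \in Q -> Y q = 1%:M.
  apply: summand_trivial sQH _ sYQ.
  by apply: ind_trivial_on => // q _ /=.
have sum0 M : \sum_(U : {group gT} | (Q \subset U) && (U \subset H)) (#|U|%:Z * mobius U H) * (hom_dim U Y M)%:Z = 0.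
  (* K is the submodule of Q-fixed points, where the image of any
     homomorphism from Y lies. *)
  have [K [C [i1 [p2 [j1 [j2 [[h1 h2 e12 e11 [e22 e]] dK dC eqU]]]]]]] :=
    submod_ses (normal_rfix_mx_module M nsQH).
  have QK q : q \in Q -> K q = 1%:M.
    move=> Qq; rewrite -[LHS]mulmx1 -e11 mulmxA h1 ?(subsetP sQH) //.
    have /rfix_mxP-> // : (i1 <= rfix_mx M Q)%MS by rewrite eqU.
  rewrite -[RHS](hom_dim_sum_trivial sYQ QK); apply: eq_bigr => U /andP[sQU sUH].
  congr (_ * (Posz _)); apply/eqP; rewrite eqn_leq; apply/andP; split.
    have fE f : hom_on U Y M f -> f *m j1 *m i1 = f.
      move=> hf; have /submxP[D ->] : (f <= i1)%MS.
        rewrite eqU; apply/rfix_mxP => q Qq.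
        by rewrite -hf ?(subsetP sQU) // QY // mul1mx.
      by rewrite -(mulmxA D) e11 mulmx1.
    apply: (hom_dim_le (phi := fun f => f *m j1)).
    - by move=> a f h; rewrite mulmxDl -scalemxAl.
    - move=> f hf g Ug; rewrite -[LHS]mulmx1 -[RHS]mulmx1 -e11 [LHS]mulmxA [RHS]mulmxA; congr (_ *m _).
      by rewrite -[LHS]mulmxA fE // -[RHS]mulmxA h1 ?(subsetP sUH) // mulmxA fE // hf.
    by move=> f hf f0; rewrite -(fE f hf) f0 mul0mx.
  apply: (hom_dim_le (phi := fun f => f *m i1)).
  - by move=> a f h; rewrite mulmxDl -scalemxAl.
  - by move=> f hf; apply: hom_on_comp hf (hom_onS sUH h1).
  by move=> f _ f0; rewrite -[f]mulmx1 -e11 mulmxA f0 mul0mx.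
move=> M; pose N (Z : representation F H) : int :=
  \sum_(U : {group gT} | U \subset H) (#|U|%:Z * mobius U H) * (hom_dim U Z M)%:Z.
have Nadd : additive_rep N.
  move=> X Z X' isoZ; rewrite /N -big_split /=; apply: eq_bigr => U sUH.
  by rewrite (hom_dim_additivel M sUH isoZ) mulrDr.
have := @additive_relation _ _ H (fun=> True) int N
  [seq (#|U|%:Z * mobius U H, ind_grepr H (res_grepr U Y))
     | U <- enum (fun U : {group gT} => (Q \subset U) && (U \subset H))].
rewrite big_map big_enum /= => h.
have {h} : \sum_(U : {group gT} | (Q \subset U) && (U \subset H))
    N (ind_grepr H (res_grepr U Y)) *~ (#|U|%:Z * mobius U H) = 0.
  apply: h => // [a b d _ _ _|X]; first exact: Nadd.
  rewrite big_map big_enum /= -[RHS](sum0 X); apply: eq_bigr => U /andP[_ sUH].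
  by rewrite hom_dim_ind // hom_dim_resl // mulrzz mulrC.
rewrite (bigD1 H) /=; last by rewrite sQH subxx.
rewrite [X in _ + X]big1 ?addr0 => [|U /andP[/andP[_ sUH] neq]]; last first.
  have ltUH : U \proper H by rewrite properEneq sUH andbT; apply: contra neq => /eqP e; apply/eqP/val_inj.
  have := mobius_null_ind (res_grepr U Y) ltUH M; rewrite -/(N _) => ->.
  by rewrite mul0rz.
rewrite mobius_refl mulr1 mulrzz => /eqP; rewrite mulf_eq0 orbC eqz_nat -leqn0 leqNgt cardG_gt0 /= => /eqP N0.
rewrite -[RHS]N0 -[LHS]/(N Y).
apply: (@additive_rep_iso _ _ _ (fun=> True) _ N) => // [a b d _ _ _|]; first exact: Nadd.
by apply: iso_sym; apply: iso_of_hom_dim => X; rewrite hom_dim_ind // hom_dim_resl.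
Qed.

End NormalVertex.

(** * Counting trivial summands over a p-subgroup *)

Section Relative.
Variables (F : fieldType) (gT : finGroupType).
Implicit Types G H L U Q C N S : {group gT}.

Lemma summand_isor H n (a : gT -> 'M[F]_n) (X Y : representation F H) : iso X Y ->
  summand_on H a X -> summand_on H a Y.
Proof. by move=> /iso_summand isoXY sa; apply: summand_trans isoXY. Qed.

Lemma ind_iso H L (X Y : representation F L) : iso X Y ->
  iso (ind_grepr H X) (ind_grepr H Y).
Proof.
move=> isoXY; have h := iso_trans (iso_sym isoXY) (iso_add0 X).
have := iso_trans (ind_grepr_dadd H h) (iso_sym (ind_grepr_dadd H (iso_add0 X))).
exact: iso_sym.
Qed.

Lemma indec_triv L : indecomposable (triv F L).
Proof.
split=> // Y Z /iso_deg /=; case: (rdegree Y) => [|n]; first by left.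
by rewrite addSn => -[] /esym/eqP; rewrite addn_eq0 => /andP[_ /eqP]; right.
Qed.

(** The indecomposable module Y goes with one term of the direct sum. *)
Lemma summand_ind_dsum H L (Y : representation F H) (s : seq (representation F L)) :
  indecomposable Y -> summand_on H Y (ind_grepr H (dsum s)) ->
  exists2 Z : representation F L, Z \in s & summand_on H Y (ind_grepr H Z).
Proof.
move=> indY; elim: s => [|Z s IHs] /= sY.
  by have := summand_deg sY; rewrite sum_nat_const muln0 leqNgt; case: indY => ->.
have [i1 [i2 [p1 [p2 sp]]]] := (split_iso _ _ _).1 (ind_grepr_dadd H (iso_refl (dadd_grepr Z (dsum s)))).
have [sYZ|/IHs[Z' sZ' sYZ']] := summand_indec_split sp indY sY.
  by exists Z; rewrite ?mem_head.
by exists Z'; rewrite // inE sZ' orbT.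
Qed.

Lemma summand_res_dsum H N (M : representation F N) (s : seq (representation F H)) : N \subset H ->
  indecomposable M -> summand_on N M (dsum s) ->
  exists2 Y : representation F H, Y \in s & summand_on N M Y.
Proof.
move=> sNH indM; elim: s => [|Z s IHs] /= sM.
  by have := summand_deg sM; rewrite leqNgt; case: indM => ->.
have [i1 [i2 [p1 [p2 sp]]]] := (split_iso _ _ _).1 (iso_refl (dadd_grepr Z (dsum s))).
have [sMZ|/IHs[Z' sZ' sMZ']] := summand_indec_split (split_byS sNH sp) indM sM.
  by exists Z; rewrite ?mem_head.
by exists Z'; rewrite // inE sZ' orbT.
Qed.

Lemma relative_indec H L (Y : representation F H) (X : representation F L) :
  indecomposable Y -> summand_on H Y (ind_grepr H X) ->
  exists Z : representation F L, [/\ indecomposable Z, summand_on L Z X & summand_on H Y (ind_grepr H Z)].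
Proof.
move=> indY sY; have [s inds isoX] := indec_decomposition X.
have [Z sZ sYZ] := summand_ind_dsum indY (summand_isor (ind_iso H isoX) sY).
exists Z; split=> //; first exact: inds.
exact: summand_isor (iso_sym isoX) (dsum_summand sZ).
Qed.

(** By perm_additive, mult Z is positive on one of the transitive permutation
    modules. *)
Lemma perm_summand L (Z X : representation F L) : indecomposable Z ->
  permutation_module X -> summand_on L Z X ->
  exists2 S : {group gT}, S \subset L & summand_on L Z (ind_grepr L (triv F S)).
Proof.
move=> indZ permX sZX.
have [s [sL e]] := perm_additive (mult_additive indZ) permX.
case: (pselect (exists2 S, S \in s & 0 < mult Z (ind_grepr L (triv F S)))) => [[S sS m0]|no].
  by exists S; [apply: sL | apply: mult_gt0_summand].
have := mult_summand_gt0 indZ sZX; rewrite -(pmulrn_lgt0 _ (cardG_gt0 L)) e big_seq.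
rewrite big1 ?ltxx // => S sS; have := mult_ge0 (ind_grepr L (triv F S)) indZ.
rewrite le_eqVlt => /orP[/eqP<-|m0]; first by rewrite mul0rn.
by case: no; exists S.
Qed.

Lemma mult_summand_le L (Z X Y : representation F L) : indecomposable Z ->
  summand_on L X Y -> mult Z X <= mult Z Y.
Proof.
move=> indZ /summand_split[X' [i1 [i2 [p1 [p2 sp]]]]].
have isoY : iso Y (dadd_grepr X X') by apply/split_iso; exists i1, i2, p1, p2.
by rewrite (mult_additive indZ isoY) lerDl mult_ge0.
Qed.

(** Otherwise 1 would be a relative trace from S to Q of an endomorphism of
    the trivial module, that is, a multiple of the index. *)
Lemma summand_triv_ind p Q S : p \in [pchar F] -> (p %| #|Q : S|%g)%N -> S \subset Q ->
  ~ summand_on Q (triv F Q) (ind_grepr Q (triv F S)).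
Proof.
move=> charF dvd sSQ /(relative_trace sSQ)[theta _].
rewrite (eq_bigr (fun=> theta)) => [|j _]; last by rewrite /= mul1mx mulmx1.
rewrite sumr_const card_ord -scaler_nat; move: dvd; rewrite (dvdn_pcharf charF) => /eqP->.
by rewrite scale0r => /matrixP/(_ 0 0); rewrite !mxE => /eqP; rewrite eq_sym oner_eq0.
Qed.

Lemma ind_id L (W : representation F L) : iso (ind_grepr L W) W.
Proof. by apply: iso_of_hom_dim => M; rewrite hom_dim_ind. Qed.

Lemma res_triv H L : L \subset H -> iso (res_grepr L (triv F H)) (triv F L).
Proof. by move=> sLH; apply: iso_of_hom_dim => M; rewrite hom_dim_resl. Qed.

End Relative.

Section Multiplicity.
Variables (F : fieldType) (p : nat) (charF : p \in [pchar F]) (gT : finGroupType).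
Variables (H Q : {group gT}).
Hypotheses (sQH : Q \subset H) (pQ : (p.-group Q)%g).
Let N := ('N_H(Q)%g)%G.

Definition triv_mult (W : representation F H) : int := mult (triv F Q) (res_grepr Q W).
Let m0 := mult (triv F Q) (triv F Q).

Lemma triv_mult_additive : additive_rep triv_mult.
Proof.
move=> X Y X' /(res_grepr_dadd Q) isoY.
exact: (mult_additive (indec_triv F Q) isoY).
Qed.

Lemma pgroup_index_dvd (S : {group gT}) : S \proper Q -> (p %| #|Q : S|%g)%N.
Proof.
move=> ltSQ; have sSQ := proper_sub ltSQ.
have pi : p.-nat #|Q : S|%g by rewrite (pnat_dvd (dvdn_indexg Q S)).
have i1 : (1 < #|Q : S|%g)%N by rewrite indexg_gt1 proper_subn.
case/p_natP: pi i1 => [[|k] ->]; first by rewrite expn0.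
by rewrite expnS dvdn_mulr.
Qed.

Lemma mult_triv_ind (S : {group gT}) : S \subset Q ->
  mult (triv F Q) (ind_grepr Q (triv F S)) = if S == Q then m0 else 0.
Proof.
move=> sSQ; have indQ := indec_triv F Q; have [->|neq] := eqVneq.
  exact: mult_iso (ind_id _).
have ltSQ : S \proper Q by rewrite properEneq sSQ andbT.
have := mult_ge0 (ind_grepr Q (triv F S)) indQ.
rewrite le_eqVlt => /orP[/eqP<- //|/(mult_gt0_summand indQ)].
by move/(summand_triv_ind charF (pgroup_index_dvd ltSQ) sSQ).
Qed.

(** The Mackey formula for the p-group Q: the intersection of Q and Q^g
    contributes a trivial summand only when it is all of Q, that is, when g
    normalises Q. *)
Lemma triv_mult_ind_triv : triv_mult (ind_grepr H (triv F Q)) *+ #|Q| = m0 *+ #|N|.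
Proof.
have indQ := indec_triv F Q.
pose D g := (Q :&: Q :^ g)%G.
have := @additive_relation _ _ Q (fun=> True) int (mult (triv F Q))
  (((#|Q| * #|Q|)%N%:Z, res_grepr Q (ind_grepr H (triv F Q))) ::
   [seq (- #|D g|%:Z, ind_grepr Q (triv F (D g))) | g <- enum H]).
rewrite big_cons big_map big_enum /= => h.
have {h} : mult (triv F Q) (res_grepr Q (ind_grepr H (triv F Q))) *~ (#|Q| * #|Q|)%N%:Z
  + \sum_(g in H) mult (triv F Q) (ind_grepr Q (triv F (D g))) *~ (- #|D g|%:Z) = 0.
  apply: h => // [X Y X' _ _ _|M]; first exact: mult_additive.
  rewrite big_cons big_map big_enum /= hom_dim_resl //.
  rewrite -(hom_dim_isol _ sQH (ind_iso H (res_triv F sQH))).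
  rewrite mulrzz -PoszM mulnC mackey_l //; last exact: mx_repr_sub (subxx Q) M.
  rewrite (big_morph Posz PoszD (erefl _)) -big_split /= big1 // => g Hg.
  rewrite mulrNz mulrzz -PoszM mulnC. 
  by rewrite (@hom_dim_ind _ _ Q (D g) (subsetIl _ _) (triv F (D g)) M) subrr.
rewrite -/(triv_mult _) (bigID (mem N)) /= [X in _ + (_ + X)]big1 => [|g /andP[Hg nNg]]; last first.
  rewrite mult_triv_ind ?subsetIl //; case: eqP => [eD|]; last by rewrite mul0rz.
  case/negP: nNg; rewrite inE Hg; apply/normP/eqP; rewrite eq_sym eqEcard cardJg leqnn andbT.
  have eQ : (Q :&: Q :^ g)%g = Q :> {set gT} by exact: (congr1 (@gval gT) eD).
  by move: (subsetIr Q (Q :^ g)%g); rewrite eQ.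
rewrite (eq_bigr (fun=> - (m0 *+ #|Q|))) => [|g /andP[Hg Ng]]; last first.
  have eD : D g = Q by apply: val_inj; rewrite /= (normP (subsetP (subsetIr _ _) _ Ng)) setIid.
  rewrite eD mult_triv_ind ?subxx // eqxx mulrNz -pmulrn. 
  by rewrite (congr1 (fun A : {group gT} => #|A|) eD : #|(Q :&: Q :^ g)%g| = #|Q|).
rewrite addr0 sumr_const -?pmulrn mulrnA => /eqP; rewrite addr_eq0 mulNrn opprK.
have -> : #|[pred g in H | g \in N]| = #|N|.
  by apply: eq_card => g; rewrite !inE andbA andbb.
by rewrite mulrnAC eqrMn2r ?gtn_eqF // => /eqP.
Qed.

End Multiplicity.

Section Trivial.
Variables (F : fieldType) (gT : finGroupType).
Implicit Types H L N Q : {group gT}.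

Lemma trivial_iso Q (X Y : representation F Q) : rdegree X = rdegree Y ->
  (forall q, q \in Q -> X q = 1%:M) -> (forall q, q \in Q -> Y q = 1%:M) -> iso X Y.
Proof.
move=> dXY X1 Y1; exists (pid_mx (rdegree X)) => //.
  by rewrite /row_free rank_pid_mx // dXY.
by move=> q Qq; rewrite X1 // Y1 // mul1mx mulmx1.
Qed.

Lemma dsum_triv Q n : let D := dsum (nseq n (triv F Q)) in
  rdegree D = n /\ forall q, q \in Q -> D q = 1%:M.
Proof.
elim: n => [|n [d t]] /=; first by split=> // q _; apply/matrixP=> -[].
split=> [|q Qq]; first by rewrite d.
by rewrite t // -scalar_mx_block.
Qed.

Lemma mult_trivial Q (X : representation F Q) : (forall q, q \in Q -> X q = 1%:M) ->
  mult (triv F Q) X = mult (triv F Q) (triv F Q) *+ rdegree X.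
Proof.
move=> X1; have [d D1] := dsum_triv Q (rdegree X).
rewrite (mult_iso (indec_triv F Q) (trivial_iso (esym d) X1 D1)).
rewrite mult_dsum; last exact: indec_triv.
by rewrite big_nseq iter_addr addr0.
Qed.

Lemma summand_res H N Q (M : representation F N) (Y : representation F H) :
  Q \subset N -> Q \subset H -> summand_on Q M Y -> summand_on Q (res_grepr Q M) (res_grepr Q Y).
Proof.
move=> sQN sQH sMY; apply: (summand_resl Q M (res_grepr Q Y) sQN).1.
exact: (summand_resr Q Y M sQH).1.
Qed.

Lemma triv_mult_ge H N Q (M : representation F N) (Y : representation F H) :
  Q \subset N -> N \subset H -> (forall q, q \in Q -> M q = 1%:M) -> summand_on N M Y ->
  mult (triv F Q) (triv F Q) *+ rdegree M <= triv_mult Q Y.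
Proof.
move=> sQN sNH M1 sMY; have sQH := subset_trans sQN sNH.
have M1' q : q \in Q -> res_grepr Q M q = 1%:M.
  by rewrite (res_greprE sQN) => Qq; exact: M1.
have -> : rdegree M = rdegree (res_grepr Q M) by rewrite (res_greprE sQN).
rewrite -(mult_trivial M1'); apply: mult_summand_le; first exact: indec_triv.
by apply: summand_res => //; apply: summandS sQN sMY.
Qed.

End Trivial.

(** * Modules with a non-normal vertex *)

Section NullVertex.
Variables (F : closedFieldType) (p : nat) (charF : p \in [pchar F]) (gT : finGroupType).
Variable H : {group gT}.
Implicit Types L N Q S : {group gT}.

(** V is a summand of a module induced from an indecomposable summand Z of its
    restriction to Q, and Z is a summand of a transitive permutation module
    with stabiliser S. If S = Q then Z is trivial, against the vanishing of
    triv_mult. *)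
Lemma smaller_vertex Q (V : representation F H) : Q \subset H -> (p.-group Q)%g ->
  indecomposable V -> summand_on H V (ind_grepr H (triv F Q)) -> triv_mult Q V = 0 ->
  exists2 S : {group gT}, S \proper Q & summand_on H V (ind_grepr H (triv F S)).
Proof.
move=> sQH pQ indV sV bV0.
have [Z [indZ sZV sVZ]] := relative_indec indV (relative_summand sQH sV).
have permP : permutation_module (res_grepr Q (ind_grepr H (triv F Q))).
  by apply/res_grepr_perm/ind_grepr_perm/perm_triv.
have sZP : summand_on Q Z (res_grepr Q (ind_grepr H (triv F Q))).
  apply: summand_trans sZV _; apply: summand_res => //.
  exact: summandS sQH sV.
have [S sSQ sZS] := perm_summand indZ permP sZP.
have [eS|neq] := eqVneq S Q.
  have isoZ : iso Z (triv F Q).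
    apply: summand_indec_iso (indec_triv F Q) _ _; first by case: indZ.
    by move: sZS; rewrite eS; apply: summand_isor; apply: ind_id.
  have sTV : summand_on Q (triv F Q) (res_grepr Q V).
    exact: summand_trans (iso_summand (iso_sym isoZ)) sZV.
  by have := mult_summand_gt0 (indec_triv F Q) sTV; rewrite -/(triv_mult Q V) bV0 ltxx.
exists S; first by rewrite properEneq sSQ andbT.
apply: summand_trans sVZ _.
have := summand_ind H sZS; apply: summand_isor; exact: ind_trans.
Qed.

(** By induction on the order of Q. If Q is normal, this is
    mobius_null_normal. Otherwise Q has a proper normaliser N, and the
    argument imitates the Green correspondence: Y is a summand of the module
    induced from a summand M of the module induced to N from the trivial one
    of Q. Counting trivial summands over Q, the induced module is the sum of
    one module Y0 that takes up all of them and of a module V with smaller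
    vertices. Then V is null by induction, the module induced from M is null
    because N is proper, and so Y0 is null; and Y is Y0 or a summand of V. The
    hypothesis on the index is preserved: it holds for every proper subgroup
    of the p-group Q. *)
Lemma mobius_null_vertex Q (Y : representation F H) : Q \subset H -> (p.-group Q)%g ->
  ((Q <| H)%g -> (p %| #|H : Q|%g)%N) ->
  indecomposable Y -> summand_on H Y (ind_grepr H (triv F Q)) -> mobius_null Y.
Proof.
have [n] := ubnP #|Q|; elim: n Q Y => // n IHn Q Y; rewrite ltnS => leQ sQH pQ pHQ indY sY.
have [nQH|nnQH] := boolP (Q <| H)%g; first exact: (mobius_null_normal charF nQH (pHQ nQH) sY).
(* Without trivial summands over Q, V arises in the same way from a smaller
   p-group. *)
have mobius_null_small (V : representation F H) : indecomposable V -> summand_on H V (ind_grepr H (triv F Q)) ->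
    triv_mult Q V = 0 -> mobius_null V.
  move=> indV sV /(smaller_vertex sQH pQ indV sV)[S ltSQ sVS].
  have sSQ := proper_sub ltSQ.
  apply: (IHn S) => //; first exact: leq_trans (proper_card ltSQ) leQ.
  - exact: subset_trans sSQ sQH.
  - exact: pgroupS pQ.
  by move=> _; rewrite -(Lagrange_index sQH sSQ) dvdn_mull // pgroup_index_dvd.
pose N := 'N_H(Q)%G; pose m0 := mult (triv F Q) (triv F Q).
have sNH : N \subset H := subsetIl _ _.
have nsQN : (Q <| N)%g by apply: normalSG.
have sQN := normal_sub nsQN.
have ltNH : N \proper H.
  rewrite properEneq sNH andbT; apply: contra nnQH => /eqP eNH.
  by rewrite -eNH.
pose W := ind_grepr N (triv F Q).
have W1 q : q \in Q -> W q = 1%:M by apply: ind_trivial_on => // r _ /=.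
have isoHW : iso (ind_grepr H W) (ind_grepr H (triv F Q)) by apply: ind_trans.
have [M [indM sMW sYM]] := relative_indec indY (summand_isor (iso_sym isoHW) sY).
have [W' [i1 [i2 [p1 [p2 spW]]]]] := summand_split sMW.
have isoW : iso W (dadd_grepr M W') by apply/split_iso; exists i1, i2, p1, p2.
have M1 := summand_trivial sQN W1 sMW; have W'1 := summand_trivial sQN W1 (iso_summandr isoW).
(* The lower bounds of triv_mult for M and for its complement W' add up to the
   exact value for W, so both are attained. *)
have bM : triv_mult Q (ind_grepr H M) <= m0 *+ rdegree M.
  have e : triv_mult Q (ind_grepr H W) = m0 *+ rdegree W.
    have := triv_mult_ind_triv charF sQH pQ.
    rewrite -(additive_rep_iso (P := fun=> True) (psi := triv_mult Q) _ _ _ _ isoHW) //; last first.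
      by move=> X Y' X' _ _ _; apply: triv_mult_additive.
    have -> : #|'N_H(Q)%g| = (rdegree W * #|Q|)%N.
      by rewrite /= sum_nat_const card_ord muln1 mulnC Lagrange.
    by rewrite mulrnA => /eqP; rewrite eqrMn2r ?gtn_eqF // => /eqP.
  have := triv_mult_additive Q (ind_grepr_dadd H isoW); rewrite e (iso_deg isoW) mulrnDr => e2.
  rewrite -(lerD2r (m0 *+ rdegree W')) e2 lerD2l.
  exact: triv_mult_ge sQN sNH W'1 (summand_res_ind W' sNH).
have [s inds isoMs] := indec_decomposition (ind_grepr H M).
(* Y0 restricts to N with M as a summand, so it already has all the trivial
   summands over Q. *)
have [Y0 sY0 sMY0] : exists2 Y0 : representation F H, Y0 \in s & summand_on N M Y0.
  apply: summand_res_dsum => //; apply: summand_trans (summand_res_ind M sNH) _.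
  exact: summandS sNH (iso_summand isoMs).
have indY0 := inds _ sY0.
have sY0M : summand_on H Y0 (ind_grepr H M) := summand_isor (iso_sym isoMs) (dsum_summand sY0).
have [V [j1 [j2 [q1 [q2 spV]]]]] := summand_split sY0M.
have isoV : iso (ind_grepr H M) (dadd_grepr Y0 V) by apply/split_iso; exists j1, j2, q1, q2.
have bV : triv_mult Q V <= 0.
  have bY0 := triv_mult_ge sQN sNH M1 sMY0.
  have := triv_mult_additive Q isoV => e; move: bM; rewrite e => le.
  by rewrite -(lerD2l (triv_mult Q Y0)) addr0 (le_trans le).
have sMQ : summand_on H (ind_grepr H M) (ind_grepr H (triv F Q)).
  exact: summand_isor isoHW (summand_ind H sMW).
have mobius_null_sub (X : representation F H) : indecomposable X -> summand_on H X V -> mobius_null X.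
  move=> indX sX; apply: mobius_null_small => //.
    exact: summand_trans sX (summand_trans (iso_summandr isoV) sMQ).
  apply/eqP; rewrite eq_le mult_ge0 ?andbT; last exact: indec_triv.
  apply: le_trans bV; apply: mult_summand_le; first exact: indec_triv.
  by apply: summand_res => //; apply: summandS sQH sX.
have nullV : mobius_null V.
  have [t indt isoVt] := indec_decomposition V.
  apply: mobius_null_iso (iso_sym isoVt) _; apply: mobius_null_dsum => X tX.
  by apply: mobius_null_sub; [apply: indt | apply: summand_isor (iso_sym isoVt) (dsum_summand tX)].
have [sYY0|sYV] := summand_indec_split spV indY sYM; last exact: mobius_null_sub.
have isoY : iso Y Y0 by apply: summand_indec_iso sYY0 => //; case: indY.
apply: mobius_null_iso (iso_sym isoY) _.
exact: (mobius_null_split isoV nullV).2 (mobius_null_ind M ltNH).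
Qed.

(** Y is a summand of the module induced from its restriction to a Sylow
    subgroup P, whose index is prime to p and where all stabilisers of a
    permutation basis are p-groups. *)
Lemma pperm_vertex (Y : representation F H) : indecomposable Y -> p_permutation Y ->
  exists S : {group gT}, [/\ S \subset H, (p.-group S)%g & summand_on H Y (ind_grepr H (triv F S))].
Proof.
move=> indY [X permX /summandP sYX]; have p_pr : prime p := pcharf_prime charF.
have [P sylP] := Sylow_exists p H; have sPH := pHall_sub sylP.
have n0 : (#|H : P|%g)%:R != 0 :> F.
  rewrite -(dvdn_pcharf charF); case/and3P: sylP => _ _.
  by rewrite p'natE.
have [Z [indZ sZY sYZ]] := relative_indec indY (summand_index Y sPH n0).
have sZX : summand_on P Z (res_grepr P X).
  apply: summand_trans sZY _; apply: summand_res => //.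
  exact: summandS sPH sYX.
have [S sSP sZS] := perm_summand indZ (res_grepr_perm P permX) sZX.
exists S; split; first exact: subset_trans sPH.
  exact: pgroupS sSP (pHall_pgroup sylP).
apply: summand_trans sYZ _; apply: summand_isor (summand_ind H sZS); exact: ind_trans.
Qed.

End NullVertex.

(** * Projective and exprojective modules *)

Section Regular.
Variables (F : fieldType) (gT : finGroupType) (G : {group gT}).

Definition regular : representation F G := Representation (regular_repr F G).

(** A homomorphism from the regular module is determined by the image of the
    basis vector 1, which is arbitrary. *)
Lemma hom_dim_regular (M : representation F G) : hom_dim G regular M = rdegree M.
Proof.
pose g1 := gring_index G 1%g.
have rowf (f : 'M[F]_(rdegree regular, rdegree M)) : hom_on G regular M f ->
    forall i, row i f = row g1 f *m M (enum_val i).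
  move=> hf i; rewrite -row_mul -hf ?enum_valP // row_mul rowK -rowE /g1.
  by rewrite gring_indexK // mul1g gring_valK.
have dimV : \dim (fullv : {vspace 'rV[F]_(rdegree M)}) = rdegree M.
  by rewrite dimvf /dim /= mul1n.
apply/eqP; rewrite -[X in _ == X]dimV eqn_leq; apply/andP; split.
  apply: (@dimv_inj _ _ _ _ _ (row g1)) => [a f h|f _|f /homsP hf f0].
  - exact: linearP.
  - exact: memvf.
  by apply/row_matrixP=> i; rewrite rowf // f0 mul0mx row0.
apply: (@dimv_inj _ _ _ _ _ (fun v => \matrix_i (v *m M (enum_val i)) : 'M[F]_(rdegree regular, rdegree M))).
- by move=> a u v; apply/row_matrixP=> i; rewrite rowK mulmxDl -scalemxAl linearP /= !rowK.
- move=> v _; apply/homsP=> g Gg; apply/row_matrixP=> i.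
  rewrite !row_mul !rowK -rowE rowK gring_indexK ?groupM ?enum_valP //.
  by rewrite repr_mxM ?enum_valP // mulmxA.
move=> v _ /row_matrixP/(_ g1); rewrite rowK row0 /g1 gring_indexK // repr_mx1.
by rewrite mulmx1.
Qed.

Lemma projective_summand (P : representation F G) : summand_on G P regular -> projective P.
Proof.
move=> sP; exists 1%N; apply/summandP; rewrite /muln_grepr big_ord_recl big_ord0.
by apply: summand_isor sP; apply: iso_add0.
Qed.

End Regular.

Section Exprojective.
Variables (F : closedFieldType) (gT : finGroupType) (H Q : {group gT}).
Hypothesis nsQH : (Q <| H)%g.

(** The module induced from the trivial module of Q is inflated from the
    regular module of H / Q, so Y is inflated from a summand of the latter. *)
Lemma normal_exprojective (Y : representation F H) :
  summand_on H Y (ind_grepr H (triv F Q)) -> indec_exprojective Y.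
Proof.
set W := ind_grepr H (triv F Q) => sYW; have [i [p [hi hp ip]]] := sYW; have sQH := normal_sub nsQH.
have W1 q : q \in Q -> W q = 1%:M by apply: ind_trivial_on => // r _ /=.
have Y1 := summand_trivial sQH W1 sYW.
have kr (V : representation F H) : (forall q, q \in Q -> V q = 1%:M) -> Q \subset rker V.
  by move=> V1; apply/subsetP=> q Qq; apply/rkerP; rewrite V1 // (subsetP sQH).
pose nQH := normal_norm nsQH.
pose P : representation F (H / Q)%G := Representation (quo_repr (kr Y Y1) nQH).
pose PW : representation F (H / Q)%G := Representation (quo_repr (kr W W1) nQH).
have PE x : x \in H -> P (coset Q x) = Y x by move=> Hx; apply: quo_mx_coset.
have PWE x : x \in H -> PW (coset Q x) = W x by move=> Hx; apply: quo_mx_coset.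
exists Q, nsQH, P; split; last first.
  exists 1%:M => //; first by rewrite row_free_unit unitmx1.
  by move=> g Hg; rewrite mulmx1 mul1mx /= /morphim_mx quo_mx_coset.
apply: projective_summand.
have : summand_on (H / Q)%G P PW.
  exists i, p; split=> // Hx /morphimP[x Nx Hx' ->].
    by rewrite PE // PWE // hi.
  by rewrite PE // PWE // hp.
apply: summand_isor; apply: iso_of_hom_dim => M; rewrite hom_dim_regular.
pose M' := inflation nsQH M.
have M1 q : q \in Q -> M' q = 1%:M.
  by move=> Qq; rewrite -[LHS]/(M (coset Q q)) coset_id // repr_mx1.
apply: etrans (hom_dim_triv_deg nsQH M1); congr (\dim _); apply/vspaceP => f.
apply/idP/idP => /homsP hf; apply/homsP.
  move=> g Hg; have := hf (coset Q g) (mem_quotient _ Hg).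
  by rewrite PWE.
by move=> Hx /morphimP[x Nx Hx' ->]; rewrite PWE //; apply: hf.
Qed.

End Exprojective.

Section Key.
Variables (F : closedFieldType) (p : nat) (charF : p \in [pchar F]) (gT : finGroupType).
Variable H : {group gT}.

(** If Y is not exprojective then Q is not normal, by normal_exprojective. *)
Lemma mobius_null_nonexprojective (Y : representation F H) :
  indecomposable Y -> p_permutation Y -> ~ indec_exprojective Y -> mobius_null Y.
Proof.
move=> indY permY nex; have [Q [sQH pQ sY]] := pperm_vertex charF indY permY.
apply: (mobius_null_vertex charF sQH pQ _ indY sY) => nsQH.
by case: nex; apply: normal_exprojective sY.
Qed.

End Key.

(** * The Grothendieck group and its projection *)

Section Classes.
Variables (F : fieldType) (gT : finGroupType) (G : {group gT}).
Implicit Types X Y Z : representation F G.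

Lemma perm_grepr0 : permutation_module (@grepr0 F gT G).
Proof. by exists 1%:M => [|g _ []]; rewrite ?unitmx1. Qed.

Lemma perm_dadd X Y : permutation_module X -> permutation_module Y ->
  permutation_module (dadd_grepr X Y).
Proof.
case=> B uB hB [C uC hC]; exists (block_mx B 0 0 C).
  by rewrite unitmxE det_ublock unitrM -!unitmxE uB.
have mulE g : block_mx B 0 0 C *m dadd_grepr X Y g = block_mx (B *m X g) 0 0 (C *m Y g).
  by rewrite /= mulmx_block !mulmx0 !mul0mx !addr0 !add0r.
move=> g Gg i; case: (split_ordP i) => k ->; rewrite -row_mul mulE.
  have [j e] := hB g Gg k; exists (lshift _ j).
  by rewrite !block_mxEv !rowKu !row_row_mx row_mul e !row0.
have [j e] := hC g Gg k; exists (rshift _ j).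
by rewrite !block_mxEv !rowKd !row_row_mx row_mul e !row0.
Qed.

Lemma pperm_grepr0 : p_permutation (@grepr0 F gT G).
Proof. by exists grepr0; [apply: perm_grepr0 | apply/summandP/iso_summand/iso_refl]. Qed.

Lemma pperm_summand X Y : summand_on G X Y -> p_permutation Y -> p_permutation X.
Proof. by move=> sXY [P pP /summandP sYP]; exists P => //; apply/summandP; apply: summand_trans sYP. Qed.

Lemma pperm_dadd X Y : p_permutation X -> p_permutation Y -> p_permutation (dadd_grepr X Y).
Proof.
case=> [P pP /summandP/summand_split[P' [i1 [i2 [p1 [p2 sp]]]]]].
case=> [Q pQ /summandP/summand_split[Q' [j1 [j2 [q1 [q2 sq]]]]]].
exists (dadd_grepr P Q); first exact: perm_dadd.
have isoP : iso P (dadd_grepr X P') by apply/split_iso; exists i1, i2, p1, p2.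
have isoQ : iso Q (dadd_grepr Y Q') by apply/split_iso; exists j1, j2, q1, q2.
exists (dadd_grepr P' Q').
apply: iso_trans (iso_dadd isoP isoQ) _.
apply: iso_trans (iso_addA _ _ _) _; apply: iso_trans (iso_sym (iso_addA _ _ _)).
apply: iso_dadd; first exact: iso_refl.
apply: iso_trans (iso_sym (iso_addA _ _ _)) _; apply: iso_trans (iso_addA _ _ _).
by apply: iso_dadd (iso_refl _); apply: iso_addC.
Qed.

(** Totalised so that it can be applied to all modules; zero is a default
    value when X is not a p-permutation module. *)
Definition Tclass0 X : Tgrp F G :=
  if pselect (p_permutation X) is left pX then Tclass (PPmod pX) else 0.

Lemma Tclass0E (X : ppmod F G) : Tclass0 X = Tclass X.
Proof.
rewrite /Tclass0; case: pselect => [pX|]; last by case; apply: ppmod_pperm.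
by congr Tclass; case: X pX => X p1 p2; congr PPmod; apply: Prop_irrelevance.
Qed.

Lemma Tclass0_add X Y Z : p_permutation X -> p_permutation Y -> p_permutation Z ->
  iso Y (dadd_grepr X Z) -> Tclass0 Y = Tclass0 X + Tclass0 Z.
Proof.
move=> pX pY pZ isoY.
rewrite (Tclass0E (PPmod pX)) (Tclass0E (PPmod pY)) (Tclass0E (PPmod pZ)).
exact: (Tclass_dadd (X := PPmod pX) (Y := PPmod pY) (Z := PPmod pZ)).
Qed.

Lemma Tclass0_iso X Y : p_permutation X -> p_permutation Y -> iso X Y -> Tclass0 X = Tclass0 Y.
Proof. exact: additive_rep_iso Tclass0_add pperm_grepr0 X Y. Qed.

Lemma Tclass_iso (X Y : ppmod F G) : iso X Y -> Tclass X = Tclass Y.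
Proof. by move=> isoXY; rewrite -!Tclass0E; apply: Tclass0_iso isoXY; apply: ppmod_pperm. Qed.

Lemma Tclass_dsum (X : ppmod F G) s : iso X (dsum s) -> Tclass X = \sum_(Y <- s) Tclass0 Y.
Proof.
move=> isoX; have ps Y : Y \in s -> p_permutation Y.
  move=> sY; apply: pperm_summand (ppmod_pperm X).
  exact: summand_isor (iso_sym isoX) (dsum_summand sY).
rewrite -(additive_rep_dsum Tclass0_add pperm_grepr0 pperm_dadd ps) -Tclass0E.
apply: Tclass0_iso isoX; first exact: ppmod_pperm.
exact: (closed_dsum pperm_grepr0 pperm_dadd ps).
Qed.

Lemma Tgrp_span (x : Tgrp F G) :
  exists s : seq (int * ppmod F G), x = \sum_(c <- s) Tclass c.2 *~ c.1.
Proof.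
rewrite -[x]pres_reprK -[pres_repr x]freeg_sumE.
exists [seq (coeff z (pres_repr x), z) | z <- dom (pres_repr x)].
rewrite raddf_sum [RHS]big_map; apply: eq_bigr => z _ /=.
by rewrite /Tclass /pgen -raddfMz freeg_mulz /= intz.
Qed.

(** The classes of modules generate the Grothendieck group. *)
Lemma Tgrp_eq (Z : zmodType) (f g : {additive Tgrp F G -> Z}) :
  (forall X : ppmod F G, f (Tclass X) = g (Tclass X)) -> f =1 g.
Proof.
move=> e x; have [s ->] := Tgrp_span x; rewrite !raddf_sum.
by apply: eq_bigr => c _; rewrite !raddfMz e.
Qed.

Lemma indec_exproj_iso X Y : iso X Y -> indec_exprojective X -> indec_exprojective Y.
Proof.
by move=> isoXY [K [nK [P [pP isoX]]]]; exists K, nK, P; split=> //; apply: iso_trans (iso_sym isoXY) isoX.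
Qed.

Lemma indec_exprojectiveP X : indecomposable X -> exprojective X <-> indec_exprojective X.
Proof.
move=> indX; split=> [|exX Y indY /summandP sYX].
  by apply=> //; apply/summandP/iso_summand/iso_refl.
by apply: indec_exproj_iso exX; apply/iso_sym/summand_indec_iso => //; case: indY.
Qed.

Definition components X : seq (representation F G) := projT1 (cid2 (indec_decomposition X)).

Lemma components_indec X Y : Y \in components X -> indecomposable Y.
Proof. by rewrite /components; case: cid2 => s inds isoX; apply: inds. Qed.

Lemma components_iso X : iso X (dsum (components X)).
Proof. by rewrite /components; case: cid2. Qed.

Definition ex_class X : Tgrp F G := if `[< indec_exprojective X >] then Tclass0 X else 0.

(** The value of the projection on a module: the classes of the exprojective
    modules in a decomposition chosen once and for all. *)
Definition ex_part (X : ppmod F G) : Tgrp F G := \sum_(Y <- components X) ex_class Y.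

(** By the Krull-Schmidt theorem any decomposition gives the same value. *)
Lemma ex_part_dsum (X : ppmod F G) s : (forall Y, Y \in s -> indecomposable Y) ->
  iso X (dsum s) -> ex_part X = \sum_(Y <- s) ex_class Y.
Proof.
move=> inds isoX; have isos := iso_trans (iso_sym (components_iso X)) isoX.
have cX := @components_indec X; have pX := ppmod_pperm X.
apply: iso_count_sum => //; last by move=> Y indY; apply: krull_schmidt.
move=> Y Z sY sZ isoYZ; rewrite /ex_class.
have pY : p_permutation Y.
  by apply: pperm_summand pX; apply: summand_isor (iso_sym (components_iso X)) (dsum_summand sY).
have pZ : p_permutation Z.
  by apply: pperm_summand pX; apply: summand_isor (iso_sym isoX) (dsum_summand sZ).
rewrite (Tclass0_iso pY pZ isoYZ); congr (if _ then _ else _).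
by apply/asbool_equiv_eq; split; apply: indec_exproj_iso => //; apply: iso_sym.
Qed.

Lemma ex_part_rel v : @split_rel F gT G v -> fglift ex_part v = 0.
Proof.
case=> X [Y] [Z] [isoY ->]; rewrite !raddfB /= !liftU !scale1r.
have isoYs : iso Y (dsum (components X ++ components Z)).
  apply: iso_trans (iso_sym (iso_dsum_cat _ _)).
  by apply: iso_trans isoY _; apply: iso_dadd; apply: components_iso.
rewrite (ex_part_dsum _ isoYs).
  by rewrite big_cat /= addrAC addrK subrr.
by move=> W; rewrite mem_cat => /orP[]; apply: components_indec.
Qed.

Definition ex_proj : Tgrp F G -> Tgrp F G := pres_lift ex_part.

HB.instance Definition _ := GRing.isZmodMorphism.Build (Tgrp F G) (Tgrp F G)
  ex_proj (pres_lift_is_zmod_morphism ex_part_rel).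

Lemma ex_projE (X : ppmod F G) : ex_proj (Tclass X) = ex_part X.
Proof. exact: (pres_lift_gen ex_part_rel). Qed.

Lemma exproj_component (X : ppmod F G) Y : Y \in components X ->
  indec_exprojective Y -> Tclass0 Y \in @Tex F gT G.
Proof.
move=> XY exY; have pY : p_permutation Y.
  apply: pperm_summand (ppmod_pperm X).
  exact: summand_isor (iso_sym (components_iso X)) (dsum_summand XY).
rewrite (Tclass0E (PPmod pY)); apply: mem_span; exists (PPmod pY) => //.
by apply/indec_exprojectiveP => //; apply: components_indec XY.
Qed.

Lemma Tex_proj_exists : is_Tex_proj ex_proj.
Proof.
split=> [x|x /spanP[s Ss ->]|X indX nexX].
- have [s ->] := Tgrp_span x; rewrite raddf_sum rpred_sum // => -[a X] _ /=.
  rewrite raddfMz rpredMz //. rewrite [X in X \in _]ex_projE /ex_part big_seq rpred_sum // => Y XY.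
  by rewrite /ex_class; case: asboolP => [exY|_]; [apply: exproj_component XY exY | apply: rpred0].
- rewrite raddf_sum big_seq [RHS]big_seq; apply: eq_bigr => -[a y] sc.
  have [X exX ->] := Ss _ sc.
  rewrite -[a]intz scaler_int raddfMz; congr (_ *~ _).
  rewrite /= ex_projE /ex_part (Tclass_dsum (components_iso X)).
  apply: eq_big_seq => Y XY; rewrite /ex_class asboolT //; apply: exX; first exact: components_indec XY.
  apply/summandP; exact: summand_isor (iso_sym (components_iso X)) (dsum_summand XY).
rewrite /= ex_projE (@ex_part_dsum X [:: X : representation F G]).
- rewrite big_seq1 /ex_class asboolF // => exX; case: nexX.
  exact/indec_exprojectiveP.
- by move=> Y; rewrite inE => /eqP->.
exact: iso_add0.
Qed.

Lemma TpiP : is_Tex_proj (@Tpi F gT G).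
Proof.
rewrite /Tpi; case: pselect => [ex|]; last by case; exists ex_proj; apply: Tex_proj_exists.
by case: (cid ex).
Qed.

End Classes.

(** * The induction formula *)

Section Functors.
Variables (F : fieldType) (gT : finGroupType).
Implicit Types G U V : {group gT}.

Lemma Tind_trans G U V (x : Tgrp F U) : U \subset V -> V \subset G ->
  Tind G (Tind V x) = Tind G x.
Proof.
move=> sUV sVG; move: x; apply: (Tgrp_eq (f := @Tind F gT G V \o @Tind F gT V U) (g := @Tind F gT G U)) => X /=.
by rewrite !TindE; apply: Tclass_iso; apply: ind_trans.
Qed.

Lemma Tres_trans G U V (x : Tgrp F G) : U \subset V -> V \subset G ->
  Tres U (Tres V x) = Tres U x.
Proof.
move=> sUV sVG; move: x; apply: (Tgrp_eq (f := @Tres F gT V U \o @Tres F gT G V) (g := @Tres F gT G U)) => X /=.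
rewrite !TresE; apply: Tclass_iso; apply: iso_of_hom_dim => M.
by rewrite !hom_dim_resl ?(subset_trans sUV).
Qed.

Lemma Tres_id G (x : Tgrp F G) : Tres G x = x.
Proof.
move: x; apply: (Tgrp_eq (f := @Tres F gT G G) (g := idfun)) => X /=.
by rewrite TresE; apply: Tclass_iso; apply: iso_of_hom_dim => M; rewrite hom_dim_resl.
Qed.

Lemma Tind_id G (x : Tgrp F G) : Tind G x = x.
Proof.
move: x; apply: (Tgrp_eq (f := @Tind F gT G G) (g := idfun)) => X /=.
by rewrite TindE; apply: Tclass_iso; apply: ind_id.
Qed.

(** The operator that appears in the formula for the group V, before inducing
    to G. *)
Definition mobius_ires V (x : Tgrp F V) : Tgrp F V :=
  \sum_(U : {group gT} | U \subset V) Tind V (Tres U x) *~ (#|U|%:Z * mobius U V).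

Fact mobius_ires_is_zmod_morphism V : zmod_morphism (@mobius_ires V).
Proof.
move=> x y; rewrite /mobius_ires -sumrB; apply: eq_bigr => U _.
by rewrite !raddfB mulrzBl.
Qed.

HB.instance Definition _ V := GRing.isZmodMorphism.Build (Tgrp F V) (Tgrp F V)
  (@mobius_ires V) (@mobius_ires_is_zmod_morphism V).

Lemma mobius_ires_null V (X : ppmod F V) : mobius_null X -> mobius_ires (Tclass X) = 0.
Proof.
move=> nX; have := @additive_relation _ _ V (@p_permutation F gT V) (Tgrp F V) (@Tclass0 F gT V)
  [seq (#|U|%:Z * mobius U V, ind_ppmod V (res_ppmod U X) : representation F V)
     | U <- enum (fun U : {group gT} => U \subset V)].
rewrite big_map big_enum /= => h; rewrite -[RHS]h.
- by apply: eq_bigr => U _; rewrite TresE TindE -Tclass0E.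
- exact: Tclass0_add.
- exact: pperm_grepr0.
- exact: pperm_dadd.
- by move=> c /mapP[U _ ->]; exact: (ppmod_pperm (ind_ppmod V (res_ppmod U X))).
move=> M; rewrite big_map big_enum /= -[RHS](nX M).
by apply: eq_bigr => U sUV; rewrite hom_dim_ind // hom_dim_resl // mulrzz mulrC.
Qed.

End Functors.

Section Integral.
Variables (F : closedFieldType) (p : nat) (charF : p \in [pchar F]) (gT : finGroupType).

(** Decompose X into indecomposable modules: the projection fixes the
    exprojective ones, and both sides vanish on the others, which are null. *)
Lemma mobius_ires_Tpi (V : {group gT}) (x : Tgrp F V) :
  mobius_ires (Tpi F V x) = mobius_ires x.
Proof.
have [_ Tpi_ex Tpi_nex] := TpiP F V.
move: x; apply: (Tgrp_eq (f := @mobius_ires F gT V \o Tpi F V) (g := @mobius_ires F gT V)) => X /=.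
rewrite (Tclass_dsum (components_iso X)) !raddf_sum /=; apply: eq_big_seq => Y XY.
have indY := components_indec XY.
have pY : p_permutation Y.
  apply: pperm_summand (ppmod_pperm X).
  exact: summand_isor (iso_sym (components_iso X)) (dsum_summand XY).
rewrite (Tclass0E (PPmod pY)).
have [exY|nexY] := pselect (indec_exprojective Y).
  rewrite Tpi_ex //; apply: mem_span; exists (PPmod pY) => //.
  exact/indec_exprojectiveP.
rewrite Tpi_nex // ?raddf0; last by move/indec_exprojectiveP; auto.
by rewrite mobius_ires_null //; apply: (mobius_null_nonexprojective charF).
Qed.

(** The formula before division by the order of G. If the projection is left
    out, the sum over V of mu(U, V) vanishes unless U = G, and only #|G| times
    x remains; by mobius_ires_Tpi the projection can be inserted for each V. *)
Lemma Tgrp_induction (G : {group gT}) (x : Tgrp F G) :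
  x *+ #|G| = \sum_(U : {group gT} | U \subset G) \sum_(V : {group gT} | V \subset G)
    Tind G (Tres U (Tpi F V (Tres V x))) *~ (#|U|%:Z * mobius U V).
Proof.
rewrite exchange_big /=.
(* Without the projection, the functors compose and the sum over V involves
   only mu(U, V). *)
transitivity (\sum_(V : {group gT} | V \subset G) Tind G (mobius_ires (Tres V x))).
  transitivity (\sum_(V : {group gT} | V \subset G) \sum_(U : {group gT} | U \subset V)
      Tind G (Tres U x) *~ (#|U|%:Z * mobius U V)); last first.
    apply: eq_bigr => V sVG; rewrite raddf_sum; apply: eq_bigr => U sUV.
    by rewrite raddfMz /= Tind_trans // Tres_trans.
  rewrite (exchange_big_dep (fun U : {group gT} => U \subset G)) /=; last first.
    by move=> V U sVG sUV; apply: subset_trans sVG.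
  rewrite (bigD1 G) //= [X in _ = _ + X]big1 ?addr0 => [|U /andP[sUG neq]].
    rewrite (big_pred1 G) => [|V]; last first.
      by rewrite -eqEsubset -val_eqE.
    by rewrite mobius_refl mulr1 Tres_id Tind_id.
  rewrite -mulrz_sumr -mulr_sumr (eq_bigl (fun V : {group gT} => (U \subset V) && (V \subset G))); last first.
    by move=> V; rewrite andbC.
  rewrite sum_mobius ?mulr0 //.
  by rewrite properEneq sUG andbT; apply: contra neq => /eqP e; apply/eqP/val_inj.
apply: eq_bigr => V sVG; rewrite -mobius_ires_Tpi raddf_sum.
rewrite [LHS]big_mkcond [RHS]big_mkcond /=; apply: eq_bigr => U _.
case: ifP => [sUV|nsUV].
  by rewrite (subset_trans sUV sVG) raddfMz /= Tind_trans.
by rewrite mobius_notsub ?nsUV // mulr0 mulr0z if_same.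
Qed.

End Integral.

Theorem corollary3p2 (p : nat) (F : closedFieldType) (K : fieldType)
    (frakK : forall gT : finGroupType, {group gT} -> Prop)
    (p_prime : prime p)
    (charF : p \in [pchar F])
    (frakK_sub : forall (gT : finGroupType) (G H : {group gT}),
       frakK gT G -> H \subset G -> frakK gT H)
    (charK : [pchar K] =i pred0)
    (splitK : forall (gT : finGroupType) (G : {group gT}),
       frakK gT G -> group_splitting_field K G)
    (gT : finGroupType) (G : {group gT}) (X : ppmod F G) :
  frakK gT G ->
  ext1 K (Tclass X) =
    (#|G|%:R : K)^-1 *:
      \sum_(U : {group gT} | U \subset G) \sum_(V : {group gT} | V \subset G)
        (#|U|%:R * (mobius U V)%:~R : K) *:
          extmap K (@Tind F gT G U)
            (extmap K (@Tres F gT V U)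
               (extmap K (@Tpi F gT V)
                  (extmap K (@Tres F gT G V) (ext1 K (Tclass X))))).
Proof.
move=> _; have G0 : #|G|%:R != 0 :> K by rewrite ((pcharf0P K).1 charK) -lt0n.
apply: (canRL (scalerK G0)).
rewrite scaler_nat -raddfMn (Tgrp_induction charF) raddf_sum; apply: eq_bigr => U _.
rewrite raddf_sum; apply: eq_bigr => V _.
by rewrite !extmapE raddfMz -scaler_int intrM.
Qed.
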